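(* Let $m\ge1$, $d\ge0$, $k=\mathbb{F}_q$ and $R=R_{2,2m}=k[[X,Y]]/(Y(Y-X^m))$. With $t:=q^{-s}$, $$\nu^R_{R^d}(s)=\sum_{\lambda,\mu}g^{(m^d)}_\lambda(q)\,g^\lambda_\mu(q)\,\frac{(q^{-1};q^{-1})_{\lambda'_m}}{(q^{-1};q^{-1})_{\mu'_m}}\,(t;q)^2_{d-\lambda'_m}\,t^{|\lambda|}\,(q^dt)^{|\lambda|-|\mu|},$$ where the sum is over all partitions $\lambda,\mu$ (only those with $\mu\subseteq\lambda\subseteq(m^d)$ contribute).
   Context: Let $\widetilde{R}\simeq k[[T_1]]\times k[[T_2]]$ be the normalization of $R$. $\zeta^R_{R^d}(s)=\sum_N|R^d/N|^{-s}$ is the sum over finite-index $R$-submodules $N\subseteq R^d$, $\zeta^{\widetilde{R}}_{\widetilde{R}^d}(s)=\sum_N|\widetilde{R}^d/N|^{-s}$ is the sum over finite-index $\widetilde{R}$-submodules $N\subseteq\widetilde{R}^d$ (it equals $(t;q)_d^{-2}$), and $\nu^R_{R^d}(s)=\zeta^R_{R^d}(s)/\zeta^{\widetilde{R}}_{\widetilde{R}^d}(s)$. $(a;q)_n=\prod_{j=0}^{n-1}(1-aq^j)$. For a partition $\lambda$: $|\lambda|$ is its size, $\lambda'$ its conjugate (so $\lambda'_i$ is the number of parts $\ge i$), $\mu\subseteq\lambda$ is containment of Young diagrams, and $(m^d)=(m,\dots,m)$ ($d$ parts). The skew Hall polynomial $g^\lambda_\mu(q)$ is the number of submodules of type $\mu$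 in a fixed module of type $\lambda$ over a DVR $(V,\pi)$ with residue field $\mathbb{F}_q$ (type $\lambda$ means isomorphic to $\bigoplus_iV/\pi^{\lambda_i}V$). Explicitly, $$g^\lambda_\mu(q)=q^{\sum_{i\ge1}\mu'_i(\lambda'_i-\mu'_i)}\prod_{i\ge1}\genfrac{[}{]}{0pt}{}{\lambda'_i-\mu'_{i+1}}{\lambda'_i-\mu'_i}_{q^{-1}},\qquad \genfrac{[}{]}{0pt}{}{n}{k}_q=\frac{(q;q)_n}{(q;q)_k(q;q)_{n-k}},$$ and it is zero unless $\mu\subseteq\lambda$. *)

(* Defs.v *)
From HB Require Import structures.
From mathcomp Require Import all_boot all_order all_algebra finmap.
From mathcomp Require Import boolp classical_sets functions cardinality fsbigop.

Set Implicit Arguments.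
Unset Strict Implicit.
Unset Printing Implicit Defensive.

Import GRing.Theory.
Local Open Scope ring_scope.

(* * Formal power series in one variable *)

Record fps (R : Type) : Type := Fps { fcoef : nat -> R }.

HB.instance Definition _ (R : Type) := gen_eqMixin (fps R).
HB.instance Definition _ (R : Type) := gen_choiceMixin (fps R).

Lemma fpsP (R : Type) (f g : fps R) :
  (forall n, fcoef f n = fcoef g n) -> f = g.
Proof. by case: f g => [f] [g] /= fg; congr Fps; apply/funext. Qed.

Section FpsRing.
Variable R : comNzRingType.
Implicit Types f g h : fps R.

Definition fpsC (c : R) : fps R := Fps (fun n => if n == 0%N then c else 0).
Definition fpsX : fps R := Fps (fun n => (n == 1%N)%:R).

Definition fps_opp f : fps R := Fps (fun n => - fcoef f n).
Definition fps_add f g : fps R := Fps (fun n => fcoef f n + fcoef g n).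
Definition fps_mul f g : fps R :=
  Fps (fun n => \sum_(i < n.+1) fcoef f i * fcoef g (n - i)).

Lemma fps_addA : associative fps_add.
Proof. by move=> f g h; apply: fpsP => n /=; rewrite addrA. Qed.
Lemma fps_addC : commutative fps_add.
Proof. by move=> f g; apply: fpsP => n /=; rewrite addrC. Qed.
Lemma fps_add0 : left_id (fpsC 0) fps_add.
Proof. by move=> f; apply: fpsP => n /=; rewrite if_same add0r. Qed.
Lemma fps_addN : left_inverse (fpsC 0) fps_opp fps_add.
Proof. by move=> f; apply: fpsP => n /=; rewrite if_same addNr. Qed.

HB.instance Definition _ :=
  GRing.isZmodule.Build (fps R) fps_addA fps_addC fps_add0 fps_addN.

Let trunc N f : {poly R} := \poly_(i < N) fcoef f i.

Let coef_trunc N f i : (i < N)%N -> (trunc N f)`_i = fcoef f i.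
Proof. by move=> iN; rewrite coef_poly iN. Qed.

Let coef_trunc_mul N f g i : (i < N)%N ->
  (trunc N f * trunc N g)`_i = fcoef (fps_mul f g) i.
Proof.
move=> iN; rewrite coefM; apply: eq_bigr => j _; rewrite !coef_trunc //.
  exact: leq_ltn_trans (leq_subr _ _) iN.
by apply: leq_ltn_trans iN; rewrite -ltnS.
Qed.

Lemma fps_mulC : commutative fps_mul.
Proof.
move=> f g; apply: fpsP => n.
by rewrite -!(coef_trunc_mul _ _ (ltnSn n)) mulrC.
Qed.

Lemma fps_mulA : associative fps_mul.
Proof.
move=> f g h; apply: fpsP => n.
transitivity ((trunc n.+1 f * trunc n.+1 g * trunc n.+1 h)`_n).
  rewrite -mulrA coefM /=; apply: eq_bigr => i _.
  by rewrite coef_trunc // coef_trunc_mul // ltnS leq_subr.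
rewrite coefM /=; apply: eq_bigr => i _.
by rewrite coef_trunc_mul // coef_trunc // ltnS leq_subr.
Qed.

Lemma fps_mul1 : left_id (fpsC 1) fps_mul.
Proof.
move=> f; apply: fpsP => n /=; rewrite big_ord_recl /= mul1r subn0.
by rewrite big1 ?addr0 // => i _; rewrite mul0r.
Qed.

Lemma fps_mulDl : left_distributive fps_mul +%R.
Proof.
move=> f g h; apply: fpsP => n /=; rewrite -big_split /=.
by apply: eq_bigr => i _; rewrite mulrDl.
Qed.

Lemma fps_1_neq0 : fpsC 1 != 0.
Proof.
apply/eqP => /(congr1 (fun f => fcoef f 0)) /= /eqP; exact/negP/oner_neq0.
Qed.

HB.instance Definition _ := GRing.Zmodule_isComNzRing.Build (fps R)
  fps_mulA fps_mulC fps_mul1 fps_mulDl fps_1_neq0.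

Lemma fcoef_mul f g n :
  fcoef (f * g) n = \sum_(i < n.+1) fcoef f i * fcoef g (n - i).
Proof. by []. Qed.

Lemma fcoef0_mul f g : fcoef (f * g) 0 = fcoef f 0 * fcoef g 0.
Proof. by rewrite fcoef_mul big_ord1. Qed.

End FpsRing.

Section FpsUnitRing.
Variable R : comUnitRingType.
Implicit Types f g : fps R.

Definition fps_unit : pred (fps R) := fun f => fcoef f 0 \is a GRing.unit.

(* The first [n.+1] coefficients of the inverse series. *)
Fixpoint fps_inv_seq f (n : nat) : seq R :=
  if n is n'.+1 then
    let s := fps_inv_seq f n' in
    rcons s (- (fcoef f 0)^-1 * \sum_(i < n) fcoef f (n - i) * s`_i)
  else [:: (fcoef f 0)^-1].

Definition fps_inv f : fps R :=
  if fps_unit f then Fps (fun n => (fps_inv_seq f n)`_n) else f.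

Let size_fps_inv_seq f n : size (fps_inv_seq f n) = n.+1.
Proof. by elim: n => //= n IH; rewrite size_rcons IH. Qed.

Let nth_fps_inv_seq f n i : (i <= n)%N ->
  (fps_inv_seq f n)`_i = (fps_inv_seq f i)`_i.
Proof.
elim: n => [|n IH]; first by rewrite leqn0 => /eqP ->.
rewrite leq_eqVlt => /predU1P [-> //|]; rewrite ltnS => le_in.
by rewrite /= nth_rcons size_fps_inv_seq ltnS le_in IH.
Qed.

Lemma fps_mulVr : {in fps_unit, left_inverse 1 fps_inv *%R}.
Proof.
move=> f Uf; have Uf0 : fcoef f 0 \is a GRing.unit by [].
rewrite mulrC /fps_inv (_ : fps_unit f = true) //; apply: fpsP => n.
rewrite fcoef_mul; under eq_bigr => i _ do rewrite /=.
case: n => [|n]; first by rewrite big_ord1 /= divrr.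
rewrite big_ord_recl subn0 /= nth_rcons size_fps_inv_seq ltnn eqxx.
rewrite mulrA mulrN divrr // mulN1r addrC.
apply/eqP; rewrite subr_eq0; apply/eqP.
rewrite (reindex_inj rev_ord_inj) /=; apply: eq_bigr => i _.
have le_in : (i <= n)%N by rewrite -ltnS.
have -> : bump 0 (n.+1 - i.+1) = (n.+1 - i)%N.
  by rewrite /bump add1n subSS subSn.
by rewrite subKn ?(leqW le_in) // (nth_fps_inv_seq _ le_in).
Qed.

Lemma fps_unitP f g : g * f = 1 -> fps_unit f.
Proof.
move=> /(congr1 (fun h => fcoef h 0)); rewrite fcoef0_mul => gf1.
by apply/unitrPr; exists (fcoef g 0); rewrite mulrC gf1.
Qed.

Lemma fps_inv_out : {in [predC fps_unit], fps_inv =1 id}.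
Proof. by move=> f /negbTE nUf; rewrite /fps_inv ifF. Qed.

HB.instance Definition _ := GRing.ComNzRing_hasMulInverse.Build (fps R)
  fps_mulVr fps_unitP fps_inv_out.

End FpsUnitRing.

(* * The ring R_{2,2m} = k[[X,Y]] / (Y (Y - X^m)) *)

Section SingularRing.
Variables (k : fieldType) (m : nat).

(* k[[X,Y]] is realized as k[[X]][[Y]]. *)
Definition fps2 : comNzRingType := fps (fps k).
Definition varX : fps2 := fpsC (fpsX k).
Definition varY : fps2 := fpsX (fps k).

Definition Rrel : fps2 := varY * (varY - varX ^+ m).

Definition Rideal : {pred fps2} := [pred f | `[< exists g, f = g * Rrel >]].

Lemma RidealP f : reflect (exists g, f = g * Rrel) (f \in Rideal).
Proof. exact: asboolP. Qed.

Lemma Rideal_closed : idealr_closed Rideal.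
Proof.
split=> [||a f g /RidealP[b ->] /RidealP[c ->]].
- by apply/RidealP; exists 0; rewrite mul0r.
- apply/negP => /RidealP[g] /(congr1 (fun f => fcoef f 0)).
  rewrite mulrC -mulrA fcoef0_mul [fcoef varY 0]/= mul0r => /eqP.
  exact/negP/oner_neq0.
- by apply/RidealP; exists (a * b + c); rewrite mulrDl mulrA.
Qed.

HB.instance Definition _ := isIdealr.Build fps2 Rideal Rideal_closed.

Definition R22 : comNzRingType := {ideal_quot Rideal}.

End SingularRing.

(* * Normalization *)

(* [j] exhibits [Q] as the total ring of fractions of [A], i.e. the localization
   of [A] at its non-zero-divisors ([GRing.lreg a]: multiplication by [a] is
   injective). *)
Definition is_total_fractions (A : comNzRingType) (Q : comUnitRingType)
    (j : {rmorphism A -> Q}) : Prop :=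
  [/\ injective j,
      forall a, GRing.lreg a -> j a \is a GRing.unit &
      forall x, exists a b, GRing.lreg a /\ x = j b / j a].

(* [B] is isomorphic to the integral closure of [A] in its total ring of
   fractions. *)
Definition is_normalization (A B : comNzRingType) : Prop :=
  exists (Q : comUnitRingType) (j : {rmorphism A -> Q})
         (e : {rmorphism B -> Q}),
    [/\ is_total_fractions j, injective e &
        forall x, (exists b, e b = x) <-> integralOver j x].

(* * Zeta functions *)

Section Zeta.
Local Open Scope classical_set_scope.

Definition submodule (A : pzRingType) (M : lmodType A) (N : set M) : Prop :=
  submod_closed [in N].

Definition cosets (A : pzRingType) (M : lmodType A) (N : set M) : set (set M) :=
  [set [set x + y | y in N] | x in [set: M]].

Definition has_index (A : pzRingType) (M : lmodType A) (N : set M) (n : nat) :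
    Prop :=
  (cosets N #= `I_n)%card.

Definition submodules_of_index (A : pzRingType) (M : lmodType A) (n : nat) :
    set (set M) :=
  [set N | submodule N /\ has_index N n].
Arguments submodules_of_index {A} M n _.

(* The series sum_N |M/N|^{-s} as a formal power series in t = q^{-s}: for a
   module over a k-algebra with #|k| = q, a finite index |M/N| is a power q^n,
   and then |M/N|^{-s} = t^n.  [fset_set] of an infinite set is empty, but all
   the sets counted are finite for a finitely generated M over R22 or over its
   normalization. *)
Definition zeta (q : nat) (A : pzRingType) (M : lmodType A) : fps rat :=
  Fps (fun n => (#|` fset_set (submodules_of_index M (q ^ n)%N) |%fset)%:R).

Definition nu (q d : nat) (A At : comNzRingType) : fps rat :=
  zeta q 'rV[A]_d / zeta q 'rV[At]_d.

End Zeta.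

(* * q-series and partitions *)

Definition qpoch (A : comPzRingType) (a q : A) (n : nat) : A :=
  \prod_(j < n) (1 - a * q ^+ j).

Definition qbinom (F : fieldType) (q : F) (n r : nat) : F :=
  qpoch q q n / (qpoch q q r * qpoch q q (n - r)).

(* A partition is the weakly decreasing sequence of its positive parts. *)
Definition is_partition (l : seq nat) : bool :=
  sorted geq l && all (leq 1) l.

Definition conj_part (l : seq nat) (i : nat) : nat := count (leq i) l.

Definition part_sub (mu l : seq nat) : bool :=
  all (fun i => nth 0 mu i <= nth 0 l i)%N (iota 0 (size mu)).

(* For [i > head 0 l] both [conj_part]s vanish, so these indices contribute
   trivially to the sum and the product. *)
Definition skew_hall (q : rat) (l mu : seq nat) : rat :=
  if part_sub mu l then
    q ^+ (\sum_(1 <= i < (head 0 l).+1)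
            conj_part mu i * (conj_part l i - conj_part mu i))%N *
    \prod_(1 <= i < (head 0 l).+1)
       qbinom q^-1 (conj_part l i - conj_part mu i.+1)
                   (conj_part l i - conj_part mu i)
  else 0.

(* Main.v *)
Require Import Defs.
From HB Require Import structures.
From mathcomp Require Import all_boot all_order all_algebra all_field finmap.
From mathcomp Require Import boolp classical_sets functions cardinality fsbigop.
From mathcomp Require Import zify ring.

(** Write V = k[[X]] and q for the number of elements of k. The two branches
    Y = 0 and Y = X^m of the curve embed R in V x V as the ring of the pairs
    (a, b) with a = b modulo X^m ([branches]), and the normalization of R is
    V x V ([normalization_branch_ring]). So both zeta functions count
    submodules N of V^d x V^d stable under X and under (0, X^mu), with mu = m
    for R and mu = 0 for the normalization ([fcoef_zeta_branch]). As a submodule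
    of index q^n contains the multiples of X^(q^n), each coefficient is a count in
    finite dimension, of subspaces stable under nilpotent operators.

    A submodule N of R^d has the following data: its projections N1 and N2
    on the two factors V^d, the common lattice L = N1 + X^m V^d = N2 + X^m V^d,
    and K1 = {a | (a, 0) in N}, which lies between X^m N1 and
    S1 = N1 cap X^m V^d. Let lambda be the type of V^d / L, and mu that of
    K1 / X^m N1. The number of N is found by counting the data from L down.

    - The number of L is the Hall number of lambda in (m^d)
      ([card_hulls], [skew_hall_rect]).
    - With r = lambda'_m, the lattices N1 with N1 + X^m V^d = L have
      (t;q)_{d-r} / (t;q)_d as generating series in the colength in L
      ([card_spanning_lattices]), and so do the N2.
    - S1 / X^m N1 has type lambda ([mtype_kernel]), so the number of K1 is
      the Hall number of mu in lambda ([card_submodules_type]).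
    - N is determined by these data and a surjection from N2 to N1 / K1
      that lifts the projection to L / X^m V^d. As N2 is free of rank d modulo
      X^m, there are q^(d (|lambda| - |mu|)) lifts; they are onto with probability
      (q^-1;q^-1)_{lambda'_m} / (q^-1;q^-1)_{mu'_m} ([card_lifts]).

    The colength of N is 2 |lambda| - |mu| plus the colengths of N1 and N2
    in L ([dim_Rsub]). Hence the terms of the formula, after division by the
    zeta function (t;q)_d^-2 of the normalization ([zeta_normalization]).

    All the counts rest on one lemma of linear algebra: if E <= A <= B, then
    q^((dim B - dim A) (dim A - dim E)) subspaces N satisfy N cap A = E
    and N + A = B ([card_complements]). Gaussian binomials, spanning lattices,
    submodules of given type and lifts are all counted by peeling off one
    layer, where this lemma applies. *)

Set Implicit Arguments.
Unset Strict Implicit.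
Unset Printing Implicit Defensive.

Import GRing.Theory Num.Theory VectorInternalTheory.
Local Open Scope ring_scope.

Ltac clia := clear; lia.

(** * Counting subspaces over a finite field *)
HB.instance Definition _ (k : finFieldType) (T : vectType k) :=
  [Countable of {vspace T} by <:].
HB.instance Definition _ (k : finFieldType) (T : vectType k) :=
  [Finite of {vspace T} by <:].

Lemma card_uniform_fibers (I J : finType) (A : {set I}) (D : {set J})
    (f : I -> J) (c : nat) :
    (forall i, i \in A -> f i \in D) ->
    (forall j, j \in D -> #|[set i in A | f i == j]| = c) ->
  #|A| = (#|D| * c)%N.
Proof.
move=> fAD cf; rewrite -sum1_card (partition_big f (mem D)) //=.
rewrite -sum_nat_const; apply: eq_bigr => j jD.
by rewrite -(cf j jD) -sum1_card; apply: eq_bigl => i; rewrite inE.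
Qed.

Lemma card_uniform_fibers_natr (R : pzSemiRingType) (I J : finType)
    (A : {set I}) (D : {set J}) (f : I -> J) (c : R) :
    (forall i, i \in A -> f i \in D) ->
    (forall j, j \in D -> #|[set i in A | f i == j]|%:R = c) ->
  #|A|%:R = #|D|%:R * c.
Proof.
move=> fAD cf; rewrite -sum1_card (partition_big f (mem D)) //=.
rewrite natr_sum -sumr_const mulr_suml; apply: eq_bigr => j jD.
rewrite mul1r -(cf j jD) -sum1_card; congr _%:R.
by apply: eq_bigl => i; rewrite inE.
Qed.

Section Subspaces.
Variables (k : finFieldType) (T : vectType k).
Implicit Types (A B E N : {vspace T}).
Local Notation q := #|k|.

Lemma card_mem_vspace A : #|[set x : finvect_type T | x \in A]| = (q ^ \dim A)%N.
Proof.
case: T A => S cS A; rewrite -(@card_vspace k (finvect_type (Vector.Pack cS)) cS A).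
by apply: eq_card => x; rewrite inE.
Qed.

Lemma addvAC A B E : (A + B + E = A + E + B)%VS.
Proof. by rewrite -addvA [(B + E)%VS]addvC addvA. Qed.

Lemma cap_line_out A v : v \notin A -> (<[v]> :&: A = 0)%VS.
Proof.
move=> Av; apply/eqP; rewrite -subv0; apply/subvP => x; rewrite memv_cap => /andP[].
case/vlineP => a ->; have [-> _|a0] := eqVneq a 0; first by rewrite scale0r mem0v.
by move=> /(memvZ a^-1); rewrite scalerA mulVf // scale1r (negPf Av).
Qed.

(** N is E plus a line: fix v in B outside A; N contains v + c for a unique c
    in a complement of E in A. *)
Lemma card_line_complements E A B :
    (E <= A)%VS -> (A <= B)%VS -> \dim B = (\dim A).+1 ->
  #|[set N : {vspace T} | (N :&: A == E)%VS && (N + A == B)%VS]| =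
    (q ^ (\dim A - \dim E))%N.
Proof.
move=> sEA sAB dB.
have /subvPn[v Bv Av] : ~~ (B <= A)%VS.
  by apply/negP => /dimvS; rewrite dB ltnn.
have defB : (<[v]> + A = B)%VS.
  apply/eqP; rewrite eqEdim subv_add sAB andbT -memvE Bv /= dB.
  rewrite dimv_disjoint_sum ?dim_vline; last first.
    exact: cap_line_out.
  by case: eqVneq Av => [->|]; rewrite ?mem0v.
pose C := (A :\: E)%VS.
have dC : \dim C = (\dim A - \dim E)%N.
  by rewrite -(dimv_cap_compl A E) (capv_idPr sEA) addKn.
rewrite -dC -card_mem_vspace.
pose f (c : finvect_type T) : {vspace T} := (E + <[v + (c : T)]>)%VS.
have vA (c : T) : c \in A -> v + c \notin A.
  by move=> Ac; apply: contra Av => /memvB/(_ Ac); rewrite addrK.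
have sCA : (C <= A)%VS by exact: diffvSl.
have capE (c : T) : c \in A -> ((E + <[(v + c)%R]>) :&: A = E)%VS.
  move=> Ac; rewrite -vspace_modl //.
  by rewrite cap_line_out ?addv0 ?vA.
have <- : f @: [set x : finvect_type T | x \in C] =
   [set N : {vspace T} | (N :&: A == E)%VS && (N + A == B)%VS].
  apply/setP => N; rewrite inE; apply/imsetP/andP => [[c] | [/eqP NA /eqP NB]].
    rewrite inE => Cc ->; have Ac := subvP sCA _ Cc; split; first exact/eqP/capE.
    rewrite /f eqEsubv !subv_add (subv_trans sEA sAB) sAB andbT -memvE memvD //=;
      last exact: (subvP sAB).
    rewrite -defB subv_add addvSr andbT -memvE.
    suff: (v + c) + - c \in (E + <[(v + c)%R]> + A)%VS by rewrite addrK.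
    by rewrite memv_add ?memvN // (subvP (addvSr _ _)) ?memv_line.
  have: v \in (N + A)%VS by rewrite NB.
  case/memv_addP => n Nn [a Aa va].
  have: - a \in A by rewrite memvN.
  rewrite -(addv_diff_cap A E) (capv_idPr sEA) -/C => /memv_addP[c Cc [e Ee ace]].
  have aE : a = - (c + e) by rewrite -ace opprK.
  have vce : v + c = n - e.
    by rewrite va aE opprD -!addrA [- e + c]addrC addKr.
  exists (c : finvect_type T); first by rewrite inE.
  have sEN : (E <= N)%VS by rewrite -NA capvSl.
  apply/eqP; rewrite eq_sym eqEsubv; apply/andP; split.
    by rewrite subv_add sEN -memvE vce memvB // (subvP sEN).
  apply/subvP => x Nx.
  have: x \in (<[v]> + A)%VS by rewrite defB -NB (subvP (addvSl _ _)).
  case/memv_addP => _ /vlineP[b ->] [a' Aa' xE].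
  apply/memv_addP; exists (x - b *: (v + c)); last first.
    by exists (b *: (v + c)); [exact/memvZ/memv_line | rewrite subrK].
  have Nvc : v + c \in N by rewrite vce memvB // (subvP sEN).
  rewrite -NA memv_cap memvB ?memvZ //=.
  have -> : x - b *: (v + c) = a' - b *: c.
    by rewrite xE scalerDr opprD addrACA subrr add0r.
  by rewrite memvB // memvZ // (subvP sCA).
rewrite card_in_imset // => c c'; rewrite !inE => Cc Cc' /= eqf.
have Ac := subvP sCA _ Cc; have Ac' := subvP sCA _ Cc'.
have: (c : T) - c' \in (E :&: C)%VS.
  rewrite memv_cap; apply/andP; split; last exact: memvB.
  suff: (c : T) - c' \in ((E + <[(v + c)%R]>) :&: A)%VS by rewrite capE.
  rewrite memv_cap; apply/andP; split; last exact: memvB.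
  have -> : (c - c' : T) = (v + c) - (v + c').
    by rewrite opprD addrA [v + _]addrC addrK.
  rewrite memvB //; first by apply: (subvP (addvSr _ _)); exact: memv_line.
  by rewrite -/(f c) eqf; apply: (subvP (addvSr _ _)); exact: memv_line.
by rewrite capvC capv_diff memv0 subr_eq0 => /eqP.
Qed.

Lemma exists_hyperplane A B : (A <= B)%VS -> (\dim A < \dim B)%N ->
  exists B', [/\ (A <= B')%VS, (B' <= B)%VS & \dim B = (\dim B').+1].
Proof.
move=> sAB ltAB; have /subvPn[v Bv Av] : ~~ (B <= A)%VS.
  by apply/negP => /dimvS; rewrite leqNgt ltAB.
pose D := (B :\: (A + <[v]>))%VS.
have sAvB : (A + <[v]> <= B)%VS by rewrite subv_add sAB -memvE.
have v0 : v != 0 by apply: contraNneq Av => ->; rewrite mem0v.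
have dAv : \dim (A + <[v]>) = (\dim A).+1.
  by rewrite addvC dimv_disjoint_sum ?dim_vline ?v0 // cap_line_out.
exists (A + D)%VS; split; first exact: addvSl.
  by rewrite subv_add sAB diffvSl.
rewrite dimv_disjoint_sum; last first.
  apply/eqP; rewrite -subv0 -(capv_diff B (A + <[v]>)%VS) -/D capvC.
  by rewrite capvS // addvSl.
have := dimv_cap_compl B (A + <[v]>)%VS; rewrite (capv_idPr sAvB) -/D; lia.
Qed.

(** Such N form a torsor under Hom (B / A, A / E). The proof peels hyperplanes
    containing A off B, each with the factor of [card_line_complements]. *)
Lemma card_complements E A B : (E <= A)%VS -> (A <= B)%VS ->
  #|[set N : {vspace T} | (N :&: A == E)%VS && (N + A == B)%VS]| =
    (q ^ ((\dim B - \dim A) * (\dim A - \dim E)))%N.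
Proof.
move=> sEA; move En: (\dim B - \dim A)%N => n.
elim: n B En => [|n IHn] B En sAB.
  have -> : B = A by apply/eqP; rewrite eq_sym eqEdim sAB; lia.
  rewrite mul0n expn0; apply/eqP/cards1P; exists E; apply/setP => N; rewrite !inE.
  apply/andP/eqP => [[/eqP <- /eqP/addv_idPr sNA] | ->]; first by rewrite (capv_idPl sNA).
  by rewrite (capv_idPl sEA) (addv_idPr sEA).
have [|B' [sAB' sB'B dB]] := exists_hyperplane sAB; first lia.
rewrite mulSn addnC expnD -(IHn B') //; last lia.
apply: (card_uniform_fibers (f := fun N => N :&: B')%VS) => [N|M].
  rewrite !inE => /andP[/eqP NA /eqP NB].
  rewrite -capvA (capv_idPr sAB') NA eqxx /= capvC vspace_modr // NB.
  exact/eqP/capv_idPl.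
rewrite inE => /andP[/eqP MA /eqP MB'].
have dM : (\dim B' - \dim M = \dim A - \dim E)%N.
  have := dimv_sum_cap M A; rewrite MA MB'.
  by have := dimvS sEA; have := dimvS sAB'; lia.
have sMB' : (M <= B')%VS by rewrite -MB' addvSl.
rewrite -dM -(card_line_complements sMB' sB'B dB); apply: eq_card => N; rewrite !inE.
apply/andP/andP => [[/andP[/eqP NA /eqP NB] /eqP NB'] | [/eqP NB' /eqP NB]].
  rewrite NB' eqxx eqEsubv subv_add sB'B -[in X in (N <= X)%VS]NB addvSl /=.
  by rewrite -NB addvS.
rewrite NB' eqxx -{1}(capv_idPr sAB') capvA NB' MA eqxx; split=> //=.
have sNB : (N <= B)%VS by rewrite -NB addvSl.
rewrite eqEsubv subv_add sNB sAB -NB subv_add addvSl /= -MB' subv_add addvSr andbT.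
by rewrite -NB' (subv_trans (capvSl _ _)) ?addvSl.
Qed.

(** The Gaussian binomial coefficient, by the q-Pascal rule. *)
Fixpoint gauss_bin (b n j : nat) : nat :=
  match n, j with
  | _, 0 => 1
  | 0, _.+1 => 0
  | n'.+1, j'.+1 => gauss_bin b n' j'.+1 + b ^ (n' - j') * gauss_bin b n' j'
  end.

(** The q-Pascal rule: fix a hyperplane B' of B containing A; N either lies in
    B' or meets it in codimension 1. *)
Lemma card_grassmannian A B j : (A <= B)%VS ->
  #|[set N : {vspace T} | [&& (A <= N)%VS, (N <= B)%VS & \dim N == (\dim A + j)%N]]| =
    gauss_bin q (\dim B - \dim A) j.
Proof.
move En: (\dim B - \dim A)%N => n; elim: n j B En => [|n IHn] j B En sAB.
  have -> : B = A by apply/eqP; rewrite eq_sym eqEdim sAB; lia.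
  case: j => [|j] /=.
    apply/eqP/cards1P; exists A; apply/setP => N; rewrite !inE addn0.
    by apply/and3P/eqP => [[sAN sNA _]|->]; [apply/eqP; rewrite eqEsubv sAN sNA | rewrite subvv eqxx].
  apply/eqP; rewrite cards_eq0 -finset.subset0; apply/fintype.subsetP => N; rewrite !inE.
  by move=> /and3P[_ /dimvS sNA /eqP]; lia.
case: j => [|j] /=.
  apply/eqP/cards1P; exists A; apply/setP => N; rewrite !inE addn0.
  apply/and3P/eqP => [[sAN _ /eqP dN]|->]; last by rewrite subvv sAB eqxx.
  by apply/eqP; rewrite eq_sym eqEdim sAN dN /=.
have [|B' [sAB' sB'B dB]] := exists_hyperplane sAB; first lia.
rewrite -(IHn j.+1 B') //; last lia.
rewrite -[LHS](cardsID [set N | (N <= B')%VS]); congr (_ + _)%N.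
  apply: eq_card => N; rewrite !inE; case: (A <= N)%VS => //=.
  case sNB': (N <= B')%VS; last by rewrite andbF.
  by rewrite (subv_trans sNB' sB'B) andbT.
rewrite mulnC -(IHn j B') //; last lia.
apply: (card_uniform_fibers (f := fun N => N :&: B')%VS) => [N|M].
  rewrite !inE => /and4P[sNB' sAN sNB /eqP dN].
  rewrite subv_cap sAN sAB' capvSr /=.
  have := dimv_sum_cap N B'.
  have -> : (N + B' = B)%VS; last lia.
  apply/eqP; rewrite eqEdim subv_add sNB sB'B /= dB ltnNge.
  apply: contra sNB' => le; apply/addv_idPr/eqP.
  by rewrite eq_sym eqEdim addvSr.
rewrite inE => /and3P[sAM sMB' /eqP dM].
have -> : (n - j = \dim B' - \dim M)%N by lia.
rewrite -(card_line_complements sMB' sB'B dB); apply: eq_card => N; rewrite !inE.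
apply/andP/andP => [[/and4P[sNB' sAN sNB /eqP dN] /eqP NB'] | [/eqP NB' /eqP NB]].
  rewrite NB' eqxx; split => //.
  rewrite eqEdim subv_add sNB sB'B /=.
  by have := dimv_sum_cap N B'; rewrite NB'; lia.
have sMN : (M <= N)%VS by rewrite -NB' capvSl.
have sNB : (N <= B)%VS by rewrite -NB addvSl.
rewrite NB' eqxx sNB (subv_trans sAM sMN); split => //=; apply/andP; split.
  by apply/negP => /addv_idPr sN; move: NB dB; rewrite sN => ->; lia.
by have := dimv_sum_cap N B'; rewrite NB' NB; lia.
Qed.

(** P is chosen through its trace on W, then as a complement above that trace. *)
Lemma card_supplements A W B j : (A <= W)%VS -> (W <= B)%VS ->
    (j <= \dim W - \dim A)%N ->
  #|[set P : {vspace T} | [&& (A <= P)%VS, (P + W == B)%VS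
                            & (\dim P + j)%N == \dim B]]| =
    (gauss_bin q (\dim W - \dim A) (\dim W - \dim A - j) *
      q ^ (j * (\dim B - \dim W)))%N.
Proof.
move=> sAW sWB le_j; have leAW := dimvS sAW; have leWB := dimvS sWB.
rewrite -(card_grassmannian _ sAW).
apply: (card_uniform_fibers (f := fun N => N :&: W)%VS) => [N|E].
  rewrite !inE => /and3P[sAN /eqP NB /eqP dN].
  rewrite subv_cap sAN sAW capvSr /=.
  by have := dimv_sum_cap N W; rewrite NB; lia.
rewrite inE => /and3P[sAE sEW /eqP dE].
have -> : (j = \dim W - \dim E)%N by lia.
rewrite mulnC -(card_complements sEW sWB); apply: eq_card => N; rewrite !inE.
apply/andP/andP => [[/and3P[_ ? _] ?] | [/eqP NE /eqP NB]]; first by split.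
rewrite NE NB !eqxx -{1}NE; split => //=.
rewrite (subv_trans sAE) -?NE ?capvSl //=.
by have := dimv_sum_cap N W; rewrite NE NB; have := dimvS sEW; lia.
Qed.
End Subspaces.

(** * Power series and q-series *)
Section Series.
Variable R : comNzRingType.
Implicit Types (f g : fps R) (n e : nat).

Lemma fcoefD f g n : fcoef (f + g) n = fcoef f n + fcoef g n.
Proof. by []. Qed.

Lemma fcoefB f g n : fcoef (f - g) n = fcoef f n - fcoef g n.
Proof. by []. Qed.

Lemma fcoef0 n : fcoef (0 : fps R) n = 0.
Proof. by rewrite /= if_same. Qed.

Lemma fcoef_sum (I : Type) (r : seq I) (P : pred I) (F : I -> fps R) n :
  fcoef (\sum_(i <- r | P i) F i) n = \sum_(i <- r | P i) fcoef (F i) n.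
Proof.
exact: (big_morph (fun f => fcoef f n) (fun f g => fcoefD f g n) (fcoef0 n)).
Qed.

Lemma fcoefCM c f n : fcoef (fpsC c * f) n = c * fcoef f n.
Proof.
rewrite fcoef_mul big_ord_recl subn0 big1 ?addr0 // => i _.
by rewrite /= mul0r.
Qed.

Lemma fpsCD a b : fpsC (a + b) = fpsC a + fpsC b :> fps R.
Proof. by apply: fpsP => n; rewrite fcoefD /=; case: eqP; rewrite ?addr0. Qed.

Lemma fpsCM a b : fpsC (a * b) = fpsC a * fpsC b :> fps R.
Proof. by apply: fpsP => n; rewrite fcoefCM /=; case: eqP; rewrite ?mulr0. Qed.

Lemma fpsC_nat n : fpsC n%:R = n%:R :> fps R.
Proof. by elim: n => [|n IHn]; [by apply: fpsP => i | rewrite -!natr1 fpsCD IHn]. Qed.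

Lemma fcoef_natM c f n : fcoef (c%:R * f) n = c%:R * fcoef f n.
Proof. by rewrite -fpsC_nat fcoefCM. Qed.

Lemma fcoefXM f n : fcoef (fpsX R * f) n = if n is n'.+1 then fcoef f n' else 0.
Proof.
case: n => [|n]; first by rewrite fcoef0_mul mul0r.
rewrite fcoef_mul big_ord_recl /= mul0r add0r big_ord_recl /= mul1r subn1 big1 ?addr0 //.
by move=> i _; rewrite mul0r.
Qed.

Lemma fcoefXnM f n e :
  fcoef (fpsX R ^+ n * f) e = if (n <= e)%N then fcoef f (e - n) else 0.
Proof.
elim: n e => [|n IHn] e; first by rewrite mul1r subn0.
by rewrite exprS -mulrA fcoefXM; case: e => // e; rewrite IHn.
Qed.
End Series.

Section QSeries.
Variable A : comPzRingType.
Implicit Types (x q : A).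

Lemma qpochS x q n : qpoch x q n.+1 = (1 - x) * qpoch (x * q) q n.
Proof.
rewrite /qpoch big_ord_recl expr0 mulr1; congr (_ * _).
by apply: eq_bigr => i _; rewrite exprS mulrA.
Qed.

Lemma qpochD x q m n : qpoch x q (m + n) = qpoch x q m * qpoch (x * q ^+ m) q n.
Proof.
rewrite /qpoch big_split_ord; congr (_ * _).
by apply: eq_bigr => i _; rewrite /= exprD mulrA.
Qed.

Lemma gauss_bin_small b n j : (n < j)%N -> gauss_bin b n j = 0%N.
Proof.
elim: n j => [|n IHn] [|j] //= lt; rewrite !IHn //; lia.
Qed.

Lemma gauss_bin0 b n : gauss_bin b n 0 = 1%N. Proof. by case: n. Qed.

(** A q-analogue of the binomial theorem for (x + (1 - x))^r; the q-Pascal rule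
    splits the sum for r + 1 into x h_r(x) + (1 - x) h_r(q x). *)
Lemma sum_gauss_qpoch b r x :
  \sum_(i < r.+1) (gauss_bin b r i)%:R * x ^+ (r - i) * qpoch x b%:R i = 1.
Proof.
elim: r x => [|r IHr] x.
  by rewrite big_ord_recl big_ord0 /qpoch big_ord0 !mulr1 addr0.
rewrite big_ord_recl subn0 gauss_bin0 mul1r {1}/qpoch big_ord0 mulr1.
under eq_bigr => i _.
  rewrite /= natrD natrM natrX !mulrDl /bump add1n subSS.
  over.
rewrite big_split /= addrA.
have -> : x ^+ r.+1 + \sum_(i < r.+1)
     (gauss_bin b r i.+1)%:R * x ^+ (r - i) * qpoch x b%:R i.+1 = x.
  rewrite big_ord_recr /= gauss_bin_small // !mul0r addr0.
  rewrite -[RHS]mulr1 -[in RHS](IHr x) big_ord_recl mulrDr subn0 gauss_bin0 mul1r.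
  rewrite {2}/qpoch big_ord0 mulr1 exprS; congr (_ + _).
  rewrite big_distrr; apply: eq_bigr => i _; rewrite /= /bump add1n.
  have -> : (r - i = (r - i.+1).+1)%N by have := ltn_ord i; lia.
  rewrite exprS; ring.
rewrite -[LHS]/(x + _) [X in x + X](_ : _ = (1 - x) * 1); first by ring.
rewrite -[X in _ = _ * X](IHr (x * b%:R)) big_distrr; apply: eq_bigr => i _.
rewrite /= add0n qpochS exprMn; ring.
Qed.
End QSeries.

Section LatticeSeries.
Variable b : nat.
Let t : fps rat := fpsX rat.

Lemma fcoef0_qpoch n : fcoef (qpoch t b%:R n) 0 = 1.
Proof.
elim: n => [|n IHn]; rewrite /qpoch ?big_ord0 //.
rewrite big_ord_recr fcoef0_mul -[\big[_/_]_(_ < n) _]/(qpoch t _ n) IHn mul1r fcoefD.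
by rewrite -[fcoef (- _) 0]/(- fcoef (t * _) 0) fcoefXM oppr0 addr0.
Qed.

Lemma qpoch_unit n : qpoch t b%:R n \is a GRing.unit.
Proof.
by rewrite unfold_in /= /fps_unit fcoef0_qpoch unitr1.
Qed.

(** The generating series of the lattices of V^d, by colength, that together with
    a fixed submodule W span V^d, when W has rank r modulo X. *)
Definition span_series d r : fps rat := qpoch t b%:R (d - r) / qpoch t b%:R d.

Lemma span_series0 d : span_series d 0 = 1.
Proof. by rewrite /span_series subn0 divrr // qpoch_unit. Qed.

(** [sum_gauss_qpoch] at x = t q^(d - r); it mirrors the sorting of the
    lattices N by the lattice N + X V^d. *)
Lemma span_series_rec d r : (r <= d)%N ->
  span_series d r = \sum_(i < r.+1)
    (gauss_bin b r i)%:R * (b ^ ((r - i) * (d - r)))%:R * t ^+ (r - i) *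
    span_series d (r - i).
Proof.
move=> le_rd; rewrite -[LHS]mulr1 -[X in _ * X = _](sum_gauss_qpoch b r (t * b%:R ^+ (d - r))).
rewrite big_distrr; apply: eq_bigr => i _ /=.
rewrite /span_series; have -> : (d - (r - i) = (d - r) + i)%N by have := ltn_ord i; lia.
by rewrite qpochD exprMn -exprM natrX [((r - i) * _)%N]mulnC; ring.
Qed.

Lemma fcoef_span_series0 d r : fcoef (span_series d r) 0 = 1.
Proof.
have := divrK (qpoch_unit d) (qpoch t b%:R (d - r)).
by move/(congr1 (fun f => fcoef f 0)); rewrite fcoef0_mul !fcoef0_qpoch mulr1.
Qed.

Lemma fcoef_span_series_rec d r e : (r <= d)%N ->
  fcoef (span_series d r) e.+1 = \sum_(i < r.+1 | (0 < r - i <= e.+1)%N)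
    (gauss_bin b r i)%:R * (b ^ ((r - i) * (d - r)))%:R *
    fcoef (span_series d (r - i)) (e.+1 - (r - i)).
Proof.
move=> le_rd; rewrite {1}span_series_rec // fcoef_sum [RHS]big_mkcond.
apply: eq_bigr => i _.
rewrite -natrM -!mulrA fcoef_natM fcoefXnM.
case: posnP => [->|_]; first by rewrite span_series0 /= mulr0.
rewrite andTb.
by case: ifP => _; rewrite ?mulr0 // natrM mulrA.
Qed.
End LatticeSeries.

(** * Stable subspaces of a nilpotent operator *)
Section Nilpotent.
Variables (k : finFieldType) (T : vectType k) (X : 'End(T)).
Implicit Types (A B E F G K L N S W : {vspace T}) (i j e : nat).
Local Notation q := #|k|.

Definition ximg i W : {vspace T} := iter i (fun W' => (X @: W')%VS) W.

Definition stable W := (X @: W <= W)%VS.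

Lemma ximgS i W1 W2 : (W1 <= W2)%VS -> (ximg i W1 <= ximg i W2)%VS.
Proof. by move=> sW; elim: i => //= i; exact: limgS. Qed.

Lemma ximgD i W1 W2 : ximg i (W1 + W2)%VS = (ximg i W1 + ximg i W2)%VS.
Proof. by elim: i => //= i ->; rewrite limgD. Qed.

Lemma ximgA i j W : ximg (i + j) W = ximg i (ximg j W).
Proof. exact: iterD. Qed.

Lemma ximg1 W : ximg 1 W = (X @: W)%VS. Proof. by []. Qed.

Lemma stable_ximg i W : stable W -> stable (ximg i W).
Proof. by move=> sW; elim: i => //= i; exact: limgS. Qed.

Lemma ximg_sub i W : stable W -> (ximg i W <= W)%VS.
Proof.
move=> sW; elim: i => [|i IHi]; first exact: subvv.
exact: subv_trans (limgS _ IHi) sW.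
Qed.

Lemma ximg_anti i j W : stable W -> (i <= j)%N -> (ximg j W <= ximg i W)%VS.
Proof. by move=> sW /subnKC <-; rewrite ximgA; apply/ximgS/ximg_sub. Qed.

Lemma stableD W1 W2 : stable W1 -> stable W2 -> stable (W1 + W2)%VS.
Proof. by move=> s1 s2; rewrite /stable limgD addvS. Qed.

Lemma stable_cap W1 W2 : stable W1 -> stable W2 -> stable (W1 :&: W2)%VS.
Proof. by move=> s1 s2; apply: subv_trans (limg_cap _ _ _) _; exact: capvS. Qed.

Lemma stableV W : stable W -> forall x, x \in W -> X x \in W.
Proof. by move=> sW x Wx; apply: (subvP sW); exact: memv_img. Qed.

Lemma dim_limg_ker W : (lker X <= W)%VS ->
  \dim W = (\dim (X @: W)%VS + \dim (lker X))%N.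
Proof. by move=> /capv_idPr sW; rewrite -(limg_ker_dim X W) sW addnC. Qed.

(** X maps B cap X^-1 A onto X B cap A, with the same kernel as on B. *)
Lemma dim_preim_cap A B :
  (\dim (B :&: (X @^-1: A))%VS + \dim (X @: B + A)%VS = \dim B + \dim A)%N.
Proof.
have imJ : (X @: (B :&: X @^-1: A) = (X @: B) :&: A)%VS.
  apply/vspaceP => y; apply/memv_imgP/idP => [[x] | ].
    by rewrite memv_cap -memv_preim => /andP[Bx Ax] ->; rewrite memv_cap memv_img.
  rewrite memv_cap => /andP[/memv_imgP[x Bx ->] Ax].
  by exists x => //; rewrite memv_cap Bx -memv_preim.
have kJ : ((B :&: X @^-1: A) :&: lker X = B :&: lker X)%VS.
  rewrite -capvA; congr (_ :&: _)%VS; apply/capv_idPr.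
  by rewrite -lpreim0 lpreimS // sub0v.
have := limg_ker_dim X (B :&: X @^-1: A)%VS; have := limg_ker_dim X B.
by rewrite imJ kJ; have := dimv_sum_cap (X @: B)%VS A; lia.
Qed.

Hypothesis nilX : exists b, ximg b fullv = 0%VS.

(** Iterating, L lies in N + X^i L for all i, and X is nilpotent. *)
Lemma nakayama N L : stable N -> (L <= N + X @: L)%VS -> (L <= N)%VS.
Proof.
move=> sN sL; have H i : (L <= N + ximg i L)%VS.
  elim: i => [|i IHi]; first exact: addvSr.
  apply: subv_trans sL _; rewrite subv_add addvSl /=.
  apply: subv_trans (limgS X IHi) _; rewrite limgD addvS //.
have [b nil] := nilX; have /eqP b0 : ximg b L == 0%VS.
  by rewrite -subv0 -nil ximgS // subvf.
by have := H b; rewrite b0 addv0.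
Qed.

(** Sort the lattices N by P = N + X L. By Nakayama, N + W = L exactly when
    P + W = L, and the P of given codimension j are counted by
    [card_supplements]; inside P the lattice N spans together with X L, which
    has rank j modulo X. This is the recursion of [span_series].
    The hypothesis on the kernel makes X behave as an injective operator on
    all lattices of colength at most e in L. *)
Lemma card_spanning_lattices e L W : stable L -> stable W -> (W <= L)%VS ->
    (lker X <= ximg e L)%VS ->
  #|[set N : {vspace T} | [&& (N <= L)%VS, stable N, (N + W == L)%VS
                            & (\dim N + e)%N == \dim L]]|%:R =
  fcoef (span_series q (\dim (lker X))
           (\dim (W + X @: L)%VS - \dim (X @: L)%VS)) e.
Proof.
have [n] := ubnP e; elim: n e L W => // n IHn e L W le_en stL stW sWL kerL.
have stL' : (X @: L <= L)%VS := stL.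
set d := \dim (lker X); set r := (_ - _)%N.
have dL : \dim L = (\dim (X @: L)%VS + d)%N.
  by apply: dim_limg_ker; apply: subv_trans kerL _; exact: ximg_sub.
have sWXL : (W + X @: L <= L)%VS by rewrite subv_add sWL.
have le_rd : (r <= d)%N by have := dimvS sWXL; rewrite /r; lia.
case: e le_en kerL => [|e] le_en kerL.
  rewrite fcoef_span_series0 [X in X%:R](_ : _ = 1%N) //.
  apply/eqP/cards1P; exists L; apply/setP => N; rewrite !inE addn0.
  apply/and4P/eqP => [[sNL _ _ /eqP dN] | ->].
    by apply/eqP; rewrite eqEdim sNL dN /=.
  by rewrite subvv; split=> //; apply/eqP/addv_idPl.
set S := [set N | _].
have codimP N : N \in S -> (\dim (N + X @: L)%VS < \dim L)%N /\
   (\dim L <= \dim (N + X @: L)%VS + minn r e.+1)%N.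
  rewrite inE => /and4P[sNL stN /eqP NW /eqP dN]; split.
    rewrite ltnNge; apply/negP => le.
    suff /dimvS : (L <= N)%VS by lia.
    apply: nakayama => //.
    suff /eqP-> : (N + X @: L == L)%VS by exact: subvv.
    by rewrite eqEdim subv_add sNL stL' le.
  have := dimvS (addvSl N (X @: L)%VS).
  have := dimv_sum_cap (N + X @: L)%VS (W + X @: L)%VS.
  have -> : ((N + X @: L) + (W + X @: L) = L)%VS.
    apply/eqP; rewrite eqEsubv !subv_add sNL sWL stL' /=.
    by rewrite -{1}NW addvS ?addvSl.
  have : (X @: L <= (N + X @: L) :&: (W + X @: L))%VS by rewrite subv_cap !addvSr.
  by move/dimvS; rewrite /r; move: dN; clia.
(* the index i stands for the codimension r - i of P, as in [span_series_rec] *)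
pose D (i : 'I_r.+1) := [set P : {vspace T} | [&& (X @: L <= P)%VS,
  (P + (W + X @: L) == L)%VS & (\dim P + (r - i))%N == \dim L]].
pose c N := (r - (\dim L - \dim (N + X @: L)%VS))%N.
rewrite fcoef_span_series_rec // -sum1_card.
rewrite (partition_big (fun N => inord (c N) : 'I_r.+1)
   (fun i : 'I_r.+1 => 0 < r - i <= e.+1)%N); last first.
  by move=> N /codimP[] lt1 lt2; rewrite inordK /c; lia.
rewrite natr_sum; apply: eq_bigr => i /andP[i1 i2].
have dP P : (X @: L <= P)%VS -> (P <= L)%VS -> \dim P = (\dim (X @: P)%VS + d)%N.
  move=> sXLP sPL; apply: dim_limg_ker; apply: subv_trans kerL _.
  by apply: subv_trans sXLP; rewrite -ximg1; exact: ximg_anti.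
rewrite -natrM (_ : (gauss_bin _ _ _ * _)%N = #|D i|); last first.
  rewrite /D card_supplements ?addvSr //; last by lia.
  rewrite -/r; congr (gauss_bin _ _ _ * _ ^ (_ * _))%N; first by have := ltn_ord i; lia.
  by have := dimvS sWXL; rewrite /r; lia.
set S_i := [set N in S | inord (c N) == i].
rewrite (_ : \sum_(_ | _) _ = #|S_i|)%N; last first.
  by rewrite -sum1_card; apply: eq_bigl => N; rewrite [in RHS]inE.
apply: (card_uniform_fibers_natr (f := fun N => N + X @: L)%VS) => [N|P].
  rewrite inE => /andP[NS /eqP/(congr1 val)]; have [lt1 lt2] := codimP N NS.
  rewrite /= inordK /c; last by lia.
  move=> ci; move: NS; rewrite !inE addvSr /= => /and4P[sNL stN /eqP NW /eqP dN].
  rewrite eqEsubv !subv_add sNL sWL stL' /= -{1}NW addvS ?addvSl //=.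
  by move: lt1 lt2 ci (ltn_ord i); clia.
rewrite inE => /and3P[sXLP /eqP PL /eqP dimP].
have sPL : (P <= L)%VS by rewrite -PL addvSl.
have stP : stable P by apply: subv_trans sXLP; exact: limgS.
have PW : (P + W = L)%VS.
  by rewrite -PL [in RHS]addvC -addvA (addv_idPr sXLP) addvC.
have := IHn (e.+1 - (r - i))%N P (X @: L)%VS _ stP (limgS X stL) sXLP.
rewrite (_ : (\dim (_ + _)%VS - _ = r - i)%N); last first.
  by rewrite (addv_idPl _) ?limgS //; move: (dP _ sXLP sPL) dL dimP; clia.
move=> <-; first last.
- apply: subv_trans kerL _; apply: (@subv_trans _ _ (ximg (e.+1 - (r - i)).+1 L)).
    by by apply: ximg_anti => //; move: i1 i2; clia.
  by rewrite -addn1 ximgA; apply: ximgS.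
- by move: i1 i2 le_en; clia.
congr _%:R; apply: eq_card => N; rewrite !inE.
apply/andP/and4P => [[/andP[/and4P[sNL stN NW /eqP dN] _] /eqP NP] |
                     [sNP stN /eqP NXL /eqP dN]].
  split=> //; first by rewrite -NP addvSl.
    by rewrite NP.
  by move: dN dimP i2; clia.
have NW : (N + W == L)%VS.
  rewrite eqEsubv subv_add (subv_trans sNP) // sWL /=.
  apply: nakayama; first exact: stableD.
  by rewrite -addvA [(W + _)%VS]addvC addvA NXL PW subvv.
have dN' : (\dim N + e.+1)%N = \dim L by move: dN dimP i2; clia.
rewrite NXL (subv_trans sNP) // stN NW dN' !eqxx; split=> //=.
apply/eqP/val_inj; rewrite /= inordK /c NXL; last by clia.
by move: dimP (ltn_ord i); clia.
Qed.
End Nilpotent.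

(** * Submodules of given type *)
Section Types.
Variables (k : finFieldType) (T : vectType k) (X : 'End(T)).
Implicit Types (A B E F G K L N S W : {vspace T}) (i j e : nat).
Local Notation q := #|k|.
Local Notation ximg := (ximg X).
Local Notation stable := (stable X).

(** The conjugate of the type of N / A: [mtype A N i] is the number of parts
    exceeding i, since X^i N / X^(i+1) N has one generator for each of them. *)
Definition mtype A N i : nat :=
  (\dim (ximg i N + A)%VS - \dim (ximg i.+1 N + A)%VS)%N.

Lemma mtypeS A N i : stable A ->
  mtype A (X @: N + A)%VS i = mtype A N i.+1.
Proof.
move=> stA; have H j : (ximg j (X @: N + A) + A = ximg j.+1 N + A)%VS.
  rewrite ximgD -addvA (addv_idPr (ximg_sub j stA)).
  by rewrite -ximg1 -ximgA addn1.
by rewrite /mtype !H.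
Qed.

(** The number of submodules of type aa in a module of type bb, both given by
    their conjugates shifted by one: [aa i] is the part of index i + 1. *)
Definition hall_count (b : nat) e (bb aa : nat -> nat) : nat :=
  \prod_(i < e) (b ^ (aa i.+1 * (bb i - aa i)) *
                 gauss_bin b (bb i - aa i.+1) (aa i - aa i.+1))%N.

(** Induction on the Loewy length: N' = X N + A has the type of N without its
    first column and lies in X B + A. Given N', the submodule N lies in
    P = B cap X^-1 N' and surjects onto N' / A. So it is determined by its trace E
    on the kernel J of P -> N' / A, which is a point of a Grassmannian, and then by a
    complement above N' + E. *)
Lemma card_submodules_type e A B (a : nat -> nat) :
    (A <= B)%VS -> stable A -> stable B -> (ximg e B <= A)%VS ->
    (forall i, (i < e)%N -> a i.+1 <= a i <= mtype A B i)%N -> a e = 0%N ->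
  #|[set N : {vspace T} | [&& (A <= N)%VS, (N <= B)%VS, stable N
                            & [forall i : 'I_e, mtype A N i == a i]]]| =
  hall_count q e (mtype A B) a.
Proof.
elim: e B a => [|e IHe] B a sAB stA stB nilB a_le ae.
  rewrite /hall_count big_ord0; apply/eqP/cards1P; exists A.
  apply/setP => N; rewrite !inE; apply/and4P/eqP => [[sAN sNB _ _] | ->].
    by apply/eqP; rewrite eq_sym eqEsubv sAN (subv_trans sNB nilB).
  by rewrite subvv sAB; split=> //; apply/forallP => [[]].
set b := mtype A B; pose a' i := a i.+1; pose B' := (X @: B + A)%VS.
have stXB : (X @: B <= B)%VS by [].
have stXA : (X @: A <= A)%VS by [].
have sAB' : (A <= B')%VS by exact: addvSr.
have sB'B : (B' <= B)%VS by rewrite subv_add stXB.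
have stB' : stable B' by apply: stableD => //; apply: (stable_ximg 1).
have nilB' : (ximg e B' <= A)%VS.
  by rewrite ximgD subv_add ximg_sub // andbT -ximg1 -ximgA addn1.
have bS i : mtype A B' i = b i.+1 by rewrite mtypeS.
have b0 : (\dim B = \dim B' + b 0)%N.
  rewrite /b /mtype /= (addv_idPl sAB) -/B'; have := dimvS sB'B; clia.
rewrite /hall_count big_ord_recl mulnC.
rewrite (_ : (\prod_(i < e) _)%N = hall_count q e (mtype A B') a'); last first.
  by apply: eq_bigr => i _; rewrite bS.
rewrite -(IHe B' a') //; last by move=> i i_e; rewrite bS; exact: a_le.
have /andP[a10 a0b] := a_le 0%N (ltn0Sn e).
rewrite -/b in a0b.
apply: (card_uniform_fibers (f := fun N => X @: N + A)%VS) => [N|N'].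
  rewrite !inE addvSr => /and4P[sAN sNB stN /forallP/= tN].
  rewrite [(_ <= B')%VS]addvS ?limgS //=.
  rewrite stableD //; last exact: (stable_ximg 1).
  apply/forallP => i; rewrite mtypeS //.
  by have := tN (lift ord0 i); rewrite /= /bump.
rewrite inE => /and4P[sAN' sN'B' stN' /forallP/= tN'].
have stXN' : (X @: N' <= N')%VS by [].
(* J is the kernel of X from B to B / A; P is the preimage of N' / A *)
pose J := (B :&: X @^-1: A)%VS; pose P := (B :&: X @^-1: N')%VS.
have dJ : (\dim J = \dim A + b 0)%N.
  by have := dim_preim_cap X A B; rewrite -/J -/B'; move: b0; clia.
have dP : (\dim P = \dim N' + b 0)%N.
  have := dim_preim_cap X N' B; rewrite -/P.
  have -> : (X @: B + N' = B')%VS; last by move: b0; clia.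
  by apply/eqP; rewrite eqEsubv subv_add sN'B' addvSl /= addvS.
have sN'B := subv_trans sN'B' sB'B.
have N'J : (N' :&: J = N' :&: X @^-1: A)%VS.
  by rewrite /J capvA (capv_idPl sN'B).
have dN'J : (\dim (N' :&: J)%VS = \dim A + a 1)%N.
  have a1E : (\dim N' = \dim (X @: N' + A)%VS + a 1)%N.
    case: (e) ae tN' nilB' => [|e'] ae tN' nilB'.
      have -> : N' = A by apply/eqP; rewrite eq_sym eqEsubv sAN' (subv_trans sN'B' nilB').
      by rewrite ae (addv_idPr stXA) addn0.
    have /eqP := tN' ord0; rewrite /mtype /= (addv_idPl sAN') /a'.
    have : (X @: N' + A <= N')%VS by rewrite subv_add stXN'.
    by move/dimvS; clia.
  by rewrite N'J; have := dim_preim_cap X A N'; move: a1E; clia.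
have sJP : (J <= P)%VS by rewrite capvS ?lpreimS.
have sN'P : (N' <= P)%VS.
  rewrite subv_cap sN'B; apply/subvP => x; rewrite -memv_preim.
  exact: stableV.
set S := [set N in _ | _].
have -> : S = [set N : {vspace T} | [&& (N' <= N)%VS, (N + J == P)%VS
                                      & \dim N == (\dim N' + a 0)%N]].
  apply/setP => N; rewrite !inE; apply/andP/and3P.
    case=> /and4P[sAN sNB stN /forallP/= tN] /eqP N'E.
    have sN'N : (N' <= N)%VS by rewrite -N'E subv_add sAN andbT.
    split=> //.
      rewrite eqEsubv subv_add sJP andbT; apply/andP; split.
        rewrite subv_cap sNB; apply/subvP => x Nx; rewrite -memv_preim -N'E.
        by apply: (subvP (addvSl _ _)); exact: memv_img.
      apply/subvP => x; rewrite memv_cap -memv_preim -N'E => /andP[Bx].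
      case/memv_addP => _ /memv_imgP[n Nn ->] [y Ay Xx].
      apply/memv_addP; exists n => //; exists (x - n); last by rewrite addrC subrK.
      rewrite memv_cap memvB // ?(subvP sNB) //= -memv_preim linearB /= Xx addrC addrA.
      by rewrite addNr add0r.
    have /eqP := tN ord0; rewrite /mtype /= N'E (addv_idPl sAN).
    have := dimvS sN'N; clia.
  case=> sN'N /eqP NJ /eqP dN.
  have sNP : (N <= P)%VS by rewrite -NJ addvSl.
  have sNB : (N <= B)%VS by apply: subv_trans sNP (capvSl _ _).
  have sXN : (X @: N <= N')%VS.
    apply/subvP => _ /memv_imgP[x Nx ->].
    by have := subvP sNP _ Nx; rewrite memv_cap -memv_preim => /andP[].
  have N'E : (X @: N + A = N')%VS.
    apply/eqP; rewrite eqEsubv subv_add sXN sAN' /=; apply/subvP => y N'y.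
    have := subvP sN'B' _ N'y; case/memv_addP => _ /memv_imgP[x Bx ->] [z Az yE].
    have : x \in (N + J)%VS.
      rewrite NJ memv_cap Bx -memv_preim -[X x](addrK z) -yE memvB //.
      exact: (subvP sAN').
    case/memv_addP => n Nn [j]; rewrite memv_cap -memv_preim => /andP[_ Aj] xE.
    rewrite yE xE linearD -addrA memv_add ?memv_img //.
    exact: memvD.
  have sAN := subv_trans sAN' sN'N.
  rewrite N'E eqxx sAN sNB /=; split=> //; apply/andP; split.
    exact: subv_trans sXN sN'N.
  apply/forallP => [[[|i] lti]] /=.
    by rewrite /mtype /= N'E (addv_idPl sAN) dN; apply/eqP; clia.
  by rewrite -mtypeS // N'E; exact: (tN' (Ordinal (lti : i < e)%N)).
have ->: (q ^ (a (ord0 : 'I_e.+1).+1 * (b (ord0 : 'I_e.+1) - a (ord0 : 'I_e.+1))) *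
   gauss_bin q (b (ord0 : 'I_e.+1) - a (ord0 : 'I_e.+1).+1)
     (a (ord0 : 'I_e.+1) - a (ord0 : 'I_e.+1).+1) =
   gauss_bin q (\dim J - \dim (N' :&: J)%VS) (a 0 - a 1) * q ^ (a 1 * (b 0 - a 0)))%N.
  rewrite /= mulnC; congr (gauss_bin _ _ _ * _)%N; move: dJ dN'J a10 a0b; clia.
rewrite -(card_grassmannian _ (capvSr N' J)).
apply: (card_uniform_fibers (f := fun N => N :&: J)%VS) => [N|E].
  rewrite !inE => /and3P[sN'N /eqP NJ /eqP dN]; rewrite capvS // capvSr /=.
  by have := dimv_sum_cap N J; rewrite NJ; move: dN dP dJ dN'J a10; clia.
rewrite inE => /and3P[sN'JE sEJ /eqP dE].
have N'JE : (N' :&: E = N' :&: J)%VS.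
  by apply/eqP; rewrite eqEsubv capvS //= subv_cap capvSl.
have dN'E : (\dim (N' + E)%VS = \dim N' + (a 0 - a 1))%N.
  by have := dimv_sum_cap N' E; rewrite N'JE; move: dE dN'J a10; clia.
have dN'_J : (\dim (N' + J)%VS = \dim N' + (b 0 - a 1))%N.
  by have := dimv_sum_cap N' J; move: dJ dN'J a10 a0b; clia.
have sN'EJ : (N' + E <= N' + J)%VS by rewrite addvS.
have sN'JP : (N' + J <= P)%VS by rewrite subv_add sN'P.
have -> : (a 1 * (b 0 - a 0) = (\dim P - \dim (N' + J)%VS) *
     (\dim (N' + J)%VS - \dim (N' + E)%VS))%N.
  by congr (_ * _)%N; move: dP dN'_J dN'E a10 a0b; clia.
rewrite -(card_complements sN'EJ sN'JP); apply: eq_card => N; rewrite !inE.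
apply/andP/andP => [[/and3P[sN'N /eqP NJ _] /eqP NE] | [/eqP NE /eqP NP]].
  rewrite addvA (addv_idPl sN'N) NJ; split=> //.
  by rewrite capvC -vspace_modl // capvC NE.
have sN'N : (N' <= N)%VS by apply: subv_trans (addvSl N' E) _; rewrite -NE capvSl.
have NJ : (N + J = P)%VS by rewrite -NP addvA (addv_idPl sN'N).
have NJE : (N :&: J = E)%VS.
  rewrite -(capv_idPr (addvSr N' J)) capvA NE addvC -vspace_modl //.
  exact/addv_idPl.
rewrite sN'N NJ NJE !eqxx; split=> //=.
by have := dimv_sum_cap N J; rewrite NJ NJE; move: dP dJ dE dN'J a10; clia.
Qed.
End Types.

(** * Lifts of a quotient and surjectivity *)
Section Lifts.
Variables (k : finFieldType) (T : vectType k) (X : 'End(T)).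
Implicit Types (A B E F G K L N S W : {vspace T}) (i j e : nat).
Local Notation q := #|k|.
Local Notation ximg := (ximg X).
Local Notation stable := (stable X).
Local Notation qq n := (qpoch (q%:R^-1 : rat) q%:R^-1 n).

Hypothesis nilX : exists b, ximg b fullv = 0%VS.

(** The socle of S / K is nonzero, as X is nilpotent. *)
Lemma exists_stable_cover K S : stable K -> stable S -> (K <= S)%VS ->
    (\dim K < \dim S)%N ->
  exists K', [/\ (K <= K')%VS, (K' <= S)%VS, (X @: K' <= K)%VS
               & \dim K' = (\dim K).+1].
Proof.
move=> stK stS sKS ltKS.
have [b nil] := nilX.
have exb : exists i, (ximg i S <= K)%VS.
  by exists b; apply: subv_trans (ximgS X b (subvf S)) _; rewrite nil sub0v.
case: (ex_minnP exb) => [[|i] Hi mini].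
  by move/dimvS: Hi; rewrite leqNgt /= ltKS.
have /subvPn[v Sv Kv] : ~~ (ximg i S <= K)%VS by apply/negP => /mini; rewrite ltnn.
exists (K + <[v]>)%VS; split; first exact: addvSl.
- rewrite subv_add sKS -memvE; exact: (subvP (ximg_sub i stS)).
- rewrite limgD subv_add limg_line [(_ <= K)%VS]stK -memvE /=.
  by apply: (subvP Hi); exact: memv_img.
rewrite addvC dimv_disjoint_sum ?cap_line_out // dim_vline.
by case: eqVneq Kv => // ->; rewrite mem0v.
Qed.

Lemma q_gt1 : (1 < q)%N. Proof. exact: finNzRing_gt1. Qed.

Lemma q_neq0 : (q%:R : rat) != 0.
Proof. by rewrite pnatr_eq0; have := q_gt1; clia. Qed.

Lemma qq_neq0 n : qq n != 0.
Proof.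
apply/prodf_neq0 => i _; rewrite subr_eq0 -exprS eq_sym exprVn invr_eq1.
rewrite -natrX pnatr_eq1 -[X in _ == X](expn0 q) eqn_exp2l //.
exact: q_gt1.
Qed.

Lemma qq_ratioS n : qq n.+1 / qq n = 1 - q%:R^-1 ^+ n.+1.
Proof.
by rewrite [in qq n.+1]/qpoch big_ord_recr /= mulrAC divff ?qq_neq0 // mul1r exprS.
Qed.

Section Pullback.
Variables (F S G : {vspace T}) (m d : nat).
Hypotheses (stF : stable F) (stS : stable S) (stG : stable G).
Hypotheses (sSF : (S <= F)%VS) (sGF : (G <= F)%VS).
Hypothesis freeF : forall x, x \in F -> X x \in S -> x \in (S + ximg m F)%VS.
Hypothesis dFS : (\dim F = \dim (X @: F + S)%VS + d)%N.
Hypothesis dFG : (\dim F = \dim (X @: F + G)%VS + d)%N.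

(** The rank of the image of K in (F / G) / X (F / G). *)
Definition rho K := (\dim (K + (X @: F + G))%VS - \dim (X @: F + G)%VS)%N.

(** When F is a fibre product of N1 and N2, S and G the kernels of its two
    projections, these are the graphs of the surjections from N2 = F / S to N1 / K
    that lift the map from N2 to N1 / S = F / (S + G). *)
Definition lifts K := [set N : {vspace T} |
  [&& (N <= F)%VS, stable N, (N :&: S == K)%VS, (N + S == F)%VS & (N + G == F)%VS]].

(** One step of the tower K < K' < S: given N', the N below it are the hyperplanes
    that contain Z = X N' + K but not K' (q^d of them), minus those that also contain
    G' = N' cap G and so fail to surject. The latter exist only if the
    rank [rho] grows from K to K', and then they are q^(d - rho K') in number. *)
Lemma card_lifts_step K K' N' :
    stable K -> (ximg m.+1 F :&: S <= K)%VS ->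
    (K <= K')%VS -> (K' <= S)%VS -> (X @: K' <= K)%VS -> \dim K' = (\dim K).+1 ->
    N' \in lifts K' ->
  #|[set N in lifts K | (N + K')%VS == N']|%:R =
    (q ^ d)%:R * (qq (rho K') / qq (rho K)).
Proof.
move=> stK sFK sKK' sK'S sXK' dK'.
rewrite inE => /and5P[sN'F stN' /eqP N'S /eqP N'SF /eqP N'GF].
have stXN' : (X @: N' <= N')%VS by [].
have sK'N' : (K' <= N')%VS by rewrite -N'S capvSl.
have sKN' := subv_trans sKK' sK'N'.
pose Z := (X @: N' + K)%VS; pose G' := (N' :&: G)%VS.
have sZN' : (Z <= N')%VS by rewrite subv_add stXN'.
have sG'N' : (G' <= N')%VS by exact: capvSl.
have XF_G : (X @: F + G = X @: N' + G)%VS.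
  by rewrite -N'GF limgD -addvA (addv_idPr (stG : X @: G <= G)%VS).
(* F / S is free modulo X^m, so the part of X N' in S already lies in K *)
have ZK' : (Z :&: K' = K)%VS.
  apply/eqP; rewrite eqEsubv subv_cap addvSr sKK' /= andbT.
  apply/subvP => z; rewrite memv_cap => /andP[/memv_addP[_ /memv_imgP[x N'x ->]]].
  case=> y Ky -> K'xy.
  suff Kx : X x \in K by exact: memvD.
  have K'x : X x \in K' by rewrite -[X x](addrK y) memvB // (subvP sKK').
  have := freeF (subvP sN'F _ N'x) (subvP sK'S _ K'x).
  rewrite -[in ximg m F]N'SF ximgD addvC -addvA (addv_idPr (ximg_sub m stS)).
  case/memv_addP => n mn [s Ss xE].
  have N'n : n \in N' by apply: (subvP (ximg_sub m stN')).
  have K's : s \in K'.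
    by rewrite -N'S memv_cap Ss andbT -[s](addKr n) -xE addrC memvB.
  rewrite xE linearD memvD //; last by apply: (subvP sXK'); exact: memv_img.
  apply: (subvP sFK); rewrite memv_cap; apply/andP; split.
    apply: (subvP (limgS X (ximgS X m sN'F))); exact: memv_img.
  suff: X x - X s \in S by rewrite xE linearD addrK.
  by rewrite memvB //; [exact: (subvP sK'S) | exact: (stableV stS)].
pose H Z := [set N : {vspace T} | (N :&: (Z + K') == Z)%VS && (N + (Z + K') == N')%VS].
have cardH Z1 : (Z1 <= N')%VS -> ~~ (K' <= Z1)%VS -> (K <= Z1)%VS ->
    #|H Z1| = (q ^ (\dim N' - \dim (Z1 + K')%VS))%N.
  move=> sZ1 nK' sK1; rewrite card_complements ?addvSl ?subv_add ?sZ1 //.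
  suff -> : (\dim (Z1 + K')%VS - \dim Z1 = 1)%N by rewrite muln1.
  have := dimv_sum_cap Z1 K'.
  have : (K <= Z1 :&: K')%VS by rewrite subv_cap sK1.
  move/dimvS; have : (\dim (Z1 :&: K')%VS < \dim K')%N; last by move: dK'; clia.
  rewrite ltnNge; apply: contra nK' => le; apply/capv_idPr/eqP.
  by rewrite eqEdim capvSr.
have nK'K : ~~ (K' <= K)%VS by apply/negP => /dimvS; rewrite dK' ltnn.
have nK'Z : ~~ (K' <= Z)%VS.
  by apply: contra nK'K => sK'Z; rewrite -ZK' subv_cap sK'Z subvv.
have capK' Z1 N : (K <= Z1)%VS -> (Z1 <= N)%VS -> (N <= N')%VS ->
    (N :&: K' = K)%VS -> (N :&: (Z1 + K') = Z1)%VS.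
  move=> sK1 s1N sNN' NK'; rewrite capvC -vspace_modl // capvC NK'.
  exact/addv_idPl.
have capN Z1 N : (N :&: (Z1 + K') = Z1)%VS -> (N + (Z1 + K') = N')%VS ->
   [/\ (Z1 <= N)%VS, (N <= N')%VS, (N + K' = N')%VS & (N :&: K' = Z1 :&: K')%VS].
  move=> NZ NZK'; have sZN : (Z1 <= N)%VS by rewrite -NZ capvSl.
  split=> //; first by rewrite -NZK' addvSl.
    by rewrite -NZK' addvA (addv_idPl sZN).
  by rewrite -{1}(capv_idPr (addvSr Z1 K')) capvA NZ.
have fiberE : [set N in lifts K | (N + K')%VS == N'] =
    H Z :\: [set N : {vspace T} | (G' <= N)%VS].
  apply/setP => N; rewrite !inE; apply/andP/and3P.
    case=> /and5P[sNF stN /eqP NS /eqP NSF /eqP NGF] /eqP NK'.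
    have sKN : (K <= N)%VS by rewrite -NS capvSl.
    have sNN' : (N <= N')%VS by rewrite -NK' addvSl.
    have sZN : (Z <= N)%VS.
      rewrite subv_add sKN andbT -NK' limgD subv_add [(X @: N <= N)%VS]stN.
      exact: subv_trans sXK' sKN.
    split.
    - apply/negP => sG'N; move: nK'K; rewrite -NS subv_cap sK'S andbT.
      suff -> : N = N' by rewrite sK'N'.
      apply/eqP; rewrite eqEsubv sNN' -(addv_idPl sG'N) /G' capvC.
      by rewrite vspace_modl // NGF subv_cap sN'F subvv.
    - apply/eqP/capK' => //; first exact: addvSr.
      apply/eqP; rewrite eqEsubv subv_cap sKN sKK' andbT -NS.
      by rewrite capvS.
    by rewrite addvA (addv_idPl sZN) NK'.
  case=> nG' /eqP NZ /eqP NZK'.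
  have [sZN sNN' NK' NcK'] := capN _ _ NZ NZK'; rewrite ZK' in NcK'.
  have stN : stable N.
    apply: subv_trans sZN; apply: subv_trans (limgS X sNN') (addvSl _ _).
  have sNF := subv_trans sNN' sN'F.
  rewrite NK' eqxx sNF stN; split=> //=; apply/and3P; split.
  - by rewrite -(capv_idPl sNN') -capvA N'S NcK'.
  - rewrite eqEsubv subv_add sNF sSF -N'SF -NK' -addvA.
    by rewrite (addv_idPr sK'S) subvv.
  have NG' : (N + G' = N')%VS.
    apply/eqP; rewrite eqEdim subv_add sNN' sG'N' /=.
    have : (\dim N < \dim (N + G')%VS)%N.
      rewrite ltnNge; apply: contra nG' => le; apply/addv_idPl/eqP.
      by rewrite eq_sym eqEdim addvSl.
    by have := dimv_sum_cap N K'; rewrite NcK' NK'; move: dK'; clia.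
  rewrite eqEsubv subv_add sNF sGF -N'GF -NG' -addvA.
  by rewrite (addv_idPr (capvSr N' G)) subvv.
have dN'Z : (\dim N' - \dim (Z + K')%VS = d)%N.
  have ZK'E : (Z + K' = X @: N' + K')%VS by rewrite -addvA (addv_idPr sKK').
  have sYN' : (Z + K' <= N')%VS by rewrite subv_add sZN'.
  have YS : ((Z + K') :&: S = K')%VS.
    apply/eqP; rewrite eqEsubv subv_cap addvSr sK'S -{2}N'S !andbT.
    by rewrite capvS.
  have YSE : ((Z + K') + S = X @: F + S)%VS.
    rewrite ZK'E -addvA (addv_idPr sK'S) -N'SF limgD -addvA.
    by rewrite (addv_idPr (stS : X @: S <= S)%VS).
  have := dimv_sum_cap N' S; have := dimv_sum_cap (Z + K')%VS S.
  by rewrite YS YSE N'S N'SF; move: (dimvS sYN') dFS; clia.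
set M := (X @: F + G)%VS in XF_G *.
pose Y := (Z + G' + K')%VS.
have sYN' : (Y <= N')%VS by rewrite subv_add sK'N' andbT subv_add sZN' sG'N'.
have YGE : (Y + G = K' + M)%VS.
  rewrite XF_G /Y addvAC -[(Z + G' + G)%VS]addvA (addv_idPr (capvSr N' G)) addvAC.
  by rewrite -[(Z + K')%VS]addvA (addv_idPr sKK') [(X @: N' + K')%VS]addvC addvA.
have dN'Y : (\dim N' + rho K' = \dim Y + d)%N.
  have YG : (Y :&: G = G')%VS.
    apply/eqP; rewrite eqEsubv capvS //= subv_cap capvSr andbT.
    by apply: subv_trans (addvSl _ _); rewrite addvSr.
  have := dimv_sum_cap N' G; have := dimv_sum_cap Y G.
  rewrite YG YGE N'GF -/G' /rho -/M.
  by move: (dimvS (addvSr K' M)) dFG; rewrite -/M; clia.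
have sKM : (K + M <= K' + M)%VS by rewrite addvS.
have rhoS : (rho K <= rho K' <= (rho K).+1)%N.
  have := dimv_sum_cap K' (K + M)%VS; rewrite addvA (addv_idPl sKK').
  have /dimvS : (K <= K' :&: (K + M))%VS by rewrite subv_cap sKK' addvSl.
  by move: dK' (dimvS sKM); rewrite /rho -/M; clia.
(* no hyperplane above Z + G' avoids K' exactly when the rank does not grow *)
have condE : (K' <= Z + G')%VS = (rho K' == rho K).
  apply/idP/eqP => [sK' | eqr].
    rewrite /rho -/M; suff -> : (K' + M = K + M)%VS by [].
    apply/eqP; rewrite eqEsubv sKM subv_add addvSr !andbT.
    apply: subv_trans sK' _; rewrite XF_G /Z /G' !subv_add addvSl.
    rewrite (subv_trans (addvSl _ G) (addvSr _ _)).
    by rewrite (subv_trans (capvSr N' G)) // addvA addvSr.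
  have KM : (K + M = K' + M)%VS.
    apply/eqP; rewrite eqEdim sKM /=; move: eqr; rewrite /rho -/M.
    by move: (dimvS (addvSr K M)) (dimvS (addvSr K' M)); clia.
  have : (K' <= N' :&: (K + M))%VS by rewrite subv_cap sK'N' KM addvSl.
  rewrite XF_G addvA [(K + _)%VS]addvC -/Z capvC -vspace_modl //.
  by rewrite capvC.
rewrite fiberE cardsD natrB; last by rewrite subset_leq_card // subsetIl.
rewrite (cardH Z) ?addvSr // dN'Z.
have [cond | ncond] := boolP (K' <= Z + G')%VS.
  move: (cond); rewrite condE => /eqP ->; rewrite divff ?qq_neq0 // mulr1.
  rewrite [X in _ - X](_ : _ = 0) ?subr0 //; apply/eqP; rewrite pnatr_eq0 cards_eq0.
  rewrite -finset.subset0; apply/fintype.subsetP => N; rewrite !inE => /andP[/andP[/eqP NZ /eqP NZK']].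
  have [sZN sNN' NK' NcK'] := capN _ _ NZ NZK' => sG'N; case/negP: nK'K.
  rewrite -{1}ZK' -NcK' subv_cap subvv andbT.
  by apply: subv_trans cond _; rewrite subv_add sZN.
have rhoE : rho K' = (rho K).+1.
  by move: ncond rhoS; rewrite condE; clia.
rewrite (_ : _ :&: _ = H (Z + G')%VS); last first.
  apply/setP => N; rewrite !inE; apply/andP/andP.
    case=> /andP[/eqP NZ /eqP NZK'] sG'N.
    have [sZN sNN' NK' NcK'] := capN _ _ NZ NZK'; rewrite ZK' in NcK'.
    have sZGN : (Z + G' <= N)%VS by rewrite subv_add sZN.
    split; last by rewrite addvA (addv_idPl sZGN) NK'.
    apply/eqP/capK' => //.
    by rewrite (subv_trans (addvSr (X @: N')%VS K)) // addvSl.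
  case=> /eqP NZ /eqP NZK'.
  have [sZGN sNN' NK' NcK'] := capN _ _ NZ NZK'.
  move: (sZGN); rewrite subv_add => /andP[sZN sG'N]; split=> //; apply/andP; split.
    apply/eqP/capK' => //; first exact: addvSr.
    apply/eqP; rewrite eqEsubv subv_cap (subv_trans _ sZN) ?addvSr //= sKK' andbT.
    have sKc : (K <= N :&: K')%VS by rewrite subv_cap sKK' (subv_trans _ sZN) ?addvSr.
    have : (\dim (N :&: K')%VS < \dim K')%N.
      rewrite ltnNge; apply: contra ncond => le.
      have /eqP <- : (N :&: K' == K')%VS by rewrite eqEdim capvSr.
      by rewrite NcK' capvSl.
    rewrite dK' ltnS => le; suff /eqP <- : (K == N :&: K')%VS by exact: subvv.
    by rewrite eqEdim sKc.
  by rewrite addvA (addv_idPl sZN) NK'.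
rewrite cardH //; last first.
- by rewrite (subv_trans (addvSr (X @: N')%VS K)) // addvSl.
- by rewrite subv_add sZN'.
rewrite -/Y rhoE qq_ratioS -rhoE.
have -> : (\dim N' - \dim Y = d - rho K')%N by move: dN'Y; clia.
have le_rd : (rho K' <= d)%N by move: dN'Y (dimvS sYN'); clia.
rewrite !natrX mulrBr mulr1; congr (_ - _).
rewrite -[in q%:R ^+ d](subnK le_rd) exprD -mulrA -exprMn mulfV ?q_neq0 //.
by rewrite expr1n mulr1.
Qed.

(** The product of [card_lifts_step] over a tower of submodules from K to S. *)
Lemma card_lifts K : stable K -> (ximg m.+1 F :&: S <= K)%VS -> (K <= S)%VS ->
  #|lifts K|%:R = (q ^ (d * (\dim S - \dim K)))%:R * (qq (rho S) / qq (rho K)).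
Proof.
move En: (\dim S - \dim K)%N => n.
elim: n K En => [|n IHn] K En stK sFK sKS.
  have -> : K = S by apply/eqP; rewrite eqEdim sKS /=; move: En; clia.
  rewrite muln0 expn0 divff ?qq_neq0 // mulr1 [X in X%:R](_ : _ = 1%N) //.
  apply/eqP/cards1P; exists F; apply/setP => N; rewrite !inE.
  apply/and5P/eqP => [[_ _ /eqP NS /eqP NSF _] | ->].
    by rewrite -NSF (addv_idPl _) // -NS capvSl.
  rewrite subvv stF (capv_idPr sSF) (addv_idPl sSF) (addv_idPl sGF).
  by rewrite !eqxx.
have [|K' [sKK' sK'S sXK' dK']] := exists_stable_cover stK stS sKS.
  by move: En; clia.
have stK' : stable K' by exact: subv_trans sXK' sKK'.
rewrite (@card_uniform_fibers_natr _ _ _ _ (lifts K') (fun N => N + K')%VS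
  ((q ^ d)%:R * (qq (rho K') / qq (rho K)))).
- rewrite IHn //; last 2 first.
  + by move: En dK'; clia.
  + exact: subv_trans sFK sKK'.
  rewrite mulnS expnD natrM.
  move: (qq_neq0 (rho K')) (qq_neq0 (rho K)).
  by move: (qq _) (qq _) (qq _) => x y z x0 y0; field; rewrite x0 y0.
- move=> N; rewrite !inE => /and5P[sNF stN /eqP NS /eqP NSF /eqP NGF].
  have sKF := subv_trans sK'S sSF.
  rewrite subv_add sNF sKF stableD //=; apply/and3P; split.
  + by rewrite addvC -vspace_modl // NS addvC; apply/eqP/addv_idPr.
  + by rewrite -addvA (addv_idPr sK'S) NSF.
  by rewrite addvAC NGF; apply/eqP/addv_idPl.
move=> N' N'l; exact: card_lifts_step.
Qed.

End Pullback.
End Lifts.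

(** * Types of lattices *)
Section Depth.
Variables (k : finFieldType) (T : vectType k) (X : 'End(T)).
Implicit Types (A B E F G K L N S W : {vspace T}) (i j e : nat).
Local Notation ximg := (ximg X).
Local Notation stable := (stable X).
Local Notation d := (\dim (lker X)).

Definition lpow i : 'End(T) := iter i (fun f => (X \o f)%VF) \1%VF.

Lemma lpowE i x : lpow i x = iter i X x.
Proof. by elim: i => [|i IHi] /=; rewrite ?id_lfunE // comp_lfunE IHi. Qed.

Lemma ximg_lpow i W : ximg i W = (lpow i @: W)%VS.
Proof. by elim: i => [|i IHi] /=; rewrite ?lim1g // limg_comp -IHi. Qed.

Lemma memv_ximgP i W y : reflect (exists2 x, x \in W & y = iter i X x) (y \in ximg i W).
Proof.
rewrite ximg_lpow; apply: (iffP memv_imgP).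
  by case=> x Wx ->; exists x; rewrite ?lpowE.
by case=> x Wx ->; exists x; rewrite ?lpowE.
Qed.

Lemma memv_iter i W x : x \in W -> iter i X x \in ximg i W.
Proof. by move=> Wx; apply/memv_ximgP; exists x. Qed.

Lemma stable_iter i W x : stable W -> x \in W -> iter i X x \in W.
Proof. by move=> /ximg_sub-/(_ i)/subvP sW /(memv_iter i)/sW. Qed.

(** Each of these applications of X kills exactly the kernel, since W and
    hence W' contain it deep enough. *)
Lemma dim_ximg j W W' i : stable W -> (lker X <= ximg j W)%VS -> (W <= W')%VS ->
  (i <= j.+1)%N -> \dim W' = (\dim (ximg i W') + i * d)%N.
Proof.
move=> stW kW sWW'; elim: i => [|i IHi] le_ij; first by rewrite addn0.
rewrite IHi 1?ltnW // mulSn addnA; congr (_ + _)%N.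
rewrite (@dim_limg_ker _ _ X (ximg i W')) //.
apply: subv_trans kW (subv_trans _ (ximgS X i sWW')).
by apply: ximg_anti => //; rewrite -ltnS.
Qed.

(** A module of length e is killed by X^e. *)
Lemma codim_stable e L N : (exists b, ximg b fullv = 0%VS) ->
  stable N -> stable L -> (N <= L)%VS -> (\dim L <= \dim N + e)%N ->
  (ximg e L <= N)%VS.
Proof.
move=> nilX stN; elim: e L => [|e IHe] L stL sNL le.
  by rewrite /= -(geq_leqif (dimv_leqif_sup sNL)) -[\dim N]addn0.
have stL' : stable (N + X @: L)%VS by apply: stableD => //; apply: (stable_ximg 1).
have [lt|ge] := ltnP (\dim (N + X @: L)%VS) (\dim L).
  rewrite -addn1 ximgA; apply: subv_trans (ximgS X e _) (IHe _ stL' (addvSl _ _) _).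
    exact: addvSr.
  by move: lt le; clia.
have sLN : (L <= N)%VS.
  apply: (@nakayama _ _ X) => //.
  suff /eqP-> : (N + X @: L == L)%VS by exact: subvv.
  by rewrite eqEdim subv_add sNL [(_ <= L)%VS]stL ge.
by apply: subv_trans (ximg_sub _ stL) sLN.
Qed.

(** A second description, as the dimension of the kernel of X on
    (X^i N + A) / A: it makes the monotonicity in N and in i clear. *)
Lemma mtypeE A N i : stable A ->
  (\dim ((ximg i N + A) :&: X @^-1: A)%VS = mtype X A N i + \dim A)%N.
Proof.
move=> stA; have := dim_preim_cap X A (ximg i N + A)%VS.
rewrite limgD -addvA (addv_idPr (stA : X @: A <= A)%VS) /mtype.
have : (A <= (ximg i N + A) :&: X @^-1: A)%VS.
  rewrite subv_cap addvSr; apply/subvP => x Ax; rewrite -memv_preim.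
  exact: stableV Ax.
by move/dimvS; rewrite /=; clia.
Qed.

Lemma mtypeM A N N' i : stable A -> (N <= N')%VS -> (mtype X A N i <= mtype X A N' i)%N.
Proof.
move=> stA sNN'; rewrite -(leq_add2r (\dim A)) -!mtypeE //.
by rewrite dimvS // capvS // addvS // ximgS.
Qed.

Lemma mtype_anti A N i : stable A -> stable N -> (mtype X A N i.+1 <= mtype X A N i)%N.
Proof.
move=> stA stN; rewrite -(leq_add2r (\dim A)) -!mtypeE //.
by rewrite dimvS // capvS // addvS // ximg_anti.
Qed.

Lemma mtype_le_ker A N i : stable A -> (mtype X A N i <= d)%N.
Proof.
move=> stA; rewrite /mtype.
have := limg_ker_dim X (ximg i N + A)%VS.
have := dimvS (capvSr (ximg i N + A)%VS (lker X)).
have /dimvS : (X @: (ximg i N + A) <= ximg i.+1 N + A)%VS by rewrite limgD addvS.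
clia.
Qed.

Lemma sum_mtype m A N : stable A -> stable N -> (A <= N)%VS -> (ximg m N <= A)%VS ->
  (\sum_(i < m) mtype X A N i = \dim N - \dim A)%N.
Proof.
move=> stA stN sAN nil.
have H j : (\sum_(i < j) mtype X A N i = \dim N - \dim (ximg j N + A)%VS)%N.
  elim: j => [|j IHj]; first by rewrite big_ord0 (addv_idPl sAN) subnn.
  rewrite big_ord_recr [LHS]/= IHj /mtype.
  have /dimvS : (ximg j.+1 N + A <= ximg j N + A)%VS by rewrite addvS ?ximg_anti.
  have /dimvS : (ximg j N + A <= N)%VS by rewrite subv_add sAN ximg_sub.
  clia.
by rewrite H (addv_idPr nil).
Qed.

(** The types of L / X^m U and of U / L are complementary in the m x d box: both
    are read off from the dimensions of L + X^j U, as X^i (L + X^(m-i) U) is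
    X^i L + X^m U. *)
Lemma mtype_compl m L : stable L -> (lker X <= ximg m fullv)%VS ->
  (ximg m fullv <= L)%VS -> forall i, (i < m)%N ->
  (mtype X (ximg m fullv) L i + mtype X L fullv (m - i.+1) = d)%N.
Proof.
move=> stL deep sUL i lt_im.
have stU j : stable (ximg j fullv) by apply: stable_ximg; exact: subvf.
have H j : (j <= m)%N -> (\dim (L + ximg (m - j) fullv)%VS =
      \dim (ximg j L + ximg m fullv)%VS + j * d)%N.
  move=> le_jm; have -> : (ximg j L + ximg m fullv)%VS = ximg j (L + ximg (m - j) fullv).
    by rewrite ximgD -ximgA subnKC.
  apply: (@dim_ximg j (ximg (m - j) fullv)) => //; last exact: addvSr.
  by rewrite -ximgA subnKC.
have := H i (ltnW lt_im); have := H i.+1 lt_im.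
have /dimvS : (ximg i.+1 L + ximg m fullv <= ximg i L + ximg m fullv)%VS.
  by rewrite addvS ?subvv ?ximg_anti.
have /dimvS : (L + ximg (m - i) fullv <= L + ximg (m - i.+1) fullv)%VS.
  by rewrite addvS ?subvv // ximg_anti ?leq_sub2l //; exact: subvf.
rewrite /mtype -(subnSK lt_im) [(L + _)%VS]addvC [(L + ximg (m - i.+1) _)%VS]addvC.
by rewrite mulSn; clia.
Qed.

(** N / X^m N is free of rank d over V / X^m, so the kernel of its quotient L / X^m U
    has the type complementary to that of the quotient; so has U / L. *)
Lemma mtype_kernel m L N : stable N -> (lker X <= ximg m N)%VS ->
  (N + ximg m fullv = L)%VS -> forall i, (i < m)%N ->
  mtype X (ximg m N) (N :&: ximg m fullv)%VS i = mtype X L fullv i.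
Proof.
move=> stN deep NL i lt_im.
have stUf : stable fullv by exact: subvf.
have stU j : stable (ximg j fullv) by exact: stable_ximg.
have deepU j : (j <= m)%N -> (lker X <= ximg j fullv)%VS.
  move=> le_jm; apply: subv_trans deep _; apply: (@subv_trans _ _ (ximg j N)).
    exact: ximg_anti.
  by apply: ximgS; exact: subvf.
pose S := (N :&: ximg m fullv)%VS.
have H j : (j <= m)%N -> (\dim (ximg j S + ximg m N)%VS + m * d + \dim L =
   \dim N + \dim (L + ximg j fullv)%VS)%N.
  move=> le_jm.
  have -> : (ximg j S + ximg m N)%VS = ximg j (S + ximg (m - j) N).
    by rewrite ximgD -ximgA subnKC.
  pose Z := (ximg m fullv + ximg (m - j) N)%VS.
  have SZ : (S + ximg (m - j) N = N :&: Z)%VS.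
    by rewrite vspace_modr ?ximg_sub.
  have d1 : \dim (S + ximg (m - j) N)%VS =
      (\dim (ximg j (S + ximg (m - j) N)) + j * d)%N.
    apply: (@dim_ximg j (ximg (m - j) N)) => //; first exact: stable_ximg.
      by rewrite -ximgA subnKC.
    exact: addvSr.
  have NZ : (N + Z = L)%VS.
    by rewrite addvA NL; apply/addv_idPl; rewrite -NL; apply: subv_trans (addvSl _ _); exact: ximg_sub.
  have ZE : Z = ximg (m - j) (L + ximg j fullv).
    rewrite -NL !ximgD -!ximgA subnK // addvAC -addvA.
    rewrite [(ximg m fullv + ximg (m - j + m) fullv)%VS](addv_idPl _).
      by rewrite addvC.
    by apply: ximg_anti => //; rewrite leq_addl.
  have d2 : \dim (L + ximg j fullv)%VS = (\dim Z + (m - j) * d)%N.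
    rewrite ZE; apply: (@dim_ximg m N) => //; last first.
    - by rewrite leqW ?leq_subr.
    by rewrite -NL -addvA addvSl.
  have := dimv_sum_cap N Z; rewrite NZ -SZ.
  have -> : (m * d = (m - j) * d + j * d)%N by rewrite -mulnDl subnK.
  by move: d1 d2; clia.
have := H i (ltnW lt_im); have := H i.+1 lt_im.
rewrite /mtype -/S [(L + _)%VS]addvC [(L + ximg i _)%VS]addvC.
by clia.
Qed.

End Depth.

(** * Sublattices of the fibre product *)
Section PairMaps.
Variables (k : fieldType) (U : vectType k).

Definition prod_map (f g : 'End(U)) (x : U * U) : U * U := (f x.1, g x.2).
Fact prod_map_linear f g : linear (prod_map f g).
Proof. by move=> a x y; rewrite /prod_map /= !linearP. Qed.
HB.instance Definition _ f g :=
  GRing.isLinear.Build k (U * U)%type (U * U)%type _ (prod_map f g) (prod_map_linear f g).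

Definition pair0 (x : U) : U * U := (x, 0).
Fact pair0_linear : linear pair0.
Proof. by move=> a x y; congr (_, _); rewrite /= scaler0 addr0. Qed.
HB.instance Definition _ :=
  GRing.isLinear.Build k U (U * U)%type _ pair0 pair0_linear.

Definition pairf f g : 'End((U * U)%type) := linfun (prod_map f g).
Definition lfun_fst : 'Hom((U * U)%type, U) := linfun fst.
Definition lfun_snd : 'Hom((U * U)%type, U) := linfun snd.
Definition lfun_inl : 'Hom(U, (U * U)%type) := linfun pair0.

Lemma pairfE f g x : pairf f g x = (f x.1, g x.2). Proof. by rewrite lfunE. Qed.
Lemma p1E x : lfun_fst x = x.1. Proof. by rewrite lfunE. Qed.
Lemma p2E x : lfun_snd x = x.2. Proof. by rewrite lfunE. Qed.
Lemma i1E x : lfun_inl x = (x, 0). Proof. by rewrite lfunE. Qed.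

Lemma iter_pairf f j x : iter j (pairf f f) x = (iter j f x.1, iter j f x.2).
Proof. by elim: j => [|j IHj] /=; [case: x | rewrite IHj pairfE]. Qed.

Lemma dim_i1 W : \dim (lfun_inl @: W)%VS = \dim W.
Proof.
apply: limg_dim_eq; apply/eqP; rewrite -subv0; apply/subvP => x.
by rewrite memv_cap memv_ker i1E memv0 => /andP[_ /eqP[->]].
Qed.

Lemma mem_i1 W x : (x \in lfun_inl @: W)%VS = (x.1 \in W) && (x.2 == 0).
Proof.
apply/memv_imgP/andP => [[y Wy ->] | [Wx /eqP x2]]; first by rewrite i1E.
by exists x.1 => //; rewrite i1E -x2; case: x {Wx x2}.
Qed.

Lemma mem_img_fst (W : {vspace U * U}) a b : (a, b) \in W -> a \in (lfun_fst @: W)%VS.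
Proof. by move=> Wx; rewrite -[a]/(a, b).1 -p1E memv_img. Qed.

Lemma mem_img_snd (W : {vspace U * U}) a b : (a, b) \in W -> b \in (lfun_snd @: W)%VS.
Proof. by move=> Wx; rewrite -[b]/(a, b).2 -p2E memv_img. Qed.

Lemma img_fstP (W : {vspace U * U}) a : a \in (lfun_fst @: W)%VS -> exists b, (a, b) \in W.
Proof. by case/memv_imgP => [[a' b] Wx ->]; exists b; rewrite p1E. Qed.

Lemma img_sndP (W : {vspace U * U}) b : b \in (lfun_snd @: W)%VS -> exists a, (a, b) \in W.
Proof. by case/memv_imgP => [[a b'] Wx ->]; exists a; rewrite p2E. Qed.
End PairMaps.

Section Fibre.
Variables (k : finFieldType) (U : vectType k) (X : 'End(U)) (m : nat).
Implicit Types (N : {vspace (U * U)%type}) (W L K : {vspace U}).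
Local Notation q := #|k|.
Local Notation d := (\dim (lker X)).
Local Notation qq n := (qpoch (q%:R^-1 : rat) q%:R^-1 n).
Let XX := pairf X X.
Let YY := pairf (0 : 'End(U)) (lpow X m).
Local Notation p1 := (lfun_fst U).
Local Notation p2 := (lfun_snd U).
Local Notation i1 := (lfun_inl U).

(** R^d inside V^d x V^d, truncated. *)
Definition Rlat : {vspace (U * U)%type} := ((p1 - p2) @^-1: ximg X m fullv)%VS.

Lemma mem_Rlat x : (x \in Rlat) = (x.1 - x.2 \in ximg X m fullv).
Proof. by rewrite -memv_preim add_lfunE opp_lfunE p1E p2E. Qed.

(** The element Y of R acts on V^d x V^d as (0, X^m). *)
Definition Rsub N := [&& (N <= Rlat)%VS, stable XX N & stable YY N].

Hypothesis nilX : exists b, ximg X b fullv = 0%VS.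

Lemma nilXX : exists b, ximg XX b fullv = 0%VS.
Proof.
case: nilX => b nb; exists b; apply/eqP; rewrite -subv0; apply/subvP => y.
case/memv_ximgP => x _ ->; rewrite iter_pairf memv0 -pair_eqE /pair_eq /=.
by rewrite -!memv0 -nb !memv_iter ?memvf.
Qed.

Lemma limg_ximg_pair (p : 'Hom((U * U)%type, U)) N : (forall x, p (XX x) = X (p x)) ->
  (p @: (XX @: N) = X @: (p @: N))%VS.
Proof.
by move=> pX; rewrite -!limg_comp; congr (_ @: _)%VS; apply/lfunP => x; rewrite !comp_lfunE.
Qed.

Lemma p1XX x : p1 (XX x) = X (p1 x). Proof. by rewrite pairfE !p1E. Qed.
Lemma p2XX x : p2 (XX x) = X (p2 x). Proof. by rewrite pairfE !p2E. Qed.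

Lemma stable_p1 N : stable XX N -> stable X (p1 @: N)%VS.
Proof. by move=> sN; rewrite /stable -limg_ximg_pair ?limgS //; exact: p1XX. Qed.

Lemma stable_p2 N : stable XX N -> stable X (p2 @: N)%VS.
Proof. by move=> sN; rewrite /stable -limg_ximg_pair ?limgS //; exact: p2XX. Qed.

Section FixedProjections.
Variables (N1 N2 K1 : {vspace U}).
Hypothesis m_gt0 : (0 < m)%N.
Hypotheses (stN1 : stable X N1) (stN2 : stable X N2) (stK1 : stable X K1).
Hypothesis N12 : (N1 + ximg X m fullv = N2 + ximg X m fullv)%VS.
Hypotheses (deep1 : (lker X <= ximg X m N1)%VS) (deep2 : (lker X <= ximg X m N2)%VS).
Let S1 := (N1 :&: ximg X m fullv)%VS.
Hypotheses (sAK : (ximg X m N1 <= K1)%VS) (sKS : (K1 <= S1)%VS).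

Let F : {vspace (U * U)%type} := (Rlat :&: (p1 @^-1: N1 :&: p2 @^-1: N2))%VS.
Let S : {vspace (U * U)%type} := (F :&: lker p2)%VS.
Let G : {vspace (U * U)%type} := (F :&: lker p1)%VS.
Let K := (i1 @: K1)%VS.

Let memF x : (x \in F) = [&& x.1 - x.2 \in ximg X m fullv, x.1 \in N1 & x.2 \in N2].
Proof. by rewrite !memv_cap mem_Rlat -!memv_preim p1E p2E. Qed.

Let memS x : (x \in S) = (x.1 \in S1) && (x.2 == 0).
Proof.
rewrite memv_cap memF memv_ker p2E memv_cap.
by case: eqP => [->|]; rewrite ?andbF // subr0 mem0v !andbT andbC.
Qed.

Let memG x : (x \in G) = [&& x.1 == 0, x.2 \in N2 & x.2 \in ximg X m fullv].
Proof.
rewrite memv_cap memF memv_ker p1E.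
by case: eqP => [->|]; rewrite ?andbF // sub0r memvN mem0v !andbT andbC.
Qed.

Let stU : stable X (ximg X m fullv).
Proof. by apply: stable_ximg; exact: subvf. Qed.

Let stF : stable XX F.
Proof.
apply/subvP => _ /memv_imgP[x Fx ->]; move: Fx; rewrite !memF pairfE /=.
by move=> /and3P[h1 h2 h3]; rewrite -linearB !(stableV _) //=.
Qed.

Let stS : stable XX S.
Proof.
apply/subvP => _ /memv_imgP[x Fx ->]; move: Fx; rewrite !memS pairfE /=.
case/andP=> h1 /eqP ->; rewrite linear0 eqxx andbT.
by apply: stableV h1; exact: stable_cap.
Qed.

Let stG : stable XX G.
Proof.
apply/subvP => _ /memv_imgP[x Fx ->]; move: Fx; rewrite !memG pairfE /=.
by case/and3P=> /eqP -> h1 h2; rewrite linear0 eqxx !(stableV _).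
Qed.

Let liftF1 b : b \in N2 -> exists2 a, a \in N1 & (a, b) \in F.
Proof.
move=> Nb; have : b \in (N1 + ximg X m fullv)%VS by rewrite N12 (subvP (addvSl _ _)).
case/memv_addP => a Na [z Uz bE]; exists a => //; rewrite memF /= Na Nb !andbT.
by rewrite bE opprD addrA subrr sub0r memvN.
Qed.

Let liftF2 a : a \in N1 -> exists2 b, b \in N2 & (a, b) \in F.
Proof.
move=> Na; have : a \in (N2 + ximg X m fullv)%VS by rewrite -N12 (subvP (addvSl _ _)).
case/memv_addP => b Nb [z Uz aE]; exists b => //; rewrite memF /= Na Nb !andbT.
by rewrite aE addrAC subrr add0r.
Qed.

Let p1F : (p1 @: F = N1)%VS.
Proof.
apply/vspaceP => a; apply/idP/idP => [/img_fstP[b] | /liftF2[b _] /mem_img_fst //].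
by rewrite memF => /and3P[].
Qed.

Let p2F : (p2 @: F = N2)%VS.
Proof.
apply/vspaceP => b; apply/idP/idP => [/img_sndP[a] | /liftF1[a _] /mem_img_snd //].
by rewrite memF => /and3P[].
Qed.

Let dN W : stable X W -> (lker X <= ximg X m W)%VS -> (\dim W = \dim (X @: W)%VS + d)%N.
Proof. by move=> stW dp; apply/dim_limg_ker/(subv_trans dp)/ximg_sub. Qed.

(* dimension count for a subspace between the kernel of p in F and F *)
Let dim_over (p : 'Hom((U * U)%type, U)) (W : {vspace (U * U)%type}) :
  (W <= F)%VS -> (F :&: lker p <= W)%VS ->
  (\dim W = \dim (F :&: lker p)%VS + \dim (p @: W)%VS)%N.
Proof.
move=> sWF sW; rewrite -(limg_ker_dim p W); congr (\dim _ + _)%N.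
apply/eqP; rewrite eqEsubv capvS //= subv_cap sW capvSr //.
Qed.

Let kill (p : 'Hom((U * U)%type, U)) : (p @: (F :&: lker p) = 0)%VS.
Proof. by apply/eqP; rewrite -lkerE capvSr. Qed.

Let dFS : (\dim F = \dim (XX @: F + S)%VS + d)%N.
Proof.
rewrite (dim_over (p := p2)) ?subvv ?capvSl // p2F
  (dim_over (p := p2) (W := (XX @: F + S)%VS)).
- rewrite limgD kill addv0 limg_ximg_pair; last exact: p2XX.
  by rewrite p2F (dN stN2 deep2) addnA.
- by rewrite subv_add [(_ <= F)%VS]stF capvSl.
exact: addvSr.
Qed.

Let dFG : (\dim F = \dim (XX @: F + G)%VS + d)%N.
Proof.
rewrite (dim_over (p := p1)) ?subvv ?capvSl // p1F
  (dim_over (p := p1) (W := (XX @: F + G)%VS)).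
- rewrite limgD kill addv0 limg_ximg_pair; last exact: p1XX.
  by rewrite p1F (dN stN1 deep1) addnA.
- by rewrite subv_add [(_ <= F)%VS]stF capvSl.
exact: addvSr.
Qed.

Let SE : S = (i1 @: S1)%VS.
Proof. by apply/vspaceP => x; rewrite memS mem_i1. Qed.

Let rhoE W : (W <= S1)%VS ->
  rho XX F G (i1 @: W)%VS = (\dim (W + X @: N1)%VS - \dim (X @: N1)%VS)%N.
Proof.
move=> sWS; have sXG : (XX @: F + G <= F)%VS by rewrite subv_add [(_ <= F)%VS]stF capvSl.
have sWF : (i1 @: W <= F)%VS.
  by apply: (@subv_trans _ _ S); rewrite ?capvSl // SE limgS.
rewrite /rho (dim_over (p := p1) sXG) ?addvSr //.
rewrite (dim_over (p := p1) (W := (i1 @: W + (XX @: F + G))%VS)); first last.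
- by rewrite addvA addvSr.
- by rewrite subv_add sWF.
rewrite !limgD kill !addv0 limg_ximg_pair; last exact: p1XX.
rewrite p1F subnDl; congr (\dim (_ + _)%VS - _)%N.
by rewrite -limg_comp -[RHS]lim1g; congr (_ @: _)%VS; apply/lfunP => x;
  rewrite comp_lfunE i1E p1E id_lfunE.
Qed.

Let rho_mtype W : (W <= S1)%VS -> stable X W -> (ximg X m N1 <= W)%VS ->
  rho XX F G (i1 @: W)%VS = mtype X (ximg X m N1) W m.-1.
Proof.
move=> sWS stW sAW; rewrite rhoE // /mtype prednK //.
have sWN : (W <= N1)%VS by apply: subv_trans sWS (capvSl _ _).
have -> : (ximg X m W + ximg X m N1 = ximg X m N1)%VS by apply/addv_idPr/ximgS.
have -> : ximg X m N1 = ximg X m.-1 (X @: N1) by rewrite -ximg1 -ximgA addn1 prednK.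
rewrite -ximgD.
have deep : (lker X <= ximg X m.-1 (X @: N1))%VS by rewrite -ximg1 -ximgA addn1 prednK.
have st : stable X (X @: N1)%VS by apply: (stable_ximg 1).
rewrite (dim_ximg st deep (addvSr W _) (leqnSn _)).
by rewrite [X in (_ - X)%N](dim_ximg st deep (subvv _) (leqnSn _)) subnDr.
Qed.

(** In F = N1 x N2 cap R^d, the kernels of the projections to N2 and to N1 are S
    and G. The conditions on N are those of [lifts], and stability under (0, X^m)
    is automatic: (0, X^m b) = X^m (a, b) - (X^m a, 0), where X^m a lies in K1. *)
Lemma card_fixed_projections :
  #|[set N | [&& Rsub N, (p1 @: N == N1)%VS, (p2 @: N == N2)%VS
               & (i1 @^-1: N == K1)%VS]]|%:R =
  (q ^ (d * (\dim S1 - \dim K1)))%:R *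
    (qq (mtype X (ximg X m N1) S1 m.-1) / qq (mtype X (ximg X m N1) K1 m.-1)).
Proof.
have sKF : (K <= S)%VS by rewrite SE limgS.
have stK : stable XX K.
  apply/subvP => _ /memv_imgP[x Fx ->]; move: Fx; rewrite !mem_i1 pairfE /=.
  by case/andP => h1 /eqP->; rewrite linear0 eqxx andbT; exact: stableV h1.
have stS1 : stable X S1 by apply: stable_cap.
have sAS : (ximg X m N1 <= S1)%VS by rewrite subv_cap ximg_sub // ximgS // subvf.
rewrite -(rho_mtype (subvv _) stS1 sAS) -(rho_mtype sKS stK1 sAK) -SE.
rewrite -[\dim S1]dim_i1 -[\dim K1]dim_i1 -SE -/K.
rewrite -(@card_lifts _ _ XX nilXX F S G m.-1 d); first last.
- exact: sKF.
- rewrite prednK //; apply/subvP => x; rewrite memv_cap memS mem_i1 => /andP[].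
  case/memv_ximgP => y; rewrite memF => /and3P[_ y1 _] -> /andP[_ ->].
  by rewrite iter_pairf /= andbT (subvP sAK) // memv_iter.
- exact: stK.
- exact: dFG.
- exact: dFS.
- move=> x Fx; rewrite memS pairfE /= => /andP[_ Xx0].
  move: (Fx); rewrite memF => /and3P[_ x1 x2].
  have /memv_ximgP[b Nb xE] : x.2 \in ximg X m.-1 N2.
    apply: (subvP (subv_trans deep2 _)) (_ : x.2 \in lker X); last by rewrite memv_ker.
    by apply: ximg_anti => //; exact: leq_pred.
  have [a Na Fab] := liftF1 Nb.
  have Fy : iter m.-1 XX (a, b) \in ximg XX m.-1 F by exact: memv_iter.
  apply/memv_addP; exists (x - iter m.-1 XX (a, b)); last first.
    by exists (iter m.-1 XX (a, b)); rewrite ?subrK.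
  rewrite memv_cap memvB ?(subvP (ximg_sub _ stF) _ Fy) //= memv_ker linearB /= !p2E.
  by rewrite iter_pairf /= xE subrr.
- exact: capvSl.
- exact: capvSl.
- exact: stG.
- exact: stS.
- exact: stF.
congr _%:R; apply: eq_card => N; rewrite !inE.
apply/and4P/and5P => [[/and3P[sNR stN stYN] /eqP pN1 /eqP pN2 /eqP iK] |
                      [sNF stN /eqP NS /eqP NSF /eqP NGF]].
  have memN a : ((a, 0) \in N) = (a \in K1) by rewrite -iK -memv_preim i1E.
  have sNF : (N <= F)%VS.
    apply/subvP => [[a b]] Nx; rewrite memF -mem_Rlat (subvP sNR) //=.
    by rewrite -pN1 -pN2 (mem_img_fst Nx) (mem_img_snd Nx).
  split=> //.
  - apply/eqP/vspaceP => [[a b]]; rewrite memv_cap memS mem_i1 /=.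
    apply/and3P/andP => [[Nx _ /eqP b0] | [Ka /eqP b0]].
      by rewrite b0 eqxx -memN -b0.
    by rewrite b0 memN Ka eqxx (subvP sKS).
  - rewrite eqEsubv subv_add sNF capvSl /=; apply/subvP => [[a b]] Fx.
    have : b \in (p2 @: N)%VS by rewrite pN2 -p2F (mem_img_snd Fx).
    case/img_sndP => a' Nx; apply/memv_addP; exists (a', b) => //.
    exists (a - a', 0); last by congr (_, _); rewrite /= ?addr0 // addrC subrK.
    have -> : (a - a', 0) = (a, b) - (a', b) by congr (_, _); rewrite /= subrr.
    rewrite memv_cap memv_ker p2E /= subrr eqxx andbT.
    by rewrite memvB // (subvP sNF).
  rewrite eqEsubv subv_add sNF capvSl /=; apply/subvP => [[a b]] Fx.
  have : a \in (p1 @: N)%VS by rewrite pN1 -p1F (mem_img_fst Fx).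
  case/img_fstP => b' Nx; apply/memv_addP; exists (a, b') => //.
  exists (0, b - b'); last by congr (_, _); rewrite /= ?addr0 // addrC subrK.
  have -> : (0, b - b') = (a, b) - (a, b') by congr (_, _); rewrite /= subrr.
  rewrite memv_cap memv_ker p1E /= subrr eqxx andbT.
  by rewrite memvB // (subvP sNF).
have pN1 : (p1 @: N = N1)%VS by rewrite -p1F -NGF limgD kill addv0.
have pN2 : (p2 @: N = N2)%VS by rewrite -p2F -NSF limgD kill addv0.
have memN a : ((a, 0) \in N) = (a \in K1).
  apply/idP/idP => [Nx | Ka].
    have Sx : (a, 0) \in S by rewrite memv_cap (subvP sNF _ Nx) memv_ker p2E /=.
    have : (a, 0) \in (N :&: S)%VS by rewrite memv_cap Nx.
    by rewrite NS mem_i1 => /andP[].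
  have : (a, 0) \in (N :&: S)%VS by rewrite NS mem_i1 /= Ka eqxx.
  by rewrite memv_cap => /andP[].
split; last 3 first.
- exact/eqP.
- exact/eqP.
- by apply/eqP/vspaceP => a; rewrite -memv_preim i1E memN.
apply/and3P; split=> //; first by apply: subv_trans sNF (capvSl _ _).
apply/subvP => _ /memv_imgP[[a b] Nx ->]; rewrite pairfE /= zero_lfunE lpowE.
have -> : (0, iter m X b) = iter m XX (a, b) - (iter m X a, 0).
  by rewrite iter_pairf; congr (_, _); rewrite /= ?subrr ?subr0.
rewrite memvB ?stable_iter // memN (subvP sAK) // memv_iter //.
by rewrite -pN1 (mem_img_fst Nx).
Qed.
End FixedProjections.
End Fibre.

Section Count.
Variables (k : finFieldType) (U : vectType k) (X : 'End(U)) (m n : nat).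
Implicit Types (N : {vspace (U * U)%type}) (W L K : {vspace U}).
Local Notation q := #|k|.
Local Notation ximg := (ximg X).
Local Notation d := (\dim (lker X)).
Local Notation qq n := (qpoch (q%:R^-1 : rat) q%:R^-1 n).
Local Notation XX := (pairf X X).
Local Notation p1 := (lfun_fst U).
Local Notation p2 := (lfun_snd U).
Local Notation i1 := (lfun_inl U).
Local Notation Um := (ximg m fullv).
Local Notation Rsub := (Rsub X m).
Local Notation mtype := (mtype X).

Hypothesis nilX : exists b, ximg b fullv = 0%VS.
Hypothesis m_gt0 : (0 < m)%N.
Hypothesis deep : (lker X <= ximg (n + m) fullv)%VS.

Local Notation stable := (stable X).

Let stf : stable fullv. Proof. exact: subvf. Qed.
Let stUm : stable Um. Proof. exact: stable_ximg. Qed.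

Let deepU i : (i <= n + m)%N -> (lker X <= ximg i fullv)%VS.
Proof. by move=> le; apply: subv_trans deep _; exact: ximg_anti. Qed.

(** The common lattice L = N1 + X^m U = N2 + X^m U of a sublattice of R^d. *)
Definition hull N : {vspace U} := (p1 @: N + Um)%VS.

Lemma Rsub_facts N : Rsub N -> [/\ stable (p1 @: N)%VS, stable (p2 @: N)%VS,
   (p1 @: N + Um = p2 @: N + Um)%VS, stable (i1 @^-1: N)%VS &
   (ximg m (p1 @: N) <= i1 @^-1: N)%VS /\
   (i1 @^-1: N <= p1 @: N :&: Um)%VS].
Proof.
case/and3P=> sNR stN stYN; split.
- exact: stable_p1.
- exact: stable_p2.
- apply/eqP; rewrite eqEsubv !subv_add !addvSr !andbT.
  apply/andP; split; apply/subvP.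
    move=> a /img_fstP[b Nx]; rewrite -[a](subrK b) addrC memv_add ?(mem_img_snd Nx) //.
    by have := subvP sNR _ Nx; rewrite mem_Rlat.
  move=> b /img_sndP[a Nx]; rewrite -[b](subrK a) addrC memv_add ?(mem_img_fst Nx) //.
  by have := subvP sNR _ Nx; rewrite mem_Rlat /= -memvN opprB.
- apply/subvP => y /memv_imgP[a]; rewrite -memv_preim i1E => Na -> {y}.
  rewrite -memv_preim i1E; have := stableV stN Na.
  by rewrite pairfE /= linear0.
split.
  apply/subvP => y /memv_ximgP[a /img_fstP[b Nx] ->] {y}.
  rewrite -memv_preim i1E; have := stable_iter m stN Nx; rewrite iter_pairf /= => N1.
  have := stableV stYN Nx; rewrite pairfE /= zero_lfunE lpowE => N2.
  suff -> : (iter m X a, 0) = (iter m X a, iter m X b) - (0, iter m X b) by exact: memvB.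
  by congr (_, _); rewrite /= ?subr0 ?subrr.
apply/subvP => a; rewrite -memv_preim i1E => Na; rewrite memv_cap (mem_img_fst Na).
by have := subvP sNR _ Na; rewrite mem_Rlat /= subr0.
Qed.

Definition fibre_data (a b : nat -> nat) (e1 e2 : nat) :=
  [set N | [&& Rsub N, [forall i : 'I_m, mtype (hull N) fullv i == a i],
     [forall i : 'I_m, mtype (ximg m (p1 @: N)) (i1 @^-1: N) i == b i],
     (\dim (p1 @: N) + e1 == \dim (hull N))%N &
     (\dim (p2 @: N) + e2 == \dim (hull N))%N]].

(** The type of L / X^m U when U / L has type a, see [mtype_compl]. *)
Definition compl_type (a : nat -> nat) (i : nat) : nat :=
  if (i < m)%N then (d - a (m - i.+1))%N else 0.

Lemma eq_hall_count (b e : nat) (bb bb' aa aa' : nat -> nat) :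
  (forall i, (i < e)%N -> bb i = bb' i) -> (forall i, (i <= e)%N -> aa i = aa' i) ->
  hall_count b e bb aa = hall_count b e bb' aa'.
Proof.
move=> eqb eqa; apply: eq_bigr => i _.
by rewrite eqb // !eqa // 1?ltnW.
Qed.

Lemma card_hulls (a : nat -> nat) :
    (forall i, (a i.+1 <= a i <= d)%N) ->
  #|[set L | [&& (Um <= L)%VS, stable L & [forall i : 'I_m, mtype L fullv i == a i]]]| =
  hall_count q m (fun=> d) (compl_type a).
Proof.
move=> a_le; have deepm : (lker X <= Um)%VS by apply: deepU; exact: leq_addl.
have mtU i : (i < m)%N -> mtype Um fullv i = d.
  move=> lt_im; rewrite -[RHS](@mtype_compl _ _ X m fullv stf deepm (subvf _) i lt_im).
  rewrite [X in (_ + X)%N](_ : _ = 0%N) ?addn0 //.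
  by rewrite /mtype !(addv_idPr (subvf _)) subnn.
rewrite -(@eq_hall_count q m (mtype Um fullv) (fun=> d) (compl_type a) (compl_type a)) //.
rewrite -(@card_submodules_type _ _ X m Um fullv (compl_type a)) ?subvf //; first last.
- by rewrite /compl_type ltnn.
- move=> i lt_im; rewrite mtU // /compl_type lt_im; case: ifP => lt; last by clia.
  have := a_le (m - i.+2)%N; rewrite -(subnSK lt); clia.
apply: eq_card => L; rewrite !inE subvf /=; case: (boolP (Um <= L)%VS) => //= sUL.
case: (boolP (stable L)) => //= stL.
have H i : (i < m)%N -> (mtype Um L i + mtype L fullv (m - i.+1) = d)%N.
  by move=> lt; exact: mtype_compl.
apply/forallP/forallP => /= hyp i; apply/eqP.
  have := H i (ltn_ord i).
  have /eqP : mtype L fullv (m - i.+1) == a (m - i.+1)%N.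
    by have := hyp (rev_ord i).
  by rewrite /compl_type ltn_ord; clia.
have lt : (m - i.+1 < m)%N by have := ltn_ord i; clia.
have := H _ lt; have /eqP := hyp (rev_ord i); rewrite /compl_type /= lt.
have -> : (m - (m - i.+1).+1 = i)%N by have := ltn_ord i; clia.
have /andP[_] := a_le i; clia.
Qed.

(** Three successive fibrations, N |-> L, then (N1, N2), then K1, all with fibres
    of constant cardinality. The bounds by n ensure that X is as good as
    injective on the lattices involved, although U is truncated. *)
Lemma card_fibre_data (a b : nat -> nat) (e1 e2 : nat) :
    (forall i, (a i.+1 <= a i <= d)%N) -> (forall i, (b i.+1 <= b i <= a i)%N) ->
    a m = 0%N ->
    (\sum_(i < m) a i + e1 <= n)%N -> (\sum_(i < m) a i + e2 <= n)%N ->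
  #|fibre_data a b e1 e2|%:R =
    (hall_count q m (fun=> d) (compl_type a))%:R *
    (fcoef (span_series q d (a m.-1)) e1 * fcoef (span_series q d (a m.-1)) e2 *
      ((hall_count q m a b)%:R *
        ((q ^ (d * (\sum_(i < m) a i - \sum_(i < m) b i)))%:R *
          (qq (a m.-1) / qq (b m.-1))))).
Proof.
move=> a_le b_le am le1 le2; rewrite -card_hulls //.
have bm : b m = 0%N by have /andP[_] := b_le m; rewrite am; clia.
have deepm : (lker X <= Um)%VS by apply: deepU; exact: leq_addl.
set g1 := fcoef _ e1; set g2 := fcoef _ e2.
apply: (card_uniform_fibers_natr (f := hull)) => [N|L].
  rewrite !inE => /and5P[RN -> _ _ _]; rewrite addvSr andbT /=.
  by have [st1 _ _ _ _] := Rsub_facts RN; exact: stableD.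
rewrite inE => /and3P[sUL stL /forallP/= typL].
have dimL : (\dim (fullv : {vspace U}) = \dim L + \sum_(i < m) a i)%N.
  have := @sum_mtype _ _ X m L fullv stL stf (subvf _) sUL.
  rewrite (eq_bigr (fun i : 'I_m => a i)) => [|i _]; last exact/eqP/typL.
  by move=> ->; rewrite subnKC // dimvS // subvf.
pose A e := [set W | [&& (W <= L)%VS, stable W, (W + Um == L)%VS
                            & (\dim W + e == \dim L)%N]].
have deepL e : (e <= n)%N -> (lker X <= ximg e L)%VS.
  move=> le; apply: (@subv_trans _ _ (ximg e Um)); last exact: ximgS.
  by rewrite -ximgA; apply: deepU; rewrite leq_add2r.
have cardA e : (\sum_(i < m) a i + e <= n)%N ->
    #|A e|%:R = fcoef (span_series q d (a m.-1)) e.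
  move=> le; have le_en : (e <= n)%N by apply: leq_trans le; exact: leq_addl.
  rewrite /A (@card_spanning_lattices _ _ X nilX e L Um stL stUm sUL (deepL _ le_en)).
  congr (fcoef (span_series _ _ _) _).
  have := typL (Ordinal (etrans (congr1 (leq^~ m) (prednK m_gt0)) (leqnn m))).
  move/eqP <-; rewrite /= /mtype prednK // (addv_idPr sUL).
  have -> : (Um + X @: L = X @: (ximg m.-1 fullv + L))%VS.
    by rewrite limgD; congr (_ + _)%VS; rewrite -ximg1 -ximgA add1n prednK.
  have kL : (lker X <= L)%VS by apply: subv_trans deepm sUL.
  rewrite [\dim (ximg _ _ + _)%VS](@dim_limg_ker _ _ X).
    by rewrite [\dim L](@dim_limg_ker _ _ X) // subnDr.
  by apply: subv_trans kL _; exact: addvSr.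
rewrite /g1 /g2 -cardA // -cardA // -natrM -cardsX.
apply: (card_uniform_fibers_natr (f := fun N => (p1 @: N, p2 @: N)%VS)) => [N|].
  rewrite !inE /= => /andP[/and5P[RN _ _ /eqP d1 /eqP d2] /eqP hN].
  have [-> -> eq12 _ _] := Rsub_facts RN.
  by rewrite -hN d1 d2 !eqxx /hull -eq12 !eqxx addvSl [in X in _ && X]eq12 addvSl.
move=> [N1 N2]; rewrite !inE /= => /andP[].
move=> /and4P[sN1 st1 /eqP N1L /eqP d1] /and4P[sN2 st2 /eqP N2L /eqP d2].
have deepN W e : (W <= L)%VS -> stable W -> (\dim W + e = \dim L)%N ->
    (\sum_(i < m) a i + e <= n)%N -> (lker X <= ximg m W)%VS.
  move=> sW stW dW le; apply: subv_trans deep _; rewrite addnC ximgA ximgS //.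
  by apply: codim_stable => //; [exact: subvf | move: dimL dW le; clia].
have deep1 := deepN _ _ sN1 st1 d1 le1; have deep2 := deepN _ _ sN2 st2 d2 le2.
pose S1 := (N1 :&: Um)%VS; pose A1 := ximg m N1.
have sAS : (A1 <= S1)%VS by rewrite subv_cap ximg_sub // ximgS // subvf.
have stS1 : stable S1 by exact: stable_cap.
have stA1 : stable A1 by exact: stable_ximg.
have typS1 i : (i < m)%N -> mtype A1 S1 i = a i.
  move=> lt; rewrite (mtype_kernel st1 deep1 N1L lt).
  exact/eqP/(typL (Ordinal lt)).
have nilS1 : (ximg m S1 <= A1)%VS by apply: ximgS; exact: capvSl.
have hallE : hall_count q m a b = hall_count q m (mtype A1 S1) b.
  by apply: eq_hall_count => // i lt; rewrite typS1.
rewrite hallE -(@card_submodules_type _ _ X m A1 S1 b) //; last first.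
  by move=> i lt; rewrite typS1.
have typ0 i : (i < m)%N -> (i < m)%N by [].
apply: (card_uniform_fibers_natr (f := fun N => i1 @^-1: N)%VS) => [N|K1].
  rewrite !inE => /andP[/andP[/and5P[RN _ tb _ _] _] /eqP[p1E _]].
  have [_ _ _ stK [sAK sKS]] := Rsub_facts RN.
  by rewrite p1E in sAK sKS tb; rewrite sAK sKS stK tb.
rewrite inE => /and4P[sAK sKS stK /forallP/= typK].
have sumS : (\sum_(i < m) a i = \dim S1 - \dim A1)%N.
  rewrite -(sum_mtype stA1 stS1 sAS nilS1); apply: eq_bigr => i _.
  by rewrite typS1.
have sumK : (\sum_(i < m) b i = \dim K1 - \dim A1)%N.
  have nilK : (ximg m K1 <= A1)%VS by apply: subv_trans (ximgS X m sKS) nilS1.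
  rewrite -(sum_mtype stA1 stK sAK nilK); apply: eq_bigr => i _.
  by apply/esym/eqP/typK.
have -> : (\sum_(i < m) a i - \sum_(i < m) b i = \dim S1 - \dim K1)%N.
  by move: (dimvS sAK); rewrite sumS sumK; clia.
have lt1 : (m.-1 < m)%N by rewrite prednK.
rewrite -(typS1 _ lt1) -(eqP (typK (Ordinal lt1))).
rewrite -(card_fixed_projections nilX m_gt0 st1 st2 stK) ?N1L ?N2L //.
congr _%:R; apply: eq_card => N; rewrite !inE.
apply/idP/idP.
  case/andP=> /andP[/andP[/and5P[RN _ _ _ _] _] /eqP[-> ->]] ->.
  by rewrite RN !eqxx.
case/and4P=> RN /eqP p1E /eqP p2E /eqP iE.
have hN : hull N = L by rewrite /hull p1E.
rewrite RN hN p1E p2E iE d1 d2 !eqxx !andbT andTb.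
by apply/andP; split; apply/forallP.
Qed.

(** dim N = dim K1 + dim N2, where dim K1 - dim X^m N1 = |mu|; the rest is the
    comparison of N1 and N2 with L and of L with U. *)
Lemma dim_Rsub N : Rsub N -> (\dim (fullv : {vspace U}) <= \dim (p1 @: N)%VS + n)%N ->
  (\dim N + 2 * (\sum_(i < m) mtype (hull N) fullv i)
    + (\dim (hull N) - \dim (p1 @: N)%VS) + (\dim (hull N) - \dim (p2 @: N)%VS) =
   \dim (Rlat X m) + \sum_(i < m) mtype (ximg m (p1 @: N)) (i1 @^-1: N) i)%N.
Proof.
move=> RN le; have [st1 st2 eq12 stK [sAK sKS]] := Rsub_facts RN.
have sUL : (Um <= hull N)%VS by exact: addvSr.
have stL : stable (hull N) by exact: stableD.
set N1 := (p1 @: N)%VS in st1 eq12 sAK sKS le *.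
have stA : stable (ximg m N1) by exact: stable_ximg.
have nilK : (ximg m (i1 @^-1: N) <= ximg m N1)%VS.
  by apply: ximgS; apply: subv_trans sKS (capvSl _ _).
have deepN : (lker X <= ximg m N1)%VS.
  apply: subv_trans deep _; rewrite addnC ximgA ximgS //.
  by apply: codim_stable => //; exact: subvf.
rewrite (@sum_mtype _ _ X m (hull N) fullv) ?subvf //.
rewrite (sum_mtype stA stK sAK nilK).
have d1 := dim_ximg st1 deepN (subvv _) (leqnSn m).
have dU := dim_ximg st1 deepN (subvf _) (leqnSn m).
have dN : (\dim N = \dim (i1 @^-1: N)%VS + \dim (p2 @: N)%VS)%N.
  rewrite -(limg_ker_dim p2 N); congr (_ + _)%N.
  suff -> : (N :&: lker p2 = i1 @: (i1 @^-1: N))%VS by rewrite dim_i1.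
  apply/vspaceP => x; rewrite mem_i1 -memv_preim i1E memv_cap memv_ker p2E.
  by case: x => [a b] /=; case: eqP => [->|]; rewrite ?andbF ?andbT.
have dR : (\dim (Rlat X m) = \dim Um + \dim (fullv : {vspace U}))%N.
  rewrite -(limg_ker_dim p2 (Rlat X m)); congr (_ + _)%N.
    suff -> : (Rlat X m :&: lker p2 = i1 @: Um)%VS by rewrite dim_i1.
    apply/vspaceP => x.
    rewrite mem_i1 memv_cap memv_ker p2E mem_Rlat.
    by case: eqP => [->|]; rewrite ?andbF ?andbT // subr0.
  suff -> : (p2 @: Rlat X m = fullv)%VS by [].
  apply/vspaceP => b; rewrite memvf.
  apply: (@mem_img_snd _ _ _ b); by rewrite mem_Rlat /= subrr mem0v.
have := dimvS sAK; have := dimvS (addvSl N1 Um).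
have : (\dim (p2 @: N) <= \dim (hull N))%N by rewrite dimvS // /hull eq12 addvSl.
have := dimvS (subvf (hull N)).
rewrite -/(hull N); move: d1 dU dN dR; clia.
Qed.

Lemma codim_p1 N : Rsub N -> (\dim N + n = \dim (Rlat X m))%N ->
  (\dim (fullv : {vspace U}) <= \dim (p1 @: N)%VS + n)%N.
Proof.
move=> /and3P[sNR _ _] dN.
have := limg_ker_dim p1 (Rlat X m); have := limg_ker_dim p1 N.
have -> : (p1 @: (Rlat X m) = fullv)%VS.
  apply/vspaceP => a; rewrite memvf; apply: (@mem_img_fst _ _ _ _ a).
  by rewrite mem_Rlat /= subrr mem0v.
have /dimvS : (N :&: lker p1 <= Rlat X m :&: lker p1)%VS by rewrite capvS.
move=> le eN eR; rewrite -(leq_add2l (\dim (Rlat X m :&: lker p1)%VS)) eR -dN -eN.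
by rewrite -addnA leq_add2r.
Qed.

End Count.

(** * The coefficients of the zeta function of R *)
Lemma sum_card_codes (I : finType) (A : {set I}) (C : eqType) (s : seq C)
    (P : I -> pred C) : uniq s ->
    (forall i, i \in A -> exists2 c, c \in s &
        forall c', c' \in s -> P i c' = (c' == c)) ->
  #|A| = (\sum_(c <- s) #|[set i in A | P i c]|)%N.
Proof.
move=> us hP; transitivity (\sum_(c <- s) \sum_(i in A) P i c)%N; last first.
  apply: eq_bigr => c _; rewrite -sum1_card [LHS]big_mkcond [RHS]big_mkcond.
  by apply: eq_bigr => i _; rewrite inE; case: ifP => //= _; case: (P i c).
rewrite exchange_big -sum1_card; apply: eq_bigr => i iA.
have [c cs cP] := hP i iA; rewrite big_seq.
rewrite (eq_bigr (fun c' => (c' == c) : nat)) => [|c' /cP -> //].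
rewrite -big_seq; transitivity (count_mem c s); first by rewrite count_uniq_mem // cs.
by rewrite -sum1_count [LHS]big_mkcond; apply: eq_bigr => c' _ /=; case: eqP.
Qed.

Section Total.
Variables (k : finFieldType) (U : vectType k) (X : 'End(U)) (m n : nat).
Implicit Types (N : {vspace (U * U)%type}).
Local Notation q := #|k|.
Local Notation d := (\dim (lker X)).
Local Notation qq n := (qpoch (q%:R^-1 : rat) q%:R^-1 n).
Local Notation Rsub := (Rsub X m).
Local Notation mtype := (mtype X).
Local Notation p1 := (lfun_fst U).
Local Notation p2 := (lfun_snd U).
Local Notation i1 := (lfun_inl U).

Hypothesis nilX : exists b, ximg X b fullv = 0%VS.
Hypothesis m_gt0 : (0 < m)%N.
Hypothesis deep : (lker X <= ximg X (n + m) fullv)%VS.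

Definition type_coef (a b : nat -> nat) : rat :=
  (hall_count q m (fun=> d) (compl_type X m a))%:R * (hall_count q m a b)%:R *
  ((q ^ (d * (\sum_(i < m) a i - \sum_(i < m) b i)))%:R * (qq (a m.-1) / qq (b m.-1))).

(** The pairs of types are indexed by a sequence s of codes, each standing for a
    weakly decreasing function v c, so that partitions can be plugged in below. *)
Lemma card_Rsub (C : eqType) (s : seq C) (v : C -> nat -> nat) : uniq s ->
    (forall c, c \in s -> forall i, (v c i.+1 <= v c i <= d)%N) ->
    (forall c, c \in s -> v c m = 0%N) ->
    (forall f, (forall i, (f i.+1 <= f i <= d)%N) -> exists2 c, c \in s &
        forall c', c' \in s -> [forall i : 'I_m, f i == v c' i] = (c' == c)) ->
    (forall c c', c \in s -> c' \in s ->
       [forall i : 'I_m, (v c' i <= v c i)%N] -> forall i, (v c' i <= v c i)%N) ->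
  #|[set N | Rsub N && (\dim N + n == \dim (Rlat X m))%N]|%:R =
  fcoef (\sum_(c <- s) \sum_(c' <- s | [forall i : 'I_m, (v c' i <= v c i)%N])
     fpsC (type_coef (v c) (v c')) *
       (fpsX rat ^+ (2 * (\sum_(i < m) v c i) - \sum_(i < m) v c' i) *
          (span_series q d (v c m.-1) * span_series q d (v c m.-1)))) n.
Proof.
move=> us v_le vm v_code v_ext; set A := [set N | _].
have stf : stable X fullv by exact: subvf.
have stUm : stable X (ximg X m fullv) by exact: stable_ximg.
rewrite (sum_card_codes (s := s)
  (P := fun N c => [forall i : 'I_m, mtype (hull X m N) fullv i == v c i])) //; last first.
  move=> N; rewrite inE => /andP[RN _]; apply: v_code => i.
  have stL : stable X (hull X m N) by apply: stableD => //; have [] := Rsub_facts RN.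
  by rewrite mtype_anti // mtype_le_ker.
rewrite natr_sum fcoef_sum big_seq [RHS]big_seq; apply: eq_bigr => c cs.
rewrite (sum_card_codes (s := s)
  (P := fun N c => [forall i : 'I_m, mtype (ximg X m (p1 @: N)) (i1 @^-1: N) i == v c i])) //; last first.
  move=> N; rewrite inE => /andP[]; rewrite inE => /andP[RN _] _; apply: v_code => i.
  have [st1 _ _ stK _] := Rsub_facts RN.
  have stA : stable X (ximg X m (p1 @: N)) by exact: stable_ximg.
  by rewrite mtype_anti // mtype_le_ker.
rewrite natr_sum fcoef_sum [RHS]big_mkcond big_seq [RHS]big_seq; apply: eq_bigr => c' c's.
set B := [set N in _ | _].
have BP N : N \in B -> [/\ Rsub N, (\dim N + n = \dim (Rlat X m))%N,
   [forall i : 'I_m, mtype (hull X m N) fullv i == v c i] &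
   [forall i : 'I_m, mtype (ximg X m (p1 @: N)) (i1 @^-1: N) i == v c' i]].
  by rewrite inE => /andP[]; rewrite inE => /andP[]; rewrite inE => /andP[? /eqP ?].
pose a := (\sum_(i < m) v c i)%N; pose b := (\sum_(i < m) v c' i)%N.
have sum_a N : [forall i : 'I_m, mtype (hull X m N) fullv i == v c i] ->
    (\sum_(i < m) mtype (hull X m N) fullv i = a)%N.
  by move=> /forallP ta; apply: eq_bigr => i _; exact/eqP/ta.
have sum_b N : [forall i : 'I_m, mtype (ximg X m (p1 @: N)) (i1 @^-1: N) i == v c' i] ->
    (\sum_(i < m) mtype (ximg X m (p1 @: N)) (i1 @^-1: N) i = b)%N.
  by move=> /forallP tb; apply: eq_bigr => i _; exact/eqP/tb.
have Bdim N : N \in B -> (2 * a + (\dim (hull X m N) - \dim (p1 @: N)%VS) +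
    (\dim (hull X m N) - \dim (p2 @: N)%VS) = n + b)%N.
  case/BP=> RN dN /sum_a ta /sum_b tb.
  have := dim_Rsub nilX deep RN (codim_p1 RN dN).
  by rewrite -dN ta tb; clia.
have deepN N : Rsub N -> (\dim N + n = \dim (Rlat X m))%N ->
    (lker X <= ximg X m (p1 @: N))%VS.
  move=> RN dN; apply: subv_trans deep _; rewrite addnC ximgA ximgS //.
  have [st1 _ _ _ _] := Rsub_facts RN.
  by apply: codim_stable => //; [exact: subvf | exact: codim_p1 RN dN].
case: ifPn => [le_cc | nle_cc]; last first.
  rewrite [X in X%:R](_ : _ = 0%N) //; apply/eqP; rewrite cards_eq0 -finset.subset0.
  apply/fintype.subsetP => N NB; have [RN dN /forallP/= ta /forallP/= tb] := BP N NB.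
  case/negP: nle_cc; apply/forallP => i; rewrite -(eqP (ta i)) -(eqP (tb i)).
  have [st1 _ _ stK [sAK sKS]] := Rsub_facts RN.
  rewrite -(mtype_kernel st1 (deepN _ RN dN) (erefl _)) //.
  by apply: mtypeM => //; exact: stable_ximg.
have le_v := v_ext c c' cs c's le_cc.
have le_ba : (b <= a)%N by apply: leq_sum => i _; exact: le_v.
rewrite fcoefCM fcoefXnM -/a -/b; case: ifPn => [le_n | nle_n]; last first.
  rewrite mulr0 [X in X%:R](_ : _ = 0%N) //; apply/eqP; rewrite cards_eq0 -finset.subset0.
  by apply/fintype.subsetP => N /Bdim; move: le_ba nle_n; clia.
rewrite fcoef_mul -sum1_card.
rewrite (partition_big (fun N => inord (\dim (hull X m N) - \dim (p1 @: N)%VS)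
   : 'I_(n - (2 * a - b)).+1) xpredT) // natr_sum mulr_sumr.
apply: eq_bigr => e _.
have e_le := ltn_ord e.
have -> : (\sum_(N in B | inord (\dim (hull X m N) - \dim (p1 @: N)%VS) == e) 1 =
   #|fibre_data X m (v c) (v c') e (n - (2 * a - b) - e)|)%N.
  rewrite -sum1_card; apply: eq_bigl => N; rewrite [RHS]inE.
  apply/andP/and5P => [[NB /eqP/(congr1 val)] | [RN ta tb /eqP d1 /eqP d2]].
    have [RN dN ta tb] := BP N NB; have dB := Bdim N NB.
    rewrite /= inordK; last by move: dB le_ba le_n; clia.
    have [_ _ eq12 _ _] := Rsub_facts RN => eE.
    have s1 : (\dim (p1 @: N) <= \dim (hull X m N))%N by rewrite dimvS // addvSl.
    have s2 : (\dim (p2 @: N) <= \dim (hull X m N))%N by rewrite dimvS // /hull eq12 addvSl.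
    by split=> //; apply/eqP; move: eE s1 s2 dB le_ba le_n; clia.
  have e1E : (\dim (hull X m N) - \dim (p1 @: N)%VS = e)%N by rewrite -d1 addKn.
  have dU : (\dim (fullv : {vspace U}) <= \dim (p1 @: N)%VS + n)%N.
    have := @sum_mtype _ _ X m (hull X m N) fullv _ stf (subvf _) (addvSr _ _).
    have [st1 _ _ _ _] := Rsub_facts RN; move/(_ (stableD st1 stUm)).
    rewrite (sum_a _ ta).
    by move: d1 le_ba e_le le_n (dimvS (subvf (hull X m N))); clia.
  split; last by apply/eqP/val_inj; rewrite /= inordK e1E.
  rewrite !inE RN ta tb !andbT /=; apply/eqP.
  have := dim_Rsub nilX deep RN dU.
  rewrite (sum_a _ ta) (sum_b _ tb) e1E -d2 addKn.
  by move: le_ba le_n e_le; clia.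
rewrite (card_fibre_data nilX m_gt0 deep) //; first last.
- by rewrite -/a; move: le_ba le_n e_le; clia.
- by rewrite -/a; move: le_ba le_n e_le; clia.
- exact: vm.
- by move=> i; rewrite le_v andbT; have /andP[] := v_le c' c's i.
- exact: v_le.
rewrite /type_coef -/a -/b.
by rewrite [(fcoef _ _ * fcoef _ _) * _]mulrC !mulrA.
Qed.
End Total.

(** * Partitions and Hall numbers *)
Section Partitions.
Local Open Scope nat_scope.
Implicit Types (l mu : seq nat).

Lemma is_partition_cons x l : is_partition (x :: l) ->
  [/\ 0 < x, is_partition l & all (geq x) l].
Proof.
case/and3P => /= srt x0 al.
have tr : transitive geq by move=> a b c ? h; exact: leq_trans h _.
by split=> //; [rewrite /is_partition (path_sorted srt) | exact: order_path_min srt].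
Qed.

(** The Galois connection between a partition and its conjugate; all comparisons
    below reduce to it. *)
Lemma ltn_conj_part l i j : is_partition l -> 0 < i ->
  (j < conj_part l i) = (i <= nth 0 l j).
Proof.
move=> + i0; elim: l j => [|x l IHl] j; first by rewrite nth_nil leqn0 eqn0Ngt i0.
case/is_partition_cons => x0 pl al; rewrite /conj_part /=.
have [le_ix | lt_xi] := leqP i x; first by case: j => [|j] //=; rewrite add1n ltnS -IHl.
have /eqP -> : count (leq i) l == 0.
  rewrite -leqn0 leqNgt -has_count; apply/hasPn => y /(allP al) /=.
  by rewrite -ltnNge => le; exact: leq_ltn_trans le lt_xi.
case: j => [|j] /=; first by move: lt_xi; clia.
have [lt|ge] := ltnP j (size l); last by rewrite nth_default //; move: i0; clia.
by have /= := allP al _ (mem_nth 0 lt); move: lt_xi; clia.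
Qed.

Lemma conj_part1 l : is_partition l -> conj_part l 1 = size l.
Proof. by case/andP => _ al; apply/eqP; rewrite -all_count. Qed.

Lemma conj_part_inj l mu : is_partition l -> is_partition mu ->
  (forall i, conj_part l i.+1 = conj_part mu i.+1) -> l = mu.
Proof.
move=> pl pmu eqc; apply: (@eq_from_nth _ 0).
  by rewrite -!conj_part1.
move=> j _; apply/eqP; rewrite eqn_leq.
have H l1 l2 : is_partition l1 -> is_partition l2 ->
    (forall i, conj_part l1 i.+1 = conj_part l2 i.+1) -> nth 0 l1 j <= nth 0 l2 j.
  move=> p1 p2 e; case E : (nth 0 l1 j) => [|i] //.
  by rewrite -ltn_conj_part // -e ltn_conj_part // E.
by rewrite !H.
Qed.

Lemma part_subE l mu : is_partition l -> is_partition mu ->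
  part_sub mu l <-> (forall i, conj_part mu i.+1 <= conj_part l i.+1).
Proof.
move=> pl pmu; split=> [/allP sub i | le].
  rewrite leqNgt; apply/negP; rewrite ltn_conj_part // => lt.
  have : conj_part l i.+1 < size mu.
    by rewrite ltnNge; apply/negP => /(nth_default 0) e; rewrite e in lt.
  move=> ltj; have := sub (conj_part l i.+1); rewrite mem_iota /= => /(_ ltj) le.
  have := leq_trans lt le; rewrite -ltn_conj_part //.
  by rewrite ltnn.
apply/allP => j _; case E : (nth 0 mu j) => [|i] //.
rewrite -ltn_conj_part //; apply: leq_trans (le i).
by rewrite ltn_conj_part // E.
Qed.

Lemma conj_part_anti l i : conj_part l i.+1 <= conj_part l i.
Proof. by apply: sub_count => x /=; exact: ltnW. Qed.

Lemma conj_part_size l i : conj_part l i <= size l.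
Proof. exact: count_size. Qed.

Lemma conj_part_large l m i : all (geq m) l -> m < i -> conj_part l i = 0.
Proof.
move=> al lt; apply/eqP; rewrite -leqn0 leqNgt -has_count; apply/hasPn => x /(allP al) /= le.
by rewrite -ltnNge; exact: leq_ltn_trans le lt.
Qed.

Lemma sum_conj_part l m : all (geq m) l ->
  \sum_(i < m) conj_part l i.+1 = sumn l.
Proof.
elim: l => [|x l IHl] /=; first by rewrite big1.
case/andP => le_xm /IHl <-; rewrite big_split /=; congr (_ + _).
rewrite -(big_mkord xpredT (fun i => i < x : nat)) (@big_cat_nat _ _ _ x) //=.
rewrite (eq_big_nat _ _ (F2 := fun=> 1)) => [|i /andP[_ ->] //].
rewrite sum_nat_const_nat subn0 muln1 [X in _ + X]big1_seq ?addn0 // => i /=.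
by rewrite mem_index_iota => /andP[le _]; rewrite ltnNge le.
Qed.

Fixpoint boxes m d : seq (seq nat) :=
  if d is d'.+1 then [::] :: [seq x :: l | x <- iota 1 m, l <- boxes m d'] else [:: [::]].

Lemma mem_boxes m d l : (l \in boxes m d) = (size l <= d) && all (fun x => 0 < x <= m) l.
Proof.
elim: d l => [|d IHd] [|x l] //=; rewrite inE /=.
apply/allpairsP/and3P => [[[y l'] /= [y1 l'1 [-> ->]]] | [h1 h2 h3]].
  by move: l'1 y1; rewrite IHd mem_iota add1n ltnS => /andP[h1 h2] h3; split.
by exists (x, l); split=> //=; [rewrite mem_iota add1n ltnS | rewrite IHd h3 andbT].
Qed.

Definition parts m d := undup (filter is_partition (boxes m d)).

Lemma mem_parts m d l :
  (l \in parts m d) = [&& is_partition l, size l <= d & all (geq m) l].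
Proof.
rewrite mem_undup mem_filter mem_boxes; case: (boolP (is_partition l)) => //= /andP[_ al].
congr (_ && _); apply: eq_in_all => x /(allP al) /= ->; by [].
Qed.

(** The partition with conjugate f. *)
Definition part_of m (f : nat -> nat) :=
  [seq count (fun i => j < f i) (iota 0 m) | j <- iota 0 (f 0)].

Lemma anti_le (f : nat -> nat) : (forall i, f i.+1 <= f i) ->
  forall i j, i <= j -> f j <= f i.
Proof.
move=> f_anti i j /subnKC <-; elim: (j - i) => [|e IHe]; first by rewrite addn0.
by rewrite addnS; apply: leq_trans IHe.
Qed.

Lemma conj_part_of m (f : nat -> nat) : (forall i, f i.+1 <= f i) -> f m = 0 ->
  forall i, conj_part (part_of m f) i.+1 = f i.
Proof.
move=> f_anti fm i; rewrite /conj_part /part_of count_map.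
have fle := anti_le f_anti.
have cnt j : (i < count (fun i' => j < f i') (iota 0 m)) = (j < f i).
  have [lt|ge] := ltnP j (f i).
    have lt_im : i < m.
      by rewrite ltnNge; apply/negP => /fle; rewrite fm; move: lt; clia.
    rewrite -(subnKC lt_im) iotaD count_cat.
    apply: leq_trans (leq_addr _ _).
    rewrite (_ : count _ _ = i.+1) //.
    rewrite -[RHS](size_iota 0) ; apply/eqP; rewrite -all_count; apply/allP => i'.
    rewrite mem_iota /= add0n ltnS => /fle; move: lt; clia.
  apply/negbTE; rewrite -leqNgt.
  have [le_im|lt_mi] := leqP i m; last first.
    by apply: leq_trans (count_size _ _) _; rewrite size_iota ltnW.
  rewrite -(subnKC le_im) iotaD count_cat add0n.
  rewrite [X in _ + X](_ : _ = 0) ?addn0.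
    by apply: leq_trans (count_size _ _) _; rewrite size_iota.
  apply/eqP; rewrite -leqn0 leqNgt -has_count; apply/hasPn => i'.
  by rewrite mem_iota => /andP[/fle le _]; rewrite -leqNgt; exact: leq_trans le ge.
rewrite (eq_count (a2 := fun j => j < f i)) => [|j]; last exact: cnt.
have le0 : f i <= f 0 by exact: fle.
rewrite -(subnKC le0) iotaD count_cat [X in _ + X](_ : _ = 0).
  rewrite addn0 -[RHS](size_iota 0); apply/eqP; rewrite -all_count; apply/allP => j.
  by rewrite mem_iota.
apply/eqP; rewrite -leqn0 leqNgt -has_count; apply/hasPn => j.
by rewrite mem_iota add0n => /andP[le _]; rewrite -leqNgt.
Qed.

Lemma part_of_parts m d (f : nat -> nat) : (forall i, f i.+1 <= f i) -> f m = 0 ->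
  f 0 <= d -> 0 < m -> part_of m f \in parts m d.
Proof.
move=> f_anti fm f0 m0; rewrite mem_parts /is_partition; apply/and3P; split.
- apply/andP; split.
    have mono j j' : j <= j' ->
       geq (count (fun i => j < f i) (iota 0 m)) (count (fun i => j' < f i) (iota 0 m)).
      by move=> le; apply: sub_count => i /=; exact: leq_ltn_trans.
    apply: (@homo_sorted _ _ _ leq); last exact: iota_sorted.
    by move=> j j'; exact: mono.
  apply/allP => x /mapP[j]; rewrite mem_iota /= add0n => lt ->.
  by rewrite -has_count; apply/hasP; exists 0; rewrite ?mem_iota.
- by rewrite size_map size_iota.
apply/allP => x /mapP[j _ ->]; rewrite /=; apply: leq_trans (count_size _ _) _.
by rewrite size_iota.
Qed.

Lemma parts_code m d : 0 < m -> forall f : nat -> nat,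
  (forall i, f i.+1 <= f i <= d) ->
  exists2 l, l \in parts m d & forall l', l' \in parts m d ->
     [forall i : 'I_m, f i == conj_part l' i.+1] = (l' == l).
Proof.
move=> m0 f f_le; pose g i := if i < m then f i else 0.
have g_anti i : g i.+1 <= g i.
  rewrite /g; case: ifP => // lt; rewrite (ltnW lt); by have /andP[] := f_le i.
have gm : g m = 0 by rewrite /g ltnn.
have g0 : g 0 <= d by rewrite /g m0; have /andP[] := f_le 0.
exists (part_of m g); first exact: part_of_parts.
move=> l'; rewrite mem_parts => /and3P[pl' _ al'].
have := part_of_parts g_anti gm g0 m0; rewrite mem_parts => /and3P[pg _ _].
apply/forallP/eqP => [/= eqf | -> i]; last first.
  by rewrite conj_part_of // /g ltn_ord.
apply: conj_part_inj => // i; rewrite conj_part_of // /g; case: ltnP => lt.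
  by apply/esym/eqP/(eqf (Ordinal lt)).
exact: conj_part_large al' _.
Qed.

Lemma part_sub_rect l m d : is_partition l ->
  part_sub l (nseq d m) = (size l <= d) && all (geq m) l.
Proof.
move=> /andP[_ al]; apply/allP/andP => [sub | [le_d lm] i].
  have nthl j : j < size l -> nth 0 l j <= (if j < d then m else 0).
    by move=> lt; have := sub j; rewrite mem_iota nth_nseq; exact.
  split.
    rewrite leqNgt; apply/negP => lt; have := nthl d lt; rewrite ltnn leqn0 => /eqP e.
    by have := allP al _ (mem_nth 0 lt); rewrite e.
  apply/allP => x /(nthP 0)[j lt <-]; apply: leq_trans (nthl j lt) _.
  by case: ifP.
rewrite mem_iota /= add0n => lt; rewrite nth_nseq (leq_trans lt le_d).
exact: (allP lm _ (mem_nth 0 lt)).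
Qed.
End Partitions.

Section HallNumbers.
Variable k : finFieldType.
Local Notation q := #|k|.
Local Notation qq n := (qpoch (q%:R^-1 : rat) q%:R^-1 n).

Lemma qqS n : qq n.+1 = qq n * (1 - q%:R^-1 ^+ n.+1).
Proof. by rewrite -qq_ratioS mulrC divfK // qq_neq0. Qed.

Lemma gauss_bin_diag b n : gauss_bin b n n = 1%N.
Proof. by elim: n => //= n IHn; rewrite gauss_bin_small // subnn mul1n IHn. Qed.

Lemma gauss_binS b n j :
  gauss_bin b n.+1 j.+1 = (gauss_bin b n j.+1 + b ^ (n - j) * gauss_bin b n j)%N.
Proof. by []. Qed.

(** The q-factorial formula, cleared of denominators for the induction. *)
Lemma gauss_bin_qq j p :
  (gauss_bin q (j + p) j)%:R * (qq j * qq p) = q%:R ^+ (j * p) * qq (j + p) :> rat.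
Proof.
have qq0 : qq 0 = 1 by rewrite /qpoch big_ord0.
elim: j p => [|j IHj] p; first by rewrite gauss_bin0 qq0 !mul1r.
elim: p => [|p IHp]; first by rewrite addn0 gauss_bin_diag qq0 muln0 mulr1 !mul1r.
rewrite addnS gauss_binS natrD natrM natrX.
have IHp1 := IHj p.+1; rewrite addnS -addSn in IHp1.
have -> : (j.+1 + p - j = p.+1)%N by rewrite addSnnS addKn.
rewrite mulrDl [in X in X + _](qqS p) [in X in _ + X](qqS j) (qqS (j.+1 + p)).
set u := q%:R^-1 ^+ j.+1; set w := q%:R^-1 ^+ p.+1; set n := (j.+1 + p)%N.
have -> : (q%:R^-1 : rat) ^+ n.+1 = u * w by rewrite /u /w -exprD addnS.
transitivity ((gauss_bin q n j.+1)%:R * (qq j.+1 * qq p) * (1 - w) +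
   q%:R ^+ p.+1 * ((gauss_bin q n j)%:R * (qq j * qq p.+1)) * (1 - u)); first by ring.
rewrite IHp IHp1.
have -> : q%:R ^+ p.+1 * (q%:R ^+ (j * p.+1) * qq n) = q%:R ^+ (j.+1 * p.+1) * qq n.
  by rewrite mulrA -exprD -mulSn.
have -> : (q%:R : rat) ^+ (j.+1 * p) = q%:R ^+ (j.+1 * p.+1) * u.
  rewrite mulnS exprD /u exprVn mulrC mulrA mulVf ?mul1r //.
  by rewrite expf_neq0 // q_neq0.
by ring.
Qed.

Lemma gauss_qbinom n j : (j <= n)%N ->
  (gauss_bin q n j)%:R = q%:R ^+ (j * (n - j)) * qbinom (q%:R^-1) n (n - j) :> rat.
Proof.
move=> le_jn; have nE := subnKC le_jn; have := gauss_bin_qq j (n - j); rewrite nE => H.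
have q0 : qq j * qq (n - j) != 0 by rewrite mulf_neq0 ?qq_neq0.
rewrite -[LHS](mulfK q0) H /qbinom subKn //.
by rewrite [qq (n - j) * _]mulrC mulrA.
Qed.

(** Passing from q to 1/q in the Gaussian binomials of [hall_count] multiplies by a
    power of q that completes the exponents. *)
Lemma hall_countE m (a b : nat -> nat) :
  (forall i, b i.+1 <= b i)%N -> (forall i, b i <= a i)%N ->
  (hall_count q m a b)%:R = q%:R ^+ (\sum_(i < m) b i * (a i - b i))%N *
    \prod_(i < m) qbinom (q%:R^-1) (a i - b i.+1) (a i - b i) :> rat.
Proof.
move=> b_anti b_le; rewrite natr_prod -prodrXr -big_split; apply: eq_bigr => i _ /=.
have := b_anti i; have := b_le i => le1 le2.
rewrite natrM natrX gauss_qbinom ?leq_sub2r // mulrA -exprD.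
have -> : (a i - b i.+1 - (b i - b i.+1) = a i - b i)%N by move: le1 le2; clia.
by rewrite -mulnDl subnKC.
Qed.

Lemma skew_hallE m l mu : is_partition l -> is_partition mu -> all (geq m) l ->
    (forall i, conj_part mu i.+1 <= conj_part l i.+1)%N ->
  skew_hall q%:R l mu =
  (hall_count q m (fun i => conj_part l i.+1) (fun i => conj_part mu i.+1))%:R.
Proof.
move=> pl pmu al le; rewrite hall_countE //; last by move=> i; exact: conj_part_anti.
rewrite /skew_hall (iffRL (part_subE pl pmu)) //.
have hm : (head 0 l <= m)%N by case: l al {pl le} => //= x l /andP[].
have l0 i : (head 0 l < i)%N -> conj_part l i = 0%N.
  apply: conj_part_large; case: (l) pl => //= x l' /is_partition_cons[_ _ ->].
  by rewrite leqnn.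
have mu0 i : (head 0 l < i)%N -> conj_part mu i = 0%N.
  by case: i => // i lt; have := le i; rewrite l0 // leqn0 => /eqP.
rewrite !big_add1 /=.
have bigE (R : Type) (idx : R) (op : Monoid.law idx) (F : nat -> R) :
    (forall i, (head 0 l <= i)%N -> F i = idx) ->
    \big[op/idx]_(0 <= i < head 0 l) F i = \big[op/idx]_(i < m) F i.
  move=> F0; rewrite -(big_mkord xpredT) [RHS](@big_cat_nat _ _ _ (head 0 l)) //=.
  rewrite [X in op _ X]big1_seq ?Monoid.mulm1 // => i /=.
  by rewrite mem_index_iota => /andP[h _]; exact: F0.
congr (_ ^+ _ * _); apply: bigE => i le_i; first by rewrite mu0.
by rewrite l0 // !mu0 // ?ltnS ?leqW // /qbinom !subnn /qpoch !big_ord0.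
Qed.

Lemma prod_telescope (F : fieldType) n (f : nat -> F) : (forall i, f i != 0) ->
  \prod_(i < n) (f i / f i.+1) = f 0%N / f n.
Proof.
move=> f0; elim: n => [|n IHn]; first by rewrite big_ord0 divff.
by rewrite big_ord_recr IHn /= mulrA divfK.
Qed.

(** Complementing l in the box m x d does not change the Hall number: both sides
    equal, up to the same power of q, the q-multinomial of d whose entries
    are the differences in the sequence d, l'_1, ..., l'_m, 0. *)
Lemma skew_hall_rect m d l : (0 < m)%N -> is_partition l -> (size l <= d)%N ->
    all (geq m) l ->
  skew_hall q%:R (nseq d m) l =
  (hall_count q m (fun=> d) (fun i => if (i < m)%N then d - conj_part l (m - i)
                                       else 0)%N)%:R.
Proof.
move=> m0 pl le_ld al.
have pnd : is_partition (nseq d m).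
  apply/andP; split; last by rewrite all_nseq m0 orbT.
  by elim: (d) => [|[|d'] IHd] //=; rewrite leqnn.
have cn i : (i < m)%N -> conj_part (nseq d m) i.+1 = d.
  by move=> lt; rewrite /conj_part count_nseq lt mul1n.
have cd i : (conj_part l i <= d)%N by apply: leq_trans (conj_part_size _ _) le_ld.
have al_n : all (geq m) (nseq d m) by rewrite all_nseq /= leqnn orbT.
have cm : conj_part l m.+1 = 0%N by apply: conj_part_large al _.
rewrite (skew_hallE pnd pl al_n); last first.
  move=> i; have [lt|ge] := ltnP i m; first by rewrite cn.
  by rewrite (conj_part_large al) // ltnS.
pose a i := conj_part l i.+1.
rewrite (_ : hall_count _ _ _ _ = hall_count q m (fun=> d) a); last first.
  by apply: eq_bigr => i _; rewrite cn.
have a_anti i : (a i.+1 <= a i)%N by exact: conj_part_anti.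
have ad i : (a i <= d)%N := cd i.+1.
case: m m0 al {pnd cn al_n} cm => // M _ al cm.
pose c i := if (i < M.+1)%N then (d - conj_part l (M.+1 - i))%N else 0%N.
rewrite -/c.
have cE i : (i <= M)%N -> c i = (d - a (M - i))%N by move=> le; rewrite /c ltnS le subSn.
have c_anti i : (c i.+1 <= c i)%N.
  rewrite /c; case: ifP => // lt; rewrite (ltnW lt) leq_sub2l // -(subnSK (ltnW lt)).
  exact: conj_part_anti.
have cd' i : (c i <= d)%N by rewrite /c; case: ifP => // _; exact: leq_subr.
rewrite !hall_countE // /qbinom.
congr (_ ^+ _ * _).
  rewrite [RHS](reindex_inj rev_ord_inj) /=; apply: eq_bigr => i _.
  have le_i : (i <= M)%N by rewrite -ltnS.
  by rewrite subSS cE ?leq_subr // subKn // subKn ?ad // mulnC.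
(* B is the conjugate of l with the value d put in front *)
pose B i := if i is i'.+1 then a i' else d.
have B_anti i : (B i.+1 <= B i)%N by case: i => [|i] //=; exact: a_anti.
have qn0 n : qq n != 0 by exact: qq_neq0.
transitivity (\prod_(i < M.+1) (qq (d - a i.+1) / qq (d - a i)) /
              \prod_(i < M.+1) qq (a i - a i.+1)).
  rewrite -prodf_div; apply: eq_bigr => i _.
  have -> : (d - a i.+1 - (d - a i) = a i - a i.+1)%N.
    by move: (a_anti i) (cd i.+1); rewrite /a; clia.
  by rewrite invfM mulrA.
rewrite -[\prod_(i < _) (_ / _)]invrK -prodfV.
under eq_bigr => i _ do rewrite invf_div.
rewrite (prod_telescope _ (f := fun i => qq (d - a i))) // invf_div.
have aM : a M.+1 = 0%N := cm.
rewrite [X in _ / X]big_ord_recr /= aM !subn0.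
transitivity (\prod_(i < M.+1) (qq (B i) / qq (B i.+1)) /
              \prod_(i < M.+1) qq (B i - B i.+1)).
  rewrite (prod_telescope _ (f := fun i => qq (B i))) //=.
  rewrite [X in _ = _ / X]big_ord_recl /=.
  rewrite !invfM; ring.
rewrite -prodf_div [RHS](reindex_inj rev_ord_inj) /=; apply: eq_bigr => i _.
have le_i : (i <= M)%N by rewrite -ltnS.
rewrite subSS (cE (M - i)%N) ?leq_subr // [(M - (M - i))%N]subKn //.
have -> : (d - c (M - i).+1 = B i)%N.
  case: i le_i => [[|i] lt] /= le_i; first by rewrite subn0 /c ltnn subn0.
  rewrite cE; last by move: le_i; clia.
  by rewrite subKn ?ad //; congr a; move: le_i; clia.
rewrite subKn ?ad // invfM mulrA.
by congr (_ / _ / qq _).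
Qed.
End HallNumbers.

(** * The ring R as pairs of power series *)
Section PowerSeries.
Variable k : fieldType.
Local Notation V := (fps k).
Local Notation X := (fpsX k).
Implicit Types (f g h : V).

Lemma fpsXn_inj n : injective (fun f => X ^+ n * f).
Proof.
move=> f g /= eqfg; apply: fpsP => i.
have := congr1 (fun h => fcoef h (n + i)) eqfg.
by rewrite !fcoefXnM leq_addr addKn.
Qed.

Lemma fpsXn_div n f : (forall i, (i < n)%N -> fcoef f i = 0) ->
  exists g, f = X ^+ n * g.
Proof.
move=> f0; exists (Fps (fun i => fcoef f (n + i))); apply: fpsP => i.
by rewrite fcoefXnM; case: leqP => [le|lt]; [rewrite /= subnKC | exact: f0].
Qed.

Lemma fps_val f : f != 0 -> exists v u, f = X ^+ v * u /\ fcoef u 0 != 0.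
Proof.
move=> f0; have exn : exists n, fcoef f n != 0.
  apply: contrapT => /forallNP all0; case/eqP: f0; apply: fpsP => n.
  by rewrite fcoef0; apply/eqP/negbNE/negP/all0.
case: (ex_minnP exn) => v fv minv.
have [|u fE] := @fpsXn_div v f.
  by move=> i lt; apply/eqP; apply: contraTT lt => /minv; rewrite -leqNgt.
exists v, u; split=> //; move: fv; rewrite fE fcoefXnM leqnn subnn.
exact.
Qed.

Lemma fcoef0_exp f n : fcoef (f ^+ n) 0 = fcoef f 0 ^+ n.
Proof. by elim: n => [|n IHn] //; rewrite !exprS fcoef0_mul IHn. Qed.

(** If the valuation of b were smaller than that of a, the equation divided by
    X^(n v(b)) would make a unit divisible by X. *)
Lemma fps_int_closed (a b : V) n (c : nat -> V) : a != 0 ->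
  b ^+ n = \sum_(i < n) c i * b ^+ i * a ^+ (n - i) -> exists z, b = a * z.
Proof.
move=> a0 eqb; have [->|b0] := eqVneq b 0; first by exists 0; rewrite mulr0.
have [v [u [aE u0]]] := fps_val a0; have [w [u' [bE u'0]]] := fps_val b0.
have Uu : u \is a GRing.unit by rewrite unfold_in /= /fps_unit unitfE.
have [le_vw | lt_wv] := leqP v w.
  exists (X ^+ (w - v) * u^-1 * u'); rewrite aE bE -(subnKC le_vw) exprD addKn.
  by rewrite -!mulrA; congr (_ * _); rewrite mulrCA; congr (_ * _); rewrite mulVKr.
exfalso; move/eqP: (u'0); apply.
have : u' ^+ n = X * (\sum_(i < n) c i * u' ^+ i * u ^+ (n - i) * X ^+ ((v - w) * (n - i) - 1)).
  apply: (@fpsXn_inj (w * n)); rewrite /= exprM -exprMn -bE eqb mulr_sumr mulr_sumr.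
  apply: eq_bigr => i _; have lt := ltn_ord i.
  rewrite aE bE !exprMn -!exprM.
  have -> : (v * (n - i) = (w * (n - i)) + (((v - w) * (n - i) - 1).+1))%N by nia.
  have -> : (w * n = w * i + w * (n - i))%N by nia.
  by rewrite !exprD exprS; ring.
move/(congr1 (fun f => fcoef f 0)); rewrite fcoef0_exp fcoef0_mul mul0r => /eqP.
by rewrite expf_eq0 => /andP[_ /eqP].
Qed.
End PowerSeries.

Section R22Embedding.
Variables (k : fieldType) (m : nat).
Hypothesis m_gt0 : (0 < m)%N.
Local Notation V := (fps k).
Local Notation X := (fpsX k).
Local Notation Y := (varY k).
Local Notation XX := (varX k).
Implicit Types (f h : fps2 k) (g : V).

Lemma varXn n : XX ^+ n = fpsC (X ^+ n).
Proof. by elim: n => [|n IHn] //; rewrite !exprS IHn -fpsCM. Qed.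

(** The value at Y = X^m of f divided by Y^j, terms of degree < j dropped. *)
Definition tail_eval f j : V :=
  Fps (fun n => \sum_(i < n.+1) fcoef (X ^+ (m * i) * fcoef f (j + i)) n).

Lemma tail_eval_rec f j : tail_eval f j = fcoef f j + X ^+ m * tail_eval f j.+1.
Proof.
have widen n N g (F : nat -> V) : (n < N)%N ->
    \sum_(i < N) fcoef (X ^+ (m * i) * F i) n =
    \sum_(i < n.+1) fcoef (X ^+ (m * i) * F i) n.
  move=> lt; rewrite [RHS](big_ord_widen N (fun i => fcoef (X ^+ (m * i) * F i) n)) //.
  rewrite [RHS]big_mkcond; apply: eq_bigr => i _; case: ltnP => // lt_ni.
  by rewrite fcoefXnM leqNgt (_ : (n < m * i)%N) //; nia.
have tE j' n : fcoef (tail_eval f j') n =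
  \sum_(i < n.+1) fcoef (X ^+ (m * i) * fcoef f (j' + i)) n by [].
apply: fpsP => n; rewrite fcoefD fcoefXnM !tE.
rewrite big_ord_recl muln0 expr0 mul1r addn0; congr (_ + _).
case: leqP => [le_mn | lt_nm]; last first.
  apply: big1 => i _; rewrite fcoefXnM leqNgt (_ : (n < m * _)%N) //.
  by rewrite lift0; nia.
rewrite -(widen (n - m)%N n 0 (fun i => fcoef f (j.+1 + i))); last by move: m_gt0 le_mn; clia.
apply: eq_bigr => i _; rewrite lift0 addnS addSn mulnS exprD -mulrA.
by rewrite fcoefXnM le_mn.
Qed.

Definition ev2 f : V := tail_eval f 0.

(** Division by Y - X^m; the remainder is unique ([ev2_uniq]), which makes the
    evaluation at Y = X^m a ring morphism without computing any product. *)
Lemma ev2P f : exists h, f = fpsC (ev2 f) + (Y - XX ^+ m) * h.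
Proof.
exists (Fps (fun j => tail_eval f j.+1)); apply: fpsP => n.
rewrite mulrBl varXn fcoefD fcoefB fcoefXM fcoefCM /=.
case: n => [|n] /=; first by rewrite /ev2 tail_eval_rec sub0r addrK.
by rewrite add0r (tail_eval_rec f n.+1) addrK.
Qed.

Lemma ev2_uniq g h : fpsC g = (Y - XX ^+ m) * h -> g = 0.
Proof.
move=> eqg; have rec n : fcoef h n = X ^+ m * fcoef h n.+1.
  have := congr1 (fun f => fcoef f n.+1) eqg.
  rewrite mulrBl varXn fcoefB fcoefXM fcoefCM /= => /esym/eqP.
  by rewrite subr_eq0 => /eqP.
have h0 n : fcoef h 0 = X ^+ (m * n) * fcoef h n.
  elim: n => [|n IHn]; first by rewrite muln0 mul1r.
  by rewrite IHn rec mulnS addnC exprD mulrA.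
have hz : fcoef h 0 = 0.
  apply: fpsP => n; rewrite (h0 n.+1) fcoefXnM fcoef0 leqNgt (_ : (n < m * n.+1)%N) //.
  by nia.
have := congr1 (fun f => fcoef f 0) eqg.
by rewrite mulrBl varXn fcoefB fcoefXM fcoefCM /= hz mulr0 subr0.
Qed.

Lemma ev2_eq f g h : f = fpsC g + (Y - XX ^+ m) * h -> ev2 f = g.
Proof.
move=> fE; have [h' fE'] := ev2P f; apply/eqP; rewrite -subr_eq0; apply/eqP.
apply: (@ev2_uniq _ (h - h')); rewrite mulrBr.
have -> : fpsC (ev2 f - g) = fpsC (ev2 f) - fpsC g.
  by apply: fpsP => n; rewrite fcoefB /=; case: eqP; rewrite ?subr0.
by rewrite -[fpsC (ev2 f)](addrK ((Y - XX ^+ m) * h')) -fE' {1}fE; ring.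
Qed.

Lemma ev2D f1 f2 : ev2 (f1 + f2) = ev2 f1 + ev2 f2.
Proof.
have [h1 e1] := ev2P f1; have [h2 e2] := ev2P f2.
by apply: (@ev2_eq _ _ (h1 + h2)); rewrite {1}e1 {1}e2 fpsCD; ring.
Qed.

Lemma ev2M f1 f2 : ev2 (f1 * f2) = ev2 f1 * ev2 f2.
Proof.
have [h1 e1] := ev2P f1; have [h2 e2] := ev2P f2.
apply: (@ev2_eq _ _ (h1 * f2 + fpsC (ev2 f1) * h2)).
by rewrite {1}e1 mulrDl {1}e2 fpsCM; ring.
Qed.

Lemma ev2C g : ev2 (fpsC g) = g.
Proof. by apply: (@ev2_eq _ _ 0); rewrite mulr0 addr0. Qed.

Lemma ev2Y : ev2 Y = X ^+ m.
Proof. by apply: (@ev2_eq _ _ 1); rewrite -varXn mulr1 addrC subrK. Qed.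

Lemma ev2_Rrel : ev2 (Rrel k m) = 0.
Proof.
by apply: (@ev2_eq _ _ Y); rewrite /Rrel mulrC (_ : fpsC 0 = 0) ?add0r.
Qed.

(** Divide by Y, then by Y - X^m. *)
Lemma Rideal_ev f : (f \in @Rideal k m) = (fcoef f 0 == 0) && (ev2 f == 0).
Proof.
apply/RidealP/andP => [[g ->] | [/eqP f0 /eqP f2]].
  by rewrite ev2M ev2_Rrel mulr0 fcoef0_mul /Rrel fcoef0_mul mul0r mulr0.
have [g fE] : exists g : fps2 k, f = Y * g.
  exists (Fps (fun i => fcoef f i.+1)); apply: fpsP => n.
  by rewrite fcoefXM; case: n.
have [h gE] := ev2P g.
have g0 : ev2 g = 0.
  apply: (@fpsXn_inj _ m); rewrite /= mulr0 -ev2Y -ev2M -fE; exact: f2.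
exists h; rewrite fE gE g0 (_ : fpsC 0 = 0) // add0r /Rrel; ring.
Qed.

Local Notation A := (R22 k m).
Local Open Scope quotient_scope.
Local Notation Aq := {ideal_quot (@Rideal k m)}.

Definition pi22 f : A := \pi_Aq f.
Definition repr22 (x : A) : fps2 k := generic_quotient.repr (x : Aq).

Lemma repr22K x : pi22 (repr22 x) = x.
Proof. exact: generic_quotient.reprK. Qed.

Lemma pi22D f1 f2 : pi22 (f1 + f2) = pi22 f1 + pi22 f2.
Proof. exact: (rmorphD (\pi_Aq)). Qed.

Lemma pi22M f1 f2 : pi22 (f1 * f2) = pi22 f1 * pi22 f2.
Proof. exact: (rmorphM (\pi_Aq)). Qed.

Lemma pi22_1 : pi22 1 = 1.
Proof. exact: (rmorph1 (\pi_Aq)). Qed.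

Lemma ev2B f1 f2 : ev2 (f1 - f2) = ev2 f1 - ev2 f2.
Proof. by apply/eqP; rewrite eq_sym subr_eq -ev2D subrK. Qed.

Lemma pi22_eq f1 f2 : pi22 f1 = pi22 f2 <-> (fcoef f1 0 = fcoef f2 0 /\ ev2 f1 = ev2 f2).
Proof.
have H : (f1 - f2 \in @Rideal k m) = (pi22 f1 == pi22 f2).
  exact: ring_quotient.Quotient.idealrBE.
split=> [/eqP | [e1 e2]]; last first.
  by apply/eqP; rewrite -H Rideal_ev fcoefB e1 subrr ev2B e2 subrr !eqxx.
by rewrite -H Rideal_ev fcoefB ev2B !subr_eq0 => /andP[/eqP -> /eqP ->].
Qed.

(** The restrictions to the two branches Y = 0 and Y = X^m. *)
Definition branches (x : A) : V * V := (fcoef (repr22 x) 0, ev2 (repr22 x)).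

Lemma branches_pi f : branches (pi22 f) = (fcoef f 0, ev2 f).
Proof.
by have /pi22_eq[e1 e2] := repr22K (pi22 f); rewrite /branches e1 e2.
Qed.

Lemma branchesD x y : branches (x + y) = branches x + branches y.
Proof.
rewrite -(repr22K x) -(repr22K y) -pi22D !branches_pi ev2D.
by congr (_, _).
Qed.

Lemma branchesM x y : branches (x * y) = branches x * branches y.
Proof.
rewrite -(repr22K x) -(repr22K y) -pi22M !branches_pi ev2M fcoef0_mul.
by congr (_, _).
Qed.

Lemma branches1 : branches 1 = 1.
Proof. by rewrite -pi22_1 branches_pi (ev2C 1). Qed.

Lemma branches_inj : injective branches.
Proof.
move=> x y e; rewrite -(repr22K x) -(repr22K y); apply/pi22_eq.
by split; [exact: (congr1 fst e) | exact: (congr1 snd e)].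
Qed.

Lemma branches_lift a c : exists x, branches x = (a, a + X ^+ m * c).
Proof.
exists (pi22 (fpsC a + Y * fpsC c)).
by rewrite branches_pi ev2D ev2M ev2Y !ev2C fcoefD fcoef0_mul mul0r addr0.
Qed.

Lemma branches_cong x : exists c, (branches x).2 = (branches x).1 + X ^+ m * c.
Proof.
rewrite -(repr22K x) branches_pi /=; set f := repr22 x.
exists (tail_eval f 1); exact: tail_eval_rec.
Qed.
End R22Embedding.

(** * The normalization of R *)
(** A is the ring of the pairs of power series congruent modulo X^m: the curve R
    for m > 0, and V x V for m = 0. *)
Record branch_ring (k : fieldType) (m : nat) (A : comNzRingType)
    (phi : A -> fps k * fps k) : Prop := BranchRing {
  brD : {morph phi : x y / x + y};
  brM : {morph phi : x y / x * y};
  br1 : phi 1 = 1;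
  br_inj : injective phi;
  br_lift : forall a c, exists x, phi x = (a, a + fpsX k ^+ m * c);
  br_cong : forall x, exists c, (phi x).2 = (phi x).1 + fpsX k ^+ m * c }.

Lemma R22_branch_ring (k : fieldType) m : (0 < m)%N -> branch_ring m (@branches k m).
Proof.
move=> m_gt0; split.
- exact: branchesD.
- exact: branchesM.
- exact: branches1.
- exact: branches_inj.
- exact: branches_lift.
- exact: branches_cong.
Qed.

Section BranchRing.
Variables (k : fieldType) (m : nat) (A : comNzRingType) (phi : A -> fps k * fps k).
Hypothesis phiP : branch_ring m phi.
Local Notation V := (fps k).
Local Notation X := (fpsX k).

Lemma br0 : phi 0 = 0.
Proof. by apply: (addrI (phi 0)); rewrite -(brD phiP) !addr0. Qed.

Lemma brN x : phi (- x) = - phi x.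
Proof. by apply: (addrI (phi x)); rewrite -(brD phiP) !subrr br0. Qed.

Lemma brB x y : phi (x - y) = phi x - phi y.
Proof. by rewrite (brD phiP) brN. Qed.

Lemma brX x n : phi (x ^+ n) = phi x ^+ n.
Proof. by elim: n => [|n IHn]; rewrite ?(br1 phiP) // !exprS (brM phiP) IHn. Qed.

Lemma br_sum (I : Type) (r : seq I) (F : I -> A) :
  phi (\sum_(i <- r) F i) = \sum_(i <- r) phi (F i).
Proof. exact: (big_morph phi (brD phiP) br0). Qed.

Lemma fst_sum (I : Type) (r : seq I) (F : I -> V * V) :
  (\sum_(i <- r) F i).1 = \sum_(i <- r) (F i).1.
Proof. exact: (big_morph fst (fun _ _ => erefl) erefl). Qed.

Lemma snd_sum (I : Type) (r : seq I) (F : I -> V * V) :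
  (\sum_(i <- r) F i).2 = \sum_(i <- r) (F i).2.
Proof. exact: (big_morph snd (fun _ _ => erefl) erefl). Qed.

Lemma pair_exp (z : V * V) n : z ^+ n = (z.1 ^+ n, z.2 ^+ n).
Proof. by elim: n => [|n IHn] //; rewrite !exprS IHn. Qed.

Lemma br_lift_scaled (z : V * V) : exists x, phi x = (X ^+ m * z.1, X ^+ m * z.2).
Proof.
have [x xE] := br_lift phiP (X ^+ m * z.1) (z.2 - z.1).
by exists x; rewrite xE mulrBr addrC subrK.
Qed.

(** A zero component is annihilated by X^m times an idempotent. *)
Lemma br_regular x : GRing.lreg x -> (phi x).1 != 0 /\ (phi x).2 != 0.
Proof.
move=> rx; have X0 : X ^+ m * 1 != 0 :> V.
  apply/eqP => e; have := @fpsXn_inj k m 1 0; rewrite /= mulr0 => /(_ e)/eqP.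
  by rewrite oner_eq0.
split; apply/eqP => x0.
  have [y yE] := br_lift_scaled (1, 0).
  suff y0 : y = 0 by case/eqP: X0; have := congr1 fst yE; rewrite y0 br0; exact: esym.
  apply: rx; apply: (br_inj phiP); rewrite mulr0 br0 (brM phiP) yE.
  by congr (_, _); rewrite /= ?x0 ?mul0r // mulr0 mulr0.
have [y yE] := br_lift_scaled (0, 1).
suff y0 : y = 0 by case/eqP: X0; have := congr1 snd yE; rewrite y0 br0; exact: esym.
apply: rx; apply: (br_inj phiP); rewrite mulr0 br0 (brM phiP) yE.
by congr (_, _); rewrite /= ?x0 ?mul0r // mulr0 mulr0.
Qed.

Lemma regular_br x : (forall f, (phi x).1 * f = 0 -> f = 0) ->
  (forall f, (phi x).2 * f = 0 -> f = 0) -> GRing.lreg x.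
Proof.
move=> r1 r2 y z eq; apply/eqP; rewrite -subr_eq0; apply/eqP.
have e0 : x * (y - z) = 0 by rewrite mulrBr eq subrr.
have /(congr1 phi) := e0; rewrite (brM phiP) br0 => e.
apply: (br_inj phiP); rewrite br0 [LHS]surjective_pairing.
by rewrite (r1 _ (congr1 fst e)) (r2 _ (congr1 snd e)).
Qed.

(** [theta] embeds V x V in the fractions of A, dividing by X^m. Its values are
    integral, as z is a root of (T - z.1) (T - z.2), and it reaches all integral
    elements since both components live in the integrally closed ring V. *)
Lemma normalization_branch_ring (Rt : comNzRingType) : is_normalization A Rt ->
  exists psi : Rt -> V * V, branch_ring 0 psi.
Proof.
case=> Q [j [e [[j_inj j_unit j_frac] e_inj e_im]]].
have Xm_inj (f g : V) : X ^+ m * f = X ^+ m * g -> f = g by exact: (@fpsXn_inj k m).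
have [xi xiE] := br_lift_scaled (1, 1).
have xi_reg : GRing.lreg xi.
  by apply: regular_br => f; rewrite xiE /= mulr1 => h; apply: Xm_inj; rewrite mulr0.
have Uxi := j_unit _ xi_reg.
pose iota z := sval (cid (br_lift_scaled z)).
have iotaE z : phi (iota z) = (X ^+ m * z.1, X ^+ m * z.2) := svalP (cid (br_lift_scaled z)).
have iota_eq z x : phi x = (X ^+ m * z.1, X ^+ m * z.2) -> iota z = x.
  by move=> xE; apply: (br_inj phiP); rewrite iotaE.
pose theta z := j (iota z) / j xi.
have thetaM z w : theta (z * w) = theta z * theta w.
  have izw : iota z * iota w = iota (z * w) * xi.
    apply: (br_inj phiP); rewrite !(brM phiP) !iotaE xiE.
    by congr (_, _); rewrite /=; ring.
  by rewrite /theta mulrACA -rmorphM izw rmorphM mulrA mulrK.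
have thetaD z w : theta (z + w) = theta z + theta w.
  rewrite /theta -mulrDl -rmorphD; congr (j _ / _); apply: iota_eq.
  by rewrite (brD phiP) !iotaE; congr (_, _); rewrite /= mulrDr.
have theta_phi x : theta (phi x) = j x.
  rewrite /theta; apply: (canLR (mulrK Uxi)); rewrite -rmorphM; congr (j _).
  apply: iota_eq; rewrite (brM phiP) xiE.
  by congr (_, _); rewrite /= mulr1 mulrC.
have theta1 : theta 1 = 1 by rewrite -(br1 phiP) theta_phi rmorph1.
have theta_inj : injective theta.
  move=> z w /(congr1 (fun x => x * j xi)); rewrite /theta !divrK // => /j_inj ezw.
  have := congr1 phi ezw; rewrite !iotaE => ee.
  rewrite [z]surjective_pairing [w]surjective_pairing.
  by congr (_, _); apply: Xm_inj; [exact: (congr1 fst ee) | exact: (congr1 snd ee)].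
have theta0 : theta 0 = 0 by apply: (addrI (theta 0)); rewrite -thetaD !addr0.
have thetaN z : theta (- z) = - theta z.
  by apply: (addrI (theta z)); rewrite -thetaD !subrr theta0.
have theta_int z : integralOver j (theta z).
  have diag a : exists x, phi x = (a, a).
    by have [x xE] := br_lift phiP a 0; exists x; rewrite xE mulr0 addr0.
  have [u uE] := diag z.1; have [v vE] := diag z.2.
  exists (('X - u%:P) * ('X - v%:P)); first by rewrite monicMl ?monicXsubC.
  rewrite rmorphM /= !rmorphB /= !map_polyX !map_polyC /= rootE hornerM !hornerXsubC.
  rewrite -!theta_phi -!thetaN -!thetaD -thetaM uE vE.
  rewrite (_ : _ * _ = 0) ?theta0 //; congr (_, _); rewrite /=.
    by rewrite subrr mul0r.
  by rewrite subrr mulr0.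
have int_theta x : integralOver j x -> exists z, x = theta z.
  case=> p p_mon p_root; have [a [b [a_reg xE]]] := j_frac x.
  have Ua := j_unit _ a_reg.
  have [n sp] : exists n, size p = n.+1.
    by exists (size p).-1; rewrite prednK // size_poly_gt0 monic_neq0.
  have pn : p`_n = 1 by move: p_mon; rewrite monicE lead_coefE sp => /eqP.
  have key : b ^+ n = \sum_(i < n) - p`_i * b ^+ i * a ^+ (n - i).
    have e0 : \sum_(i < n.+1) j p`_i * (j b ^+ i * j a ^+ (n - i)) = 0.
      move/rootP: p_root; rewrite (@horner_coef_wide _ n.+1); last first.
        by rewrite -sp; exact: size_poly.
      move/(congr1 (fun y => y * j a ^+ n)); rewrite mul0r mulr_suml => e0; rewrite -[RHS]e0.
      apply: eq_bigr => i _; rewrite coef_map -mulrA; congr (_ * _).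
      have le_in : (i <= n)%N by rewrite -ltnS.
      rewrite xE exprMn exprVn -[X in _ = _ * _ ^+ X](subnKC le_in) exprD -mulrA; congr (_ * _).
      by rewrite mulKr // unitrX.
    apply: j_inj; rewrite rmorphXn rmorph_sum /=.
    move/eqP: e0; rewrite big_ord_recr /= pn rmorph1 mul1r subnn mulr1 addrC.
    rewrite addr_eq0 => /eqP ->; rewrite -sumrN; apply: eq_bigr => i _.
    by rewrite !rmorphM rmorphN !rmorphXn !mulNr mulrA.
  have [a1 a2] := br_regular a_reg.
  have key1 : (phi b).1 ^+ n = \sum_(i < n) (phi (- p`_i)).1 * (phi b).1 ^+ i * (phi a).1 ^+ (n - i).
    have := congr1 (fun x => (phi x).1) key; rewrite /= brX pair_exp /= br_sum fst_sum => ->.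
    by apply: eq_bigr => i _; rewrite !(brM phiP) !brX !pair_exp.
  have key2 : (phi b).2 ^+ n = \sum_(i < n) (phi (- p`_i)).2 * (phi b).2 ^+ i * (phi a).2 ^+ (n - i).
    have := congr1 (fun x => (phi x).2) key; rewrite /= brX pair_exp /= br_sum snd_sum => ->.
    by apply: eq_bigr => i _; rewrite !(brM phiP) !brX !pair_exp.
  have [z1 b1] := fps_int_closed (c := fun i => (phi (- p`_i)).1) a1 key1.
  have [z2 b2] := fps_int_closed (c := fun i => (phi (- p`_i)).2) a2 key2.
  exists (z1, z2); rewrite xE; apply: (canLR (mulrK Ua)).
  rewrite -!theta_phi -thetaM mulrC; congr theta.
  by rewrite [LHS]surjective_pairing b1 b2.
have ex_psi y : exists z, theta z = e y.
  have [z zE] := int_theta (e y) (iffLR (e_im _) (ex_intro _ y erefl)).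
  by exists z.
pose psi y := sval (cid (ex_psi y)).
have psiE y : theta (psi y) = e y := svalP (cid (ex_psi y)).
have lift z : exists y, psi y = z.
  have [y yE] := iffRL (e_im _) (theta_int z).
  by exists y; apply: theta_inj; rewrite psiE.
exists psi; split.
- by move=> x y; apply: theta_inj; rewrite thetaD !psiE rmorphD.
- by move=> x y; apply: theta_inj; rewrite thetaM !psiE rmorphM.
- by apply: theta_inj; rewrite psiE theta1 rmorph1.
- by move=> x y exy; apply: e_inj; rewrite -!psiE exy.
- by move=> a c; apply: lift.
by move=> x; exists ((psi x).2 - (psi x).1); rewrite mul1r addrC subrK.
Qed.
End BranchRing.

(** * From submodules to subspaces *)
Lemma card_eq_seq (C : eqType) (T : Type) (P : set T) (s : seq C) (g : C -> T) :
    uniq s -> (forall y, y \in s -> P (g y)) ->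
    (forall z, P z -> exists2 y, y \in s & g y = z) ->
    {in s &, injective g} -> (P #= `I_(size s))%card.
Proof.
move=> us gP gsurj ginj; rewrite card_eq_sym.
case: s us gP gsurj ginj => [|y0 s] us gP gsurj ginj.
  suff -> : P = set0 by rewrite II0 card_eq00.
  by rewrite -subset0 => z /gsurj[].
suff fbij : set_bij (`I_(size (y0 :: s))) P (fun i => g (nth y0 (y0 :: s) i)).
  exact: pcard_eq fbij.
split.
- by move=> i /= lt; apply: gP; exact: mem_nth.
- move=> i j /set_mem/= lti /set_mem/= ltj /ginj e.
  by apply/eqP; rewrite -(@nth_uniq _ y0 (y0 :: s)) // e // mem_nth.
move=> z /gsurj[y ys <-]; exists (index y (y0 :: s)); first by move: ys; rewrite -index_mem.
by rewrite nth_index.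
Qed.

Section Transfer.
Variables (k : finFieldType) (T : vectType k) (A : comNzRingType) (M : lmodType A).
Variables (psi : M -> T) (W : {vspace T}) (adm : pred {vspace T}) (n : nat).
Local Notation q := #|k|.
Hypothesis psiD : {morph psi : x y / x + y}.
Hypothesis psiW : forall y, y \in W <-> exists x, psi x = y.

Let psi0 : psi 0 = 0.
Proof. by apply: (addrI (psi 0)); rewrite -psiD !addr0. Qed.

Let psiN x : psi (- x) = - psi x.
Proof. by apply: (addrI (psi x)); rewrite -psiD !subrr psi0. Qed.

Let psiB x y : psi (x - y) = psi x - psi y.
Proof. by rewrite psiD psiN. Qed.

Let pre (S : {vspace T}) : set M := [set x | psi x \in S]%classic.

(** The cosets are represented by a complement of S in W. *)
Lemma preimage_index S : (S <= W)%VS -> has_index (pre S) (q ^ (\dim W - \dim S)).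
Proof.
move=> sSW; pose C := (W :\: S)%VS.
have dC : \dim C = (\dim W - \dim S)%N.
  by rewrite -(dimv_cap_compl W S) (capv_idPr sSW) addKn.
have CW y : y \in C -> y \in W by apply/subvP; exact: diffvSl.
pose D := [set y : finvect_type T | y \in C].
rewrite -dC -card_mem_vspace cardE /has_index.
apply: (@card_eq_seq (finvect_type T) _ _ _
  (fun y => [set z | psi z - (y : T) \in S]%classic)).
- exact: enum_uniq.
- move=> y; rewrite mem_enum inE => /CW/psiW[x <-]; exists x => //.
  apply/seteqP; split=> [_ [z Sz <-] | z /= Sz].
    by rewrite /= psiD addrC addKr.
  by exists (z - x); [rewrite /pre /= psiB | rewrite addrC subrK].
- move=> _ [x _ <-].
  have : psi x \in (C + S)%VS.
    by rewrite addv_diff (addv_idPl sSW); apply/psiW; exists x.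
  case/memv_addP => y Cy [s Ss xE]; exists (y : finvect_type T).
    by rewrite mem_enum inE.
  apply/seteqP; split=> [z /= Sz | _ [z /= Sz <-] /=].
    exists (z - x); last by rewrite addrC subrK.
    by rewrite /pre /= psiB xE opprD addrA memvB.
  by rewrite psiD xE addrC !addrA addNr add0r memvD.
move=> y y'; rewrite !mem_enum !inE => Cy Cy' /= eqg; have Wy := CW _ Cy.
have /psiW[x xE] := CW _ Cy.
have : [set z | psi z - (y : T) \in S]%classic x by rewrite /= xE subrr mem0v.
rewrite eqg /= xE => Syy.
have : (y : T) - y' \in (C :&: S)%VS by rewrite memv_cap Syy andbT memvB.
by rewrite capv_diff memv0 subr_eq0 => /eqP.
Qed.

(** The correspondence theorem: submodules that contain the kernel of psi are
    those of its image. *)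
Lemma fcoef_zeta :
    (forall S, (S <= W)%VS -> adm S -> submodule (pre S)) ->
    (forall N : set M, submodule N -> has_index N (q ^ n)%N ->
       exists S, [/\ (S <= W)%VS, adm S & forall x, N x <-> psi x \in S]) ->
  fcoef (zeta q M) n =
  #|[set S : {vspace T} | [&& (S <= W)%VS, adm S & (\dim S + n == \dim W)%N]]|%:R.
Proof.
move=> adm_sub sub_adm; congr _%:R; apply: card_fset_set; rewrite cardE.
have q1 : (1 < q)%N by exact: finNzRing_gt1.
have preE (S S' : {vspace T}) : (S <= W)%VS -> (S' <= W)%VS -> pre S = pre S' -> S = S'.
  move=> sS sS' e; apply/vspaceP => y.
  have [Wy|nWy] := boolP (y \in W); last first.
    have out (S0 : {vspace T}) : (S0 <= W)%VS -> (y \in S0) = false.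
      by move=> sS0; apply: contraNF nWy; exact: (subvP sS0).
    by rewrite !out.
  have /psiW[x <-] := Wy; apply/idP/idP => h.
    by have : pre S x by []; rewrite e.
  by have : pre S' x by []; rewrite -e.
apply: (@card_eq_seq _ _ _ _ pre); first exact: enum_uniq.
- move=> S; rewrite mem_enum inE => /and3P[sSW admS /eqP dS]; split.
    exact: adm_sub.
  by have := preimage_index sSW; rewrite -dS addKn.
- move=> N [subN idxN]; have [S [sSW admS NS]] := sub_adm N subN idxN.
  have NE : pre S = N by apply/seteqP; split=> x /NS.
  exists S; last exact: NE.
  rewrite mem_enum inE sSW admS /=.
  have := preimage_index sSW; rewrite NE /has_index => idxN'.
  move: idxN; rewrite /has_index (card_eql idxN') => /card_eq_II/eqP.
  rewrite eqn_exp2l // => /eqP <-; rewrite subnKC //; exact: dimvS.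
move=> S S'; rewrite !mem_enum !inE => /and3P[sS _ _] /and3P[sS' _ _].
exact: preE.
Qed.
End Transfer.

(** The sum of all subspaces contained in P. *)
Lemma vspace_of_pred (k : finFieldType) (T : vectType k) (P : T -> Prop) :
    P 0 -> (forall (a : k) x y, P x -> P y -> P (a *: x + y)) ->
  exists S : {vspace T}, forall y, y \in S <-> P y.
Proof.
move=> P0 Plin; have PD x y : P x -> P y -> P (x + y).
  by move=> Px Py; rewrite -[x]scale1r; exact: Plin.
exists (\sum_(W : {vspace T} | `[< forall x, x \in W -> P x >]) W)%VS => y; split.
  case/memv_sumP => v vP ->; elim/big_ind: _ => // W PW.
  by move/asboolP: (PW); apply; exact: vP.
move=> Py; apply: (subvP (@sumv_sup _ _ _ <[y]>%VS _ _ _ _ (subvv _))) (memv_line y).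
apply/asboolP => x /vlineP[a ->]; rewrite -[_ *: _]addr0; exact: Plin.
Qed.

(** * Truncation to finite dimension *)
Section Truncation.
Variables (k : finFieldType) (d b : nat).
Local Notation V := (fps k).
Local Notation U := 'M[k]_(d, b.+1).
Implicit Types (u : U) (v : 'rV[V]_d).

Definition shift_fun (u : U) : U :=
  \matrix_(i, j) (if (0 < j)%N then u i (inord j.-1) else 0).

Fact shift_linear : linear shift_fun.
Proof.
by move=> a u v; apply/matrixP => i j; rewrite !mxE; case: ifP; rewrite ?mulr0 ?addr0.
Qed.
HB.instance Definition _ := GRing.isLinear.Build k U U _ shift_fun shift_linear.

(** Multiplication by X on (V / X^(b+1))^d, the columns being the coefficients. *)
Definition shiftX : 'End(U) := linfun shift_fun.

Lemma shiftXE u i j : shiftX u i j = if (0 < j)%N then u i (inord j.-1) else 0.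
Proof. by rewrite lfunE mxE. Qed.

Lemma iter_shiftX n u i j :
  iter n shiftX u i j = if (n <= j)%N then u i (inord (j - n)) else 0.
Proof.
elim: n j => [|n IHn] j; first by rewrite subn0 inord_val.
rewrite iterS shiftXE; have [j0 | j0] := posnP (j : nat); first by rewrite j0.
have lt : (j.-1 < b.+1)%N by rewrite prednK // ltnW // ltn_ord.
rewrite IHn inordK // -ltnS prednK //; case: ifP => // le.
by congr (u i (inord _)); move: le; clia.
Qed.

Lemma nil_shiftX : exists n, ximg shiftX n fullv = 0%VS.
Proof.
exists b.+1; apply/eqP; rewrite -subv0; apply/subvP => y /memv_ximgP[x _ ->].
rewrite memv0; apply/eqP/matrixP => i j; rewrite iter_shiftX mxE.
by rewrite leqNgt ltn_ord.
Qed.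

Lemma lker_shiftX u : (u \in lker shiftX) -> forall i (j : 'I_b.+1), (j < b)%N -> u i j = 0.
Proof.
rewrite memv_ker => /eqP u0 i j lt; have := congr1 (fun w : U => w i (inord j.+1)) u0.
by rewrite shiftXE mxE inordK //= inord_val.
Qed.

Lemma deep_shiftX : (lker shiftX <= ximg shiftX b fullv)%VS.
Proof.
apply/subvP => u /lker_shiftX u0; apply/memv_ximgP.
exists (\matrix_(i, j) u i ord_max); first exact: memvf.
apply/matrixP => i j; rewrite iter_shiftX; case: leqP => [le|lt]; last exact: u0.
by rewrite mxE; congr (u i _); apply/val_inj => /=; have := ltn_ord j; move: le; clia.
Qed.

Definition last_col_fun (c : 'cV[k]_d) : U :=
  \matrix_(i, j) (if j == ord_max then c i ord0 else 0).
Fact last_col_linear : linear last_col_fun.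
Proof.
by move=> a u v; apply/matrixP => i j; rewrite !mxE; case: ifP; rewrite ?mulr0 ?addr0.
Qed.
HB.instance Definition _ :=
  GRing.isLinear.Build k 'cV[k]_d U _ last_col_fun last_col_linear.

Lemma dim_lker_shiftX : \dim (lker shiftX) = d.
Proof.
pose f := linfun last_col_fun.
have fE c i j : f c i j = if j == ord_max then c i ord0 else 0 by rewrite lfunE mxE.
have -> : lker shiftX = limg f.
  apply/vspaceP => u; apply/idP/memv_imgP => [/lker_shiftX u0 | [c _ ->]].
    exists (\col_i u i ord_max); first exact: memvf.
    apply/matrixP => i j; rewrite fE mxE; case: eqP => [-> //|ne].
    apply: u0; have := ltn_ord j; rewrite ltnS leq_eqVlt => /orP[/eqP e|//].
    by case: ne; apply/val_inj.
  rewrite memv_ker; apply/eqP/matrixP => i j; rewrite shiftXE fE mxE.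
  case: ifP => // j0; case: eqP => // /(congr1 val) /=.
  rewrite inordK; last by rewrite prednK // ltnW // ltn_ord.
  by have := ltn_ord j; move: j0; clia.
have f_inj : (fullv :&: lker f = 0)%VS.
  apply/eqP; rewrite -subv0; apply/subvP => c; rewrite memv_cap memv_ker memv0.
  case/andP=> _ /eqP c0; apply/eqP/matrixP => i j.
  by have := congr1 (fun w : U => w i ord_max) c0; rewrite fE eqxx !mxE (ord1 j).
by rewrite (limg_dim_eq f_inj) dimvf dim_matrix; exact: muln1.
Qed.

Definition trunc v : U := \matrix_(i, j) fcoef (v 0 i) j.

Lemma truncD v w : trunc (v + w) = trunc v + trunc w.
Proof. by apply/matrixP => i j; rewrite !mxE. Qed.

Lemma trunc_Xn n v : trunc (fpsX k ^+ n *: v) = iter n shiftX (trunc v).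
Proof.
apply/matrixP => i j; rewrite iter_shiftX !mxE fcoefXnM; case: ifP => // le.
by rewrite inordK // (leq_ltn_trans (leq_subr _ _)).
Qed.

Lemma truncZ a v : trunc (a *: v) = \sum_(l < b.+1) fcoef a l *: iter l shiftX (trunc v).
Proof.
apply/matrixP => i j; rewrite summxE !mxE fcoef_mul.
rewrite (big_ord_widen b.+1 (fun l => fcoef a l * fcoef (v 0 i) (j - l))) ?ltn_ord //.
rewrite big_mkcond; apply: eq_bigr => l _; rewrite mxE iter_shiftX ltnS.
case: ifP => le; rewrite ?mulr0 // mxE inordK // (leq_ltn_trans (leq_subr _ _)) //.
Qed.

Lemma trunc_surj u : exists v, trunc v = u.
Proof.
exists (\row_i Fps (fun j => if (j < b.+1)%N then u i (inord j) else 0)).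
by apply/matrixP => i j; rewrite !mxE /= ltn_ord inord_val.
Qed.

Lemma trunc_eq0 v : trunc v = 0 -> exists w, v = fpsX k ^+ b.+1 *: w.
Proof.
move=> v0; have ex i : exists g, v 0 i = fpsX k ^+ b.+1 * g.
  apply: fpsXn_div => j lt; have := congr1 (fun w : U => w i (Ordinal lt)) v0.
  by rewrite !mxE.
exists (\row_i sval (cid (ex i))); apply/rowP => i; rewrite !mxE.
exact: svalP (cid (ex i)).
Qed.
End Truncation.

Section BranchZeta.
Variables (k : finFieldType) (m : nat) (A : comNzRingType) (phi : A -> fps k * fps k).
Hypothesis phiP : branch_ring m phi.
Variables (d b n : nat).
Local Notation q := #|k|.
Local Notation V := (fps k).
Local Notation U := 'M[k]_(d, b.+1).
Local Notation SX := (@shiftX k d b).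
Hypothesis large : (q ^ n + m <= b.+1)%N.

Let c1 (v : 'rV[A]_d) : 'rV[V]_d := \row_i (phi (v 0 i)).1.
Let c2 (v : 'rV[A]_d) : 'rV[V]_d := \row_i (phi (v 0 i)).2.
Let psi (v : 'rV[A]_d) : U * U := (trunc b (c1 v), trunc b (c2 v)).

Let psiD : {morph psi : x y / x + y}.
Proof.
move=> x y; congr (_, _); rewrite /= -truncD; congr trunc;
  by apply/rowP => i; rewrite !mxE (brD phiP).
Qed.

Let psi0 : psi 0 = 0.
Proof. by apply: (addrI (psi 0)); rewrite -psiD !addr0. Qed.

Let psiB x y : psi (x - y) = psi x - psi y.
Proof. by apply/eqP; rewrite eq_sym subr_eq -psiD subrK. Qed.

Let c1Z a v : c1 (a *: v) = (phi a).1 *: c1 v.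
Proof. by apply/rowP => i; rewrite !mxE (brM phiP). Qed.

Let c2Z a v : c2 (a *: v) = (phi a).2 *: c2 v.
Proof. by apply/rowP => i; rewrite !mxE (brM phiP). Qed.

Let lift_pair (v w : 'rV[V]_d) : exists x, c1 x = v /\ c2 x = v + fpsX k ^+ m *: w.
Proof.
have ex i := br_lift phiP (v 0 i) (w 0 i).
have xE i := svalP (cid (ex i)).
exists (\row_i sval (cid (ex i))).
by split; apply/rowP => i; rewrite !mxE xE.
Qed.

Local Notation XX := (pairf SX SX).
Local Notation YY := (pairf (0 : 'End(U)) (lpow SX m)).

Let psiW y : y \in Rlat SX m <-> exists x, psi x = y.
Proof.
rewrite mem_Rlat; split=> [| [x <-]].
  case: y => [u1 u2] /= /memv_ximgP[w _ eqw].
  have [v1 v1E] := trunc_surj u1; have [v2 v2E] := trunc_surj (- w).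
  have [x [x1 x2]] := lift_pair v1 v2; exists x.
  rewrite /psi x1 x2 truncD trunc_Xn v1E v2E; congr (_, _).
  have iterN l u : iter l SX (- u) = - iter l SX u.
    by elim: l => //= l ->; rewrite linearN.
  by rewrite iterN -eqw opprB addrC subrK.
have ex i := br_cong phiP (x 0 i).
pose w : 'rV[V]_d := \row_i sval (cid (ex i)).
have c2E : c2 x = c1 x + fpsX k ^+ m *: w.
  by apply/rowP => i; rewrite !mxE; exact: svalP (cid (ex i)).
rewrite /= c2E truncD opprD addrA subrr sub0r memvN trunc_Xn.
by apply: memv_iter; exact: memvf.
Qed.

Let fst_sumU (I : Type) (r : seq I) (F : I -> U * U) :
  (\sum_(i <- r) F i).1 = \sum_(i <- r) (F i).1.
Proof. exact: (big_morph fst (fun _ _ => erefl) erefl). Qed.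

Let snd_sumU (I : Type) (r : seq I) (F : I -> U * U) :
  (\sum_(i <- r) F i).2 = \sum_(i <- r) (F i).2.
Proof. exact: (big_morph snd (fun _ _ => erefl) erefl). Qed.

Let psiZ a x : exists g : V, psi (a *: x) =
  \sum_(l < b.+1) fcoef (phi a).1 l *: iter l XX (psi x) +
  \sum_(l < b.+1) fcoef g l *: iter l XX (YY (psi x)).
Proof.
have [g gE] := br_cong phiP a; exists g.
apply/eqP; rewrite -pair_eqE /pair_eq /= !fst_sumU !snd_sumU; apply/andP; split; apply/eqP.
  rewrite c1Z truncZ [X in _ + X]big1 ?addr0; last first.
    by move=> l _; rewrite iter_pairf /= pairfE /= zero_lfunE -lpowE linear0 scaler0.
  by apply: eq_bigr => l _; rewrite iter_pairf.
rewrite c2Z gE scalerDl truncD truncZ mulrC -scalerA truncZ trunc_Xn.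
congr (_ + _); apply: eq_bigr => l _; rewrite iter_pairf //=.
by rewrite pairfE /= lpowE.
Qed.

Let Rsub_submodule (S : {vspace (U * U)%type}) : stable XX S -> stable YY S ->
  submodule [set x | psi x \in S]%classic.
Proof.
move=> stX stY; split; first by rewrite inE /= psi0 mem0v.
move=> a x y; rewrite !inE /= => Sx Sy; rewrite psiD memvD //.
have [g ->] := psiZ a x; rewrite memvD // memv_suml // => l _; rewrite memvZ //.
  exact: stable_iter.
by apply: stable_iter => //; exact: stableV.
Qed.

Section Submodule.
Variable N : set 'rV[A]_d.
Hypothesis subN : submodule N.
Hypothesis idxN : has_index N (q ^ n)%N.

Let N0 : N 0. Proof. by case: subN; rewrite inE. Qed.

Let NZ a x : N x -> N (a *: x).
Proof.
move=> Nx; case: subN => _ /(_ a x 0); rewrite !inE addr0; exact.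
Qed.

Let ND x y : N x -> N y -> N (x + y).
Proof.
by move=> Nx Ny; case: subN => _ /(_ 1 x y); rewrite !inE scale1r; apply.
Qed.

Let NB x y : N x -> N y -> N (x - y).
Proof. by move=> Nx Ny; rewrite -scaleN1r; apply: ND => //; exact: NZ. Qed.

(* Among q^n + 1 powers of X two agree modulo N, and 1 - X^e is a unit. *)
Let nilpotent_mod xi x : phi xi = (fpsX k, fpsX k) -> N (xi ^+ (q ^ n) *: x).
Proof.
move=> xiE; pose f i := [set xi ^+ i *: x + y | y in N]%classic.
have [inj | ninj] := pselect ({in iota 0 (q ^ n).+1 &, injective f}).
  have card_f : ([set z | exists2 i, i \in iota 0 (q ^ n).+1 & f i = z] #=
       `I_(size (iota 0 (q ^ n).+1)))%card.
    by apply: (card_eq_seq (g := f)) => //; [exact: iota_uniq | move=> i; exists i].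
  have : (`I_(q ^ n).+1 #<= `I_(q ^ n))%card.
    move: card_f; rewrite size_iota => /card_eqPle[_ le1].
    apply: card_le_trans le1 _.
    move: idxN => /card_eqPle[le2 _]; apply: card_le_trans le2.
    apply: subset_card_le => _ [i _ <-]; exists (xi ^+ i *: x) => //.
  by rewrite card_le_II ltnn.
have [i [j [lt_ij le_j eqf]]] : exists i j, [/\ (i < j)%N, (j <= q ^ n)%N & f i = f j].
  apply: contrapT => /forallNP H; apply: ninj => i j.
  rewrite !mem_iota /= !add0n !ltnS => lei lej eqf; apply/eqP/negPn/negP => ne.
  case: (ltngtP i j) => lt; last by rewrite lt eqxx in ne.
    by have /forallNP/(_ j)[] := H i.
  by have /forallNP/(_ i)[] := H j.
have Nij : N (xi ^+ i *: x - xi ^+ j *: x).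
  have : f i (xi ^+ i *: x) by exists 0; rewrite ?addr0.
  by rewrite eqf => -[y Ny <-]; rewrite addrC addKr.
pose g : V := (1 - fpsX k ^+ (j - i))^-1.
have gE : g * (1 - fpsX k ^+ (j - i)) = 1.
  apply: mulVr; rewrite unfold_in /= /fps_unit fcoefB.
  have -> : fcoef (fpsX k ^+ (j - i)) 0 = 0.
    by rewrite fcoef0_exp /= expr0n; move: lt_ij; rewrite -subn_gt0; case: (j - i)%N.
  by rewrite subr0 unitr1.
have [y yE] := br_lift phiP g 0; rewrite mulr0 addr0 in yE.
have yP : y * (1 - xi ^+ (j - i)) = 1.
  apply: (br_inj phiP); rewrite (brM phiP) (brB phiP) (brX phiP) !(br1 phiP) yE xiE pair_exp.
  by congr (_, _).
have -> : xi ^+ (q ^ n) *: x = (xi ^+ (q ^ n - i) * y) *: (xi ^+ i *: x - xi ^+ j *: x).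
  rewrite -scalerBl scalerA; congr (_ *: _).
  have -> : xi ^+ i - xi ^+ j = xi ^+ i * (1 - xi ^+ (j - i)).
    by rewrite mulrBr mulr1 -exprD subnKC // ltnW.
  by rewrite mulrACA yP mulr1 -exprD subnK // (leq_trans (ltnW lt_ij)).
exact: NZ.
Qed.


(* The kernel consists of the multiples of X^(b+1), and X^m (V x V) lies in A, so an
   element of the kernel is X^(q^n) times an element of A^d. *)
Let ker_sub x : psi x = 0 -> N x.
Proof.
move=> x0; have [xi xiE] := br_lift phiP (fpsX k) 0; rewrite mulr0 addr0 in xiE.
have [w1 w1E] := trunc_eq0 (congr1 fst x0 : trunc b (c1 x) = 0).
have [w2 w2E] := trunc_eq0 (congr1 snd x0 : trunc b (c2 x) = 0).
pose e := (b.+1 - (q ^ n + m))%N.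
have [y [y1 y2]] := lift_pair (fpsX k ^+ (m + e) *: w1) (fpsX k ^+ e *: (w2 - w1)).
suff -> : x = xi ^+ (q ^ n) *: y by exact: nilpotent_mod.
have bE : (b.+1 = q ^ n + (m + e))%N by rewrite addnA subnKC.
apply/rowP => i; apply: (br_inj phiP).
rewrite [LHS]surjective_pairing [RHS]surjective_pairing; congr (_, _).
  have := congr1 (fun r : 'rV[V]_d => r 0 i) w1E; rewrite !mxE => ->.
  have := congr1 (fun r : 'rV[V]_d => r 0 i) y1; rewrite !mxE => y1i.
  by rewrite (brM phiP) (brX phiP) xiE pair_exp /= y1i bE exprD mulrA.
have := congr1 (fun r : 'rV[V]_d => r 0 i) w2E; rewrite !mxE => ->.
have := congr1 (fun r : 'rV[V]_d => r 0 i) y2; rewrite !mxE => y2i.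
rewrite (brM phiP) (brX phiP) xiE pair_exp /= y2i bE !exprD; ring.
Qed.

Let submodule_Rsub : exists S, [/\ (S <= Rlat SX m)%VS, stable XX S && stable YY S
  & forall x, N x <-> psi x \in S].
Proof.
have [] := @vspace_of_pred k (U * U)%type (fun y => exists2 x, N x & psi x = y).
- by exists 0.
- move=> a _ _ [x Nx <-] [y Ny <-].
  have [c cE] := br_lift phiP (fpsC a) 0; rewrite mulr0 addr0 in cE.
  exists (c *: x + y); first by apply: ND => //; exact: NZ.
  rewrite psiD; congr (_ + _).
  have scaleC (v : 'rV[V]_d) : trunc b (fpsC a *: v) = a *: trunc b v.
    by apply/matrixP => i j; rewrite !mxE fcoefCM.
  by congr (_, _); rewrite ?c1Z ?c2Z cE scaleC.
move=> S SE; exists S; split; last 1 first.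
- move=> x; split=> [Nx | /SE[y Ny eqxy]]; first by apply/SE; exists x.
  rewrite -[x](subrK y) addrC; apply: ND => //; apply: ker_sub.
  by rewrite psiB eqxy subrr.
- by apply/subvP => y /SE[x Nx <-]; apply/psiW; exists x.
apply/andP; split; apply/subvP => _ /memv_imgP[y /SE[x Nx <-] ->]; apply/SE.
  have [xi xiE] := br_lift phiP (fpsX k) 0; rewrite mulr0 addr0 in xiE.
  exists (xi *: x); first exact: NZ.
  rewrite pairfE /psi c1Z c2Z xiE /=.
  by congr (_, _); rewrite -[fpsX k]expr1 trunc_Xn.
have [eta etaE] := br_lift phiP 0 1; rewrite mulr1 add0r in etaE.
exists (eta *: x); first exact: NZ.
rewrite pairfE /psi c1Z c2Z etaE /= zero_lfunE lpowE trunc_Xn; congr (_, _).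
by rewrite scale0r; apply/matrixP => i j; rewrite !mxE fcoef0.
Qed.

Definition submodule_Rsub_ex := submodule_Rsub.
End Submodule.

(** The bound on b makes the kernel of truncation lie in every submodule of index
    q^n. *)
Lemma fcoef_zeta_branch :
  fcoef (zeta q 'rV[A]_d) n =
  #|[set S : {vspace (U * U)%type} |
      Rsub SX m S && (\dim S + n == \dim (Rlat SX m))%N]|%:R.
Proof.
rewrite (@fcoef_zeta k (U * U)%type A _ psi (Rlat SX m)
   (fun S => stable XX S && stable YY S) n psiD psiW).
- by congr _%:R; apply: eq_card => S; rewrite !inE /Rsub -!andbA.
- by move=> S _ /andP[]; exact: Rsub_submodule.
exact: submodule_Rsub_ex.
Qed.
End BranchZeta.

(** * The zeta function of the normalization *)
Section SplitCount.
Variables (k : finFieldType) (U : vectType k) (X : 'End(U)) (n : nat).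
Local Notation q := #|k|.
Local Notation d := (\dim (lker X)).
Local Notation XX := (pairf X X).
Local Notation p1 := (lfun_fst U).
Local Notation p2 := (lfun_snd U).
Implicit Types (S : {vspace (U * U)%type}).

Hypothesis nilX : exists b, ximg X b fullv = 0%VS.
Hypothesis deep : (lker X <= ximg X n fullv)%VS.

(** For m = 0 the idempotent (0, 1) splits N. *)
Lemma Rsub0_split S : Rsub X 0 S -> S = (p1 @^-1: (p1 @: S) :&: p2 @^-1: (p2 @: S))%VS.
Proof.
case/and3P=> _ _ stY; apply/vspaceP => [[a b]].
rewrite memv_cap -!memv_preim p1E p2E /=.
have H a' b' : (a', b') \in S -> (0, b') \in S /\ (a', 0) \in S.
  move=> Sx; have S2 : (0, b') \in S.
    by have := stableV stY Sx; rewrite pairfE /= zero_lfunE id_lfunE.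
  split=> //; suff -> : (a', 0) = (a', b') - (0, b') by exact: memvB.
  by congr (_, _); rewrite /= ?subr0 ?subrr.
apply/idP/andP => [Sx | [/img_fstP[b' /H[_ S1]] /img_sndP[a' /H[S2 _]]]].
  by rewrite (mem_img_fst Sx) (mem_img_snd Sx).
suff -> : (a, b) = (a, 0) + (0, b) by exact: memvD.
by congr (_, _); rewrite /= ?addr0 ?add0r.
Qed.

Lemma dim_split (N1 N2 : {vspace U}) (S := (p1 @^-1: N1 :&: p2 @^-1: N2)%VS) :
  [/\ (p1 @: S = N1)%VS, (p2 @: S = N2)%VS & \dim S = (\dim N1 + \dim N2)%N].
Proof.
have memS a b : ((a, b) \in S) = (a \in N1) && (b \in N2).
  by rewrite memv_cap -!memv_preim p1E p2E.
have p2S : (p2 @: S = N2)%VS.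
  apply/vspaceP => b; apply/idP/idP => [/img_sndP[a] | Nb].
    by rewrite memS => /andP[].
  by apply: (@mem_img_snd _ _ _ 0); rewrite memS mem0v.
split=> //.
  apply/vspaceP => a; apply/idP/idP => [/img_fstP[b] | Na].
    by rewrite memS => /andP[].
  by apply: (@mem_img_fst _ _ _ _ 0); rewrite memS mem0v andbT.
rewrite -(limg_ker_dim p2 S) p2S; congr (_ + _)%N.
suff -> : (S :&: lker p2 = lfun_inl U @: N1)%VS by rewrite dim_i1.
apply/vspaceP => [[a b]]; rewrite memv_cap memS memv_ker p2E mem_i1 /=.
by case: eqP => [->|]; rewrite ?mem0v ?andbT ?andbF.
Qed.

Lemma dim_Rlat0 : \dim (Rlat X 0) = (\dim (fullv : {vspace U}) + \dim (fullv : {vspace U}))%N.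
Proof.
have [_ _ <-] := dim_split fullv fullv; congr (\dim _).
by apply/vspaceP => x; rewrite mem_Rlat memv_cap -!memv_preim !memvf.
Qed.

Lemma card_Rsub0 :
  #|[set S | Rsub X 0 S && (\dim S + n == \dim (Rlat X 0))%N]|%:R =
  fcoef (span_series q d d * span_series q d d) n.
Proof.
pose C e := [set N : {vspace U} | [&& (N <= fullv)%VS, stable X N, (N + fullv == fullv)%VS
                            & (\dim N + e == \dim (fullv : {vspace U}))%N]].
have stf : stable X fullv by exact: subvf.
have cardC e : (e <= n)%N -> #|C e|%:R = fcoef (span_series q d d) e.
  move=> le; rewrite /C (card_spanning_lattices nilX stf stf (subvf _)); last first.
    by apply: subv_trans deep _; exact: ximg_anti.
  congr (fcoef (span_series _ _ _) _).
  rewrite (addv_idPl (subvf _)) (@dim_limg_ker _ _ X fullv) ?subvf // addKn //.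
set A := [set S | _].
have AP S : S \in A -> [/\ Rsub X 0 S, \dim S = (\dim (p1 @: S)%VS + \dim (p2 @: S)%VS)%N
    & (\dim S + n = \dim (fullv : {vspace U}) + \dim (fullv : {vspace U}))%N].
  rewrite inE dim_Rlat0 => /andP[RS /eqP dS]; split=> //.
  by rewrite {1}(Rsub0_split RS); have [_ _ ->] := dim_split (p1 @: S)%VS (p2 @: S)%VS.
pose c S := (\dim (fullv : {vspace U}) - \dim (p1 @: S)%VS)%N.
have cP S : S \in A -> (c S < n.+1)%N.
  case/AP=> _ d1 d2; rewrite ltnS /c.
  by move: d1 d2 (dimvS (subvf (p1 @: S)%VS)) (dimvS (subvf (p2 @: S)%VS)); clia.
rewrite fcoef_mul -sum1_card (partition_big (fun S => inord (c S) : 'I_n.+1) xpredT) //.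
rewrite natr_sum; apply: eq_bigr => e _.
have e_le := ltn_ord e.
rewrite -cardC; last by rewrite -ltnS.
rewrite -cardC; last exact: leq_subr.
rewrite -natrM -cardsX -[RHS]mulr1.
set A_e := [set S in A | inord (c S) == e].
rewrite (_ : \sum_(_ in _ | _) _ = #|A_e|)%N; last first.
  by rewrite -sum1_card; apply: eq_bigl => S; rewrite [in RHS]inE.
apply: (card_uniform_fibers_natr (f := fun S => (p1 @: S, p2 @: S)%VS)) => [S|].
  rewrite inE => /andP[SA /eqP/(congr1 val)]; rewrite /= inordK ?cP // => cE.
  have [RS d1 d2] := AP S SA; have [_ stX _] := and3P RS.
  rewrite !inE /= !subvf (stable_p1 stX) (stable_p2 stX) !(addv_idPr (subvf _)) !eqxx /=.
  apply/andP; split; apply/eqP; move: cE d1 d2; rewrite /c.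
    by move: (dimvS (subvf (p1 @: S)%VS)); clia.
  by move: (dimvS (subvf (p1 @: S)%VS)) (dimvS (subvf (p2 @: S)%VS)) e_le; clia.
move=> [N1 N2]; rewrite !inE /= => /andP[/and4P[_ st1 _ /eqP d1] /and4P[_ st2 _ /eqP d2]].
rewrite [X in X%:R](_ : _ = 1%N) //; apply/eqP/cards1P.
exists (p1 @^-1: N1 :&: p2 @^-1: N2)%VS; apply/setP => S; rewrite !inE.
apply/andP/eqP => [[/andP[/andP[RS _] _] /eqP[<- <-]] | ->]; first exact: Rsub0_split.
have [e1 e2 dS] := dim_split N1 N2.
rewrite /c e1 e2 dS eqxx dim_Rlat0; split=> //.
have -> : (\dim (fullv : {vspace U}) - \dim N1 = e)%N by rewrite -d1 addKn.
rewrite inord_val eqxx andbT; apply/andP; split; last first.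
  by apply/eqP; move: d1 d2 e_le; clia.
apply/and3P; split.
- by apply/subvP => x _; rewrite mem_Rlat memvf.
- apply/subvP => _ /memv_imgP[x Sx ->]; move: Sx.
  rewrite !memv_cap -!memv_preim !p1E !p2E pairfE /= => /andP[h1 h2].
  by rewrite !stableV.
apply/subvP => _ /memv_imgP[x Sx ->]; move: Sx.
rewrite !memv_cap -!memv_preim !p1E !p2E pairfE /= zero_lfunE id_lfunE => /andP[_ ->].
by rewrite mem0v.
Qed.
End SplitCount.

(** * The formula *)
Section ZetaSeries.
Variables (k : finFieldType) (d : nat).
Local Notation q := #|k|.
Local Notation t := (fpsX rat).
Local Notation qq n := (qpoch (q%:R^-1 : rat) q%:R^-1 n).

Lemma zeta_normalization (A : comNzRingType) (phi : A -> fps k * fps k) :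
  branch_ring 0 phi -> zeta q 'rV[A]_d = span_series q d d * span_series q d d.
Proof.
move=> phiP; apply: fpsP => n; set b := (q ^ n + n)%N.
rewrite (@fcoef_zeta_branch _ _ _ _ phiP d b n); last by rewrite /b; clia.
have le_nb : (n <= b)%N by exact: leq_addl.
rewrite card_Rsub0 ?dim_lker_shiftX //; first exact: nil_shiftX.
by apply: subv_trans (deep_shiftX _ _ _) _; apply: ximg_anti => //; exact: subvf.
Qed.

Variable m : nat.
Hypothesis m_gt0 : (0 < m)%N.

Definition hall_weight (l mu : seq nat) : rat :=
  skew_hall q%:R (nseq d m) l * skew_hall q%:R l mu *
  (q%:R ^+ (d * (sumn l - sumn mu)) * (qq (conj_part l m) / qq (conj_part mu m))).

Lemma zeta_R22 : zeta q 'rV[R22 k m]_d =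
  \sum_(l <- parts m d) \sum_(mu <- parts m d | part_sub mu l)
    fpsC (hall_weight l mu) * (t ^+ (2 * sumn l - sumn mu) *
      (span_series q d (conj_part l m) * span_series q d (conj_part l m))).
Proof.
apply: fpsP => n; set b := (q ^ n + n + m)%N.
rewrite (@fcoef_zeta_branch _ _ _ _ (R22_branch_ring k m_gt0) d b n); last by rewrite /b; clia.
have deep : (lker (shiftX k d b) <= ximg (shiftX k d b) (n + m) fullv)%VS.
  apply: subv_trans (deep_shiftX _ _ _) _; apply: ximg_anti; first exact: subvf.
  by rewrite /b -addnA leq_addl.
have dE := dim_lker_shiftX k d b.
rewrite (@card_Rsub _ _ _ m n (nil_shiftX k d b) m_gt0 deep _ (parts m d)
  (fun l i => conj_part l i.+1)) ?dE.
- congr (fcoef _ n); rewrite big_seq [RHS]big_seq; apply: eq_bigr => l.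
  rewrite mem_parts => /and3P[pl le_ld al].
  rewrite big_seq_cond [RHS]big_seq_cond; apply: eq_big => [mu|mu /andP[]].
    rewrite mem_parts; case: and3P => //= -[pmu _ almu].
    apply/forallP/idP => [le | /(part_subE pl pmu) le i]; last exact: le.
    apply/(part_subE pl pmu) => i; have [lt|ge] := ltnP i m.
      exact: (le (Ordinal lt)).
    by rewrite (conj_part_large almu).
  rewrite mem_parts => /and3P[pmu _ almu] /forallP/= le_i.
  have le i : (conj_part mu i.+1 <= conj_part l i.+1)%N.
    have [lt|ge] := ltnP i m; first exact: (le_i (Ordinal lt)).
    by rewrite (conj_part_large almu).
  rewrite !(sum_conj_part al) !(sum_conj_part almu) prednK //.
  congr (fpsC _ * _); rewrite /type_coef /hall_weight dE prednK //.
  rewrite (sum_conj_part al) (sum_conj_part almu) natrX.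
  rewrite (skew_hall_rect k m_gt0 pl le_ld al) (skew_hallE k pl pmu al le).
  congr (_%:R * _ * _); apply: eq_hall_count => // i _.
  by rewrite /compl_type dE; case: ifP => // lt; rewrite subnSK.
- exact: undup_uniq.
- move=> l; rewrite mem_parts => /and3P[_ le_ld _] i.
  by rewrite conj_part_anti (leq_trans (conj_part_size _ _)).
- by move=> l; rewrite mem_parts => /and3P[_ _ al]; exact: conj_part_large al _.
- exact: parts_code.
move=> l mu; rewrite !mem_parts => /and3P[pl _ al] /and3P[pmu _ almu] /forallP/= le i.
have [lt|ge] := ltnP i m; first exact: (le (Ordinal lt)).
by rewrite (conj_part_large almu).
Qed.
End ZetaSeries.

Lemma part_sub_parts m d l mu : l \in parts m d -> is_partition mu ->
  part_sub mu l -> mu \in parts m d.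
Proof.
rewrite !mem_parts => /and3P[pl le_ld al] pmu /(part_subE pl pmu) le.
rewrite pmu -conj_part1 // (leq_trans (le 0%N)) ?conj_part1 //=.
have := le m; rewrite (conj_part_large al) // leqn0 -leqn0 leqNgt -has_count => /hasPn h.
by apply/allP => x /h; rewrite -ltnNge ltnS.
Qed.

Lemma part_sub_sumn m d l mu : l \in parts m d -> is_partition mu ->
  part_sub mu l -> (sumn mu <= sumn l)%N.
Proof.
move=> lp pmu sub; have := part_sub_parts lp pmu sub; move: lp.
rewrite !mem_parts => /and3P[pl _ al] /and3P[_ _ almu].
rewrite -(sum_conj_part al) -(sum_conj_part almu); apply: leq_sum => i _.
exact: (iffLR (part_subE pl pmu)).
Qed.

Unset Implicit Arguments.
Local Open Scope classical_set_scope.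
Local Open Scope ring_scope.

Theorem theorem9p11 (k : finFieldType) (m d : nat) (hm : (1 <= m)%N)
    (Rt : comNzRingType) (hRt : is_normalization (R22 k m) Rt) :
  let q : nat := #|k| in
  let t : fps rat := fpsX rat in
  nu q d (R22 k m) Rt =
  \sum_(lm \in [set lm : seq nat * seq nat |
                  is_partition lm.1 /\ is_partition lm.2])
    (let l := lm.1 in let mu := lm.2 in
     fpsC (skew_hall q%:R (nseq d m) l * skew_hall q%:R l mu *
           (qpoch (q%:R^-1 : rat) q%:R^-1 (conj_part l m) /
            qpoch (q%:R^-1 : rat) q%:R^-1 (conj_part mu m))) *
     qpoch t q%:R (d - conj_part l m) ^+ 2 *
     t ^+ sumn l *
     (q%:R ^+ d * t) ^+ (sumn l - sumn mu)).
Proof.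
move=> q t.
have [psi psiP] := normalization_branch_ring (R22_branch_ring k hm) hRt.
rewrite /nu -/q (zeta_normalization d psiP) (zeta_R22 k d hm) -/q -/t.
pose s := [seq (l, mu) | l <- parts m d, mu <- parts m d].

have us : uniq s by apply: allpairs_uniq; rewrite ?undup_uniq // => -[? ?] [? ?].
rewrite -(fsbig_widen [set` s] [set lm | is_partition lm.1 /\ is_partition lm.2]); first last.
- move=> [l mu] /= [[pl pmu]] /negP ns.
  have [sub_l|nsub_l] := boolP (part_sub l (nseq d m)); last first.
    by rewrite {1}/skew_hall (negPf nsub_l) !mul0r.
  have [sub_mu|nsub_mu] := boolP (part_sub mu l); last first.
    by rewrite {2}/skew_hall (negPf nsub_mu) mulr0 !mul0r.
  have lp : l \in parts m d by rewrite mem_parts pl -part_sub_rect.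
  case/negP: ns; apply/allpairsP; exists (l, mu); split=> //=.
  exact: part_sub_parts sub_mu.
- move=> [l mu] /= /allpairsP[[l' mu'] /= []].
  by rewrite !mem_parts => /and3P[pl _ _] /and3P[pmu _ _] [-> ->].
rewrite -fsbig_seq // big_allpairs mulr_suml.
rewrite big_seq [RHS]big_seq; apply: eq_bigr => l lp.
rewrite mulr_suml [LHS]big_mkcond [LHS]big_seq [RHS]big_seq; apply: eq_bigr => mu mup.
have pmu : is_partition mu by move: mup; rewrite mem_parts => /and3P[].
case: ifPn => [sub_mu | nsub_mu]; last first.
  by rewrite /skew_hall (negPf nsub_mu) mulr0 !mul0r.
have le_s := part_sub_sumn lp pmu sub_mu.
rewrite /hall_weight /span_series subnn [qpoch t _ 0]/qpoch big_ord0.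
set P := qpoch t _ d; set Q := qpoch t _ (d - _).
have UP : P \is a GRing.unit by exact: qpoch_unit.
have -> : (1 / P * (1 / P))^-1 = P * P by rewrite !mul1r -invrM // invrK.
set a := skew_hall _ _ _; set b := skew_hall _ _ _; set c := _ / _.
have -> : a * b * (q%:R ^+ (d * (sumn l - sumn mu)) * c) =
   a * b * c * (q ^ (d * (sumn l - sumn mu)))%:R by rewrite natrX; ring.
rewrite fpsCM fpsC_nat natrX exprMn -exprM.
have -> : (2 * sumn l - sumn mu = sumn l + (sumn l - sumn mu))%N by move: le_s; clia.
rewrite exprD expr2.
have -> : Q / P * (Q / P) = Q * Q / (P * P) by rewrite invrM //; ring.
have UPP : P * P \is a GRing.unit by rewrite unitrM UP.
rewrite -!mulrA; congr (_ * _).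
rewrite [Q * (Q * _)]mulrA.
rewrite [(P * P)^-1 * _]mulVr //.
ring.
Qed.
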